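(* Let $\Omega\subset\mathbb{C}^n$ be a bounded domain with Lipschitz boundary and let $p,q$ satisfy $$1\leq p<\infty,\quad 1\leq q<\infty,\quad q(2n-1)<2np.$$ Then there is a constant $\delta=\delta(\Omega,p,q)>0$ (depending only on $\Omega,p,q$) such that $$\delta\left(\int_{\Omega}|f|^q\,d\lambda\right)^{1/q}\leq\left(\int_{\partial\Omega}|f|^p\,dS\right)^{1/p},\qquad\forall f\in\mathcal{O}(\Omega)\cap C^0(\overline\Omega).$$
   Context: A domain is a connected open set. $\mathcal{O}(\Omega)$ is the space of holomorphic functions on $\Omega$, and $C^0(\overline\Omega)$ is the space of complex valued continuous functions on $\overline\Omega$. $d\lambda$ is Lebesgue measure and $dS$ is the $(2n-1)$-dimensional Hausdorff (surface) measure on $\partial\Omega$. *)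

(* Defs.v *)
From HB Require Import structures.
From mathcomp Require Import all_boot all_order all_algebra complex.
From mathcomp Require Import all_classical all_reals all_analysis.

Set Implicit Arguments.
Unset Strict Implicit.
Unset Printing Implicit Defensive.

Import Order.TTheory GRing.Theory Num.Theory.
Import numFieldNormedType.Exports.

Local Open Scope classical_set_scope.
Local Open Scope ring_scope.
Local Open Scope complex_scope.

HB.instance Definition _ (R : rcfType) := NormedModule.copy R[i] R[i]^o.

(* C^n is 'rV[R[i]]_n.  Its library topology comes from the sup norm, which
   induces the Euclidean topology; metric notions that depend on the Euclidean
   norm go through the identification of C^n with R^(2n) given by [realify]. *)
Definition realify (R : realType) (n : nat) (z : 'rV[R[i]]_n) : 'rV[R]_(n + n) :=
  row_mx (map_mx (@complex.Re R) z) (map_mx (@complex.Im R) z).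

Definition euclid_norm (R : realType) (m : nat) (x : 'rV[R]_m) : R :=
  Num.sqrt (\sum_(k < m) x ord0 k ^+ 2).

Definition topological_boundary (T : topologicalType) (A : set T) : set T :=
  closure A `\` A^°.

(* Near each boundary point, in suitable orthonormal coordinates y of R^(2n),
   D is the region above the graph of a Lipschitz function of the coordinates
   other than y_i.  (A translation of the coordinates is absorbed in phi.) *)
Definition lipschitz_boundary (R : realType) (n : nat)
    (D : set 'rV[R[i]]_n) : Prop :=
  forall a, topological_boundary D a ->
    exists (Q : 'M[R]_(n + n)) (i : 'I_(n + n)) (phi : 'rV[R]_((n + n).-1) -> R)
           (U : set 'rV[R[i]]_n),
      [/\ Q *m Q^T = 1%:M, lipschitz phi, nbhs a U
        & D `&` U =
          [set z | phi (col' i (realify z *m Q)) < (realify z *m Q) ord0 i]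
            `&` U].

(* On an open D, complex Frechet differentiability at every point of D. *)
Definition holomorphic_on (R : realType) (n : nat) (D : set 'rV[R[i]]_n)
    (f : 'rV[R[i]]_n -> R[i]) : Prop :=
  forall z, D z -> differentiable f z.

Local Open Scope ereal_scope.

(* Outer measure generated by the countable covers by sets S i with P i,
   S i being given the weight w i.  [None] stands for an unused place in the
   sequence, so that finite and empty covers are allowed. *)
Definition cover_outer (R : realType) (T I : Type) (P : set I)
    (S : I -> set T) (w : I -> \bar R) (A : set T) : \bar R :=
  ereal_inf [set \sum_(k <oo) oapp w 0 (F k) |
    F in [set F : nat -> option I | (forall k, oapp P True (F k)) /\
                                    A `<=` \bigcup_k oapp S set0 (F k)]].

Lemma cover_outer_ge0 (R : realType) (T I : Type) (P : set I)
    (S : I -> set T) (w : I -> \bar R) :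
  (forall i, P i -> 0 <= w i) -> forall A, 0 <= cover_outer P S w A.
Proof.
move=> w0 A; apply: le_ereal_inf_tmp => _ [F [PF _] <-].
by apply: nneseries_ge0 => k _ _; case: (F k) (PF k) => //= i; exact: w0.
Qed.

Lemma le_cover_outer (R : realType) (T I : Type) (P : set I)
    (S : I -> set T) (w : I -> \bar R) :
  {homo cover_outer P S w : A B / A `<=` B >-> A <= B}.
Proof.
move=> A B AB; apply: ereal_inf_le_tmp => _ [F [PF BF] <-].
by exists F => //; split => //; exact: subset_trans AB BF.
Qed.

Lemma cover_outer0 (R : realType) (T I : Type) (P : set I)
    (S : I -> set T) (w : I -> \bar R) :
  (forall i, P i -> 0 <= w i) -> cover_outer P S w set0 = 0.
Proof.
move=> w0; apply/eqP; rewrite eq_le cover_outer_ge0// andbT.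
apply: ereal_inf_lbound; exists (fun=> None); first by split.
by rewrite eseries0.
Qed.

Lemma cover_outer_sigma_subadditive (R : realType) (T I : Type) (P : set I)
    (S : I -> set T) (w : I -> \bar R) :
  (forall i, P i -> 0 <= w i) -> sigma_subadditive (cover_outer P S w).
Proof.
move=> P_w0 A; set mu := cover_outer P S w.
pose P' := oapp P True; pose S' := oapp S set0; pose w' := oapp w 0.
have w'0 o : P' o -> 0 <= w' o by case: o => //= i; exact: P_w0.
have mu0 B : 0 <= mu B by exact: cover_outer_ge0.
have [[i ioo]|] := pselect (exists i, mu (A i) = +oo).
  by rewrite (eseries_pinfty _ _ ioo) ?leey// => n _; rewrite -ltNye (lt_le_trans _ (mu0 _)).
rewrite -forallNE => Aoo.
suff add2e (e : {posnum R}) :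
    mu (\bigcup_n A n) <= \sum_(i <oo) mu (A i) + e%:num%:E.
  by apply/lee_addgt0Pr => _/posnumP[].
rewrite (le_trans _ (epsilon_trick _ _ _))//.
pose C n (B : nat -> option I) := ((forall k, P' (B k)) /\ A n `<=` \bigcup_k S' (B k)) /\
  \sum_(k <oo) w' (B k) <= mu (A n) + (e%:num / (2 ^ n.+1)%:R)%:E.
have [G PG] : {G : nat -> nat -> option I & forall n, C n (G n)}.
  apply: (@choice _ _ C) => n.
  have muf : mu (A n) \is a fin_num.
    by rewrite ge0_fin_numE// ltey; apply/eqP/Aoo.
  have en1 : (0 < e%:num / (2 ^ n.+1)%:R)%R by [].
  have [_ [B PB <-] /ltW lB] := lb_ereal_inf_adherent en1 muf.
  by exists B; split.
have PG' x : P' (uncurry G x) by case: x => n k; exact: (PG n).1.1.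
have wG_ge0 x : 0 <= (w' \o uncurry G) x by exact: w'0.
apply: (@le_trans _ _ (\esum_(i in setT) (w' \o uncurry G) i)).
  apply: ereal_inf_lbound => /=.
  have /card_esym/ppcard_eqP[f] := card_nat2.
  exists (uncurry G \o f).
    split => [i|]; first exact: PG'.
    apply: (@subset_trans _ (\bigcup_n \bigcup_k S' (G n k))) => [t [i _]|].
      by move=> /((PG i).1.2) -[j _ ?]; exists i => //; exists j.
    move=> t [i _ [j _ Bijt]]; exists (f^-1%FUN (i, j)) => //=.
    by rewrite invK ?inE.
  rewrite -(esum_pred_image (w' \o uncurry G) _ xpredT) ?[fun=> _]set_true//.
  by rewrite image_eq.
rewrite (_ : esum _ _ = \sum_(i <oo) \sum_(j <oo) w' (G i j)); last first.
  pose J : nat -> set (nat * nat) := fun i => [set (i, j) | j in setT].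
  rewrite (_ : setT = \bigcup_k J k); last first.
    by rewrite predeqE => -[a b]; split => // _; exists a => //; exists b.
  rewrite esum_bigcupT /=; last 2 first.
  - apply/trivIsetP => i j _ _ ij.
    rewrite predeqE => -[n m] /=; split => //= -[] [_] _ [<-{n} _].
    by move=> [m' _] [] /esym/eqP; rewrite (negbTE ij).
  - by move=> x; exact: wG_ge0.
  rewrite -(image_id [set: nat]) -fun_true esum_pred_image//; last first.
    by move=> n _; apply: esum_ge0 => x _; exact: wG_ge0.
  apply: eq_eseriesr => /= j _.
  rewrite -(esum_pred_image (w' \o uncurry G) (pair j) predT)//=; last 2 first.
  - by move=> k _; exact: (wG_ge0 (j, k)).
  - by move=> ? ? _ _; exact: (@can_inj _ _ _ snd).
  by congr esum; rewrite predeqE => -[a b]; split; move=> [i _ <-]; exists i.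
apply: lee_lim.
- apply: is_cvg_nneseries => n *.
  by apply: nneseries_ge0 => m *; exact: (wG_ge0 (n, m)).
- by apply: is_cvg_nneseries => n *; apply: adde_ge0.
- by near=> n; apply: lee_sum => i _; exact: (PG i).2.
Unshelve. all: by end_near. Qed.

(* Lebesgue outer measure on C^n = R^(2n): covers by half-open boxes
   ]a, b] with their volumes. *)
Definition box (R : realType) (n : nat) (ab : 'rV[R]_(n + n) * 'rV[R]_(n + n)) :
    set 'rV[R[i]]_n :=
  [set z | forall k, (ab.1 ord0 k < realify z ord0 k <= ab.2 ord0 k)%R].

Definition box_volume (R : realType) (n : nat)
    (ab : 'rV[R]_(n + n) * 'rV[R]_(n + n)) : \bar R :=
  (\prod_(k < n + n) (ab.2 ord0 k - ab.1 ord0 k)%R)%:E.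

Definition lebesgue_outer (R : realType) (n : nat) :
    set 'rV[R[i]]_n -> \bar R :=
  cover_outer
    [set ab : 'rV[R]_(n + n) * 'rV[R]_(n + n) |
       forall k, (ab.1 ord0 k <= ab.2 ord0 k)%R]
    (@box R n) (@box_volume R n).

Lemma box_volume_ge0 (R : realType) (n : nat)
    (ab : 'rV[R]_(n + n) * 'rV[R]_(n + n)) :
  (forall k, (ab.1 ord0 k <= ab.2 ord0 k)%R) -> 0 <= box_volume ab.
Proof.
by move=> ab0; rewrite lee_fin; apply: prodr_ge0 => k _; rewrite subr_ge0.
Qed.

HB.instance Definition _ (R : realType) (n : nat) :=
  isOuterMeasure.Build R 'rV[R[i]]_n (@lebesgue_outer R n)
    (cover_outer0 (@box R n) (@box_volume_ge0 R n))
    (cover_outer_ge0 (@box R n) (@box_volume_ge0 R n))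
    (@le_cover_outer R _ _ _ (@box R n) (@box_volume R n))
    (cover_outer_sigma_subadditive (@box R n) (@box_volume_ge0 R n)).

(* Lebesgue measure on the sigma-algebra of Lebesgue measurable sets. *)
Definition lebesgue_measureC (R : realType) (n : nat) :
    set (caratheodory_type (@lebesgue_outer R n)) -> \bar R :=
  @lebesgue_outer R n.

HB.instance Definition _ (R : realType) (n : nat) :=
  Measure.copy (@lebesgue_measureC R n)
    ([the {outer_measure set 'rV[R[i]]_n -> \bar R} of @lebesgue_outer R n]
       : set (caratheodory_type (@lebesgue_outer R n)) -> \bar R).

(* Volume of the Euclidean unit ball of R^s. *)
Fixpoint ball_volume (R : realType) (s : nat) : R :=
  match s with
  | 0 => 1
  | 1 => 2
  | s'.+2 => 2 * pi / s%:R * ball_volume R s'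
  end%R.

Lemma ball_volume_ge0 (R : realType) (s : nat) : (0 <= ball_volume R s)%R.
Proof.
suff: (0 <= ball_volume R s)%R /\ (0 <= ball_volume R s.+1)%R by case.
elim: s => [|s [IH1 IH2]]; first by [].
by split=> //=; rewrite mulr_ge0// divr_ge0// mulr_ge0// pi_ge0.
Qed.

Definition diameter (R : realType) (n : nat) (B : set 'rV[R[i]]_n) : \bar R :=
  ereal_sup [set (euclid_norm (realify z.1 - realify z.2))%:E | z in B `*` B].

Lemma diameter_ge0 (R : realType) (n : nat) (B : set 'rV[R[i]]_n) :
  B !=set0 -> 0 <= diameter B.
Proof.
move=> [z Bz]; apply: (@le_trans _ _ (euclid_norm (realify z - realify z))%:E).
  by rewrite lee_fin sqrtr_ge0.
by apply: ereal_sup_ubound; exists (z, z).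
Qed.

Definition hausdorff_weight (R : realType) (n s : nat) (B : set 'rV[R[i]]_n) :
    \bar R :=
  (ball_volume R s / 2 ^+ s)%:E * diameter B ^+ s.

Definition hausdorff_premeasure (R : realType) (n s : nat) (d : R) :
    set 'rV[R[i]]_n -> \bar R :=
  cover_outer [set B | B !=set0 /\ diameter B <= d%:E] id
    (@hausdorff_weight R n s).

(* s-dimensional Hausdorff outer measure on C^n for the Euclidean distance,
   normalized so that it is Lebesgue measure on s-dimensional planes. *)
Definition hausdorff_outer (R : realType) (n s : nat) (A : set 'rV[R[i]]_n) :
    \bar R :=
  ereal_sup [set hausdorff_premeasure s d A | d in [set d : R | (0 < d)%R]].

Lemma hausdorff_weight_ge0 (R : realType) (n s : nat) (d : R)
    (B : set 'rV[R[i]]_n) :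
  B !=set0 /\ diameter B <= d%:E -> 0 <= hausdorff_weight s B.
Proof.
move=> [B0 _]; apply: mule_ge0; last by rewrite expe_ge0// diameter_ge0.
by rewrite lee_fin divr_ge0// ?exprn_ge0// ball_volume_ge0.
Qed.

Lemma hausdorff_outer_ge0 (R : realType) (n s : nat) (A : set 'rV[R[i]]_n) :
  0 <= hausdorff_outer s A.
Proof.
apply: (@le_trans _ _ (hausdorff_premeasure s 1%R A)).
  by apply: cover_outer_ge0 => B; exact: hausdorff_weight_ge0.
by apply: ereal_sup_ubound; exists 1%R => /=.
Qed.

Lemma hausdorff_outer0 (R : realType) (n s : nat) :
  hausdorff_outer s (set0 : set 'rV[R[i]]_n) = 0.
Proof.
apply/eqP; rewrite eq_le hausdorff_outer_ge0 andbT.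
apply: ge_ereal_sup => _ [d _ <-].
by rewrite /hausdorff_premeasure (cover_outer0 id (@hausdorff_weight_ge0 R n s d)).
Qed.

Lemma le_hausdorff_outer (R : realType) (n s : nat) :
  {homo @hausdorff_outer R n s : A B / A `<=` B >-> A <= B}.
Proof.
move=> A B AB; apply: ge_ereal_sup => _ [d d0 <-].
apply: (@le_trans _ _ (hausdorff_premeasure s d B)).
  exact: le_cover_outer.
by apply: ereal_sup_ubound; exists d.
Qed.

Lemma hausdorff_outer_sigma_subadditive (R : realType) (n s : nat) :
  sigma_subadditive (@hausdorff_outer R n s).
Proof.
move=> A; apply: ge_ereal_sup => _ [d d0 <-].
apply: (le_trans (cover_outer_sigma_subadditive id
  (@hausdorff_weight_ge0 R n s d) A)).
apply: lee_nneseries => k _.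
  by move=> _; apply: cover_outer_ge0 => B; exact: hausdorff_weight_ge0.
by apply: ereal_sup_ubound; exists d.
Qed.

HB.instance Definition _ (R : realType) (n s : nat) :=
  isOuterMeasure.Build R 'rV[R[i]]_n (@hausdorff_outer R n s)
    (@hausdorff_outer0 R n s) (@hausdorff_outer_ge0 R n s)
    (@le_hausdorff_outer R n s) (@hausdorff_outer_sigma_subadditive R n s).

Definition hausdorff_measure (R : realType) (n s : nat) :
    set (caratheodory_type (@hausdorff_outer R n s)) -> \bar R :=
  @hausdorff_outer R n s.

HB.instance Definition _ (R : realType) (n s : nat) :=
  Measure.copy (@hausdorff_measure R n s)
    ([the {outer_measure set 'rV[R[i]]_n -> \bar R} of @hausdorff_outer R n s]
       : set (caratheodory_type (@hausdorff_outer R n s)) -> \bar R).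

(* Main.v *)
Require Import Defs.
From HB Require Import structures.
From mathcomp Require Import all_boot all_order all_algebra complex.
From mathcomp Require Import all_classical all_reals all_analysis measurable_realfun.
From mathcomp Require Import ring lra zify.

Set Implicit Arguments.
Unset Strict Implicit.
Unset Printing Implicit Defensive.

Import Order.TTheory GRing.Theory Num.Theory.
Import numFieldNormedType.Exports.

Local Open Scope classical_set_scope.
Local Open Scope ring_scope.
Local Open Scope complex_scope.

(* Put N = 2n and cut R^N into the cubes of the grid h Z^N. Let z be a grid point
   of Omega that is not close to the boundary. The field built from f and the
   regularised Bochner-Martinelli kernel with pole z has a divergence that is an
   approximate identity at z times f. Apply the divergence theorem to the union of
   the cubes contained in Omega: the faces shared by two cubes cancel and the
   remaining ones lie on cubes b meeting the boundary, so that
     |f z| <= C sum_b F_b (dist(b, z) / h)^(1 - N),   F_b = sup of |f| on b.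
   Goursat's bisection proves the divergence theorem for a field that is merely
   differentiable. By the Lipschitz charts at most O((r / h)^(N - 1)) boundary cubes
   lie within distance r of a given one, and then q (N - 1) < N p makes the kernel
   above bounded from l^p(b) to l^q(z), uniformly in h. The charts also give
   H^(N - 1)(boundary in a ball of radius h) >= c h^(N - 1), which compares
   h^(N - 1) sum_b F_b^p with the boundary integral of |f|^p. Let h tend to 0. *)

(** * Discrete fractional integration *)

(** Stokes' formula on [Omega] itself is out of reach: the boundary is only Lipschitz, [f] is only
    continuous up to it, and its derivatives may blow up there. Unions of cubes contained in [Omega]
    avoid this. A face has area h^(N - 1) and the kernel has size dist^(1 - N), hence the power of
    dist / h. The regularising parameter, [eps] in the code, goes to 0 with the grid fixed: the pole
    is not cut out, the field stays differentiable, and the bound on the faces does not see [eps]. A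
    unimodular factor turns |f z| into a real part at z, so a one-sided estimate of a real
    divergence is enough and no sharp constant enters. The condition on [p] and [q] comes from
    scaling: with t = max(p, q) / p, a kernel of order N - 1 raised to the power t must be summable
    in dimension N. As N - 1 is also the critical exponent for sums over the boundary, the kernel is
    split before Hoelder's inequality is applied. Constants depending on [f], such as sup |f|, are
    kept apart: they come with a factor h and vanish in the limit. *)

Lemma ler_powRl (R : realType) (r x y : R) :
  0 <= r -> 0 <= x -> x <= y -> x `^ r <= y `^ r.
Proof.
by move=> r0 x0 xy; apply: ge0_ler_powR; rewrite ?nnegrE// (le_trans x0).
Qed.

Lemma gt0_powRD (R : realType) (x r s : R) :
  0 < x -> x `^ (r + s) = x `^ r * x `^ s.
Proof. by move=> x0; rewrite powRD// (gt_eqF x0) implybT. Qed.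

(** Jensen's inequality for the power t with weights [w], multiplied out so that a total mass 0 is
    allowed. *)
Lemma sum_powR_le (R : realType) (I : Type) (s : seq I) (w a : I -> R) (t : R) :
  1 <= t -> (forall i, 0 <= w i) -> (forall i, 0 <= a i) ->
  (\sum_(i <- s) w i * a i) `^ t <=
  (\sum_(i <- s) w i) `^ (t - 1) * \sum_(i <- s) w i * a i `^ t.
Proof.
move=> t1 w0 a0.
set S := \sum_(i <- s) w i * a i; set W := \sum_(i <- s) w i.
set T := \sum_(i <- s) w i * a i `^ t.
have W0 : 0 <= W by exact: sumr_ge0.
have S0 : 0 <= S by apply: sumr_ge0 => i _; rewrite mulr_ge0.
have T0 : 0 <= T by apply: sumr_ge0 => i _; rewrite mulr_ge0// powR_ge0.
move: t1; rewrite le_eqVlt => /predU1P[t1|t1].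
  rewrite /T -t1 subrr powRr0 mul1r powRr1// /S.
  by apply: ler_sum => i _; rewrite powRr1.
have t0 : 0 < t by lra.
have [W_eq0|Wn0] := eqVneq W 0.
  suff -> : S = 0 by rewrite powR0 ?gt_eqF// mulr_ge0// powR_ge0.
  suff aux (r : seq I) : \sum_(i <- r) w i = 0 -> \sum_(i <- r) w i * a i = 0 by exact: aux.
  elim: r => [|i r IH]; first by rewrite !big_nil.
  rewrite !big_cons => /eqP; rewrite paddr_eq0 ?sumr_ge0// => /andP[/eqP -> /eqP Ws].
  by rewrite mul0r add0r IH.
have Wgt : 0 < W by rewrite lt_neqAle eq_sym Wn0.
pose y := S / W.
have y0 : 0 <= y by rewrite divr_ge0.
have SWy : S = W * y by rewrite /y mulrC divfK.
have tn : t - 1 != 0 by rewrite gt_eqF//; lra.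
(* Young's inequality a y^(t - 1) <= a^t / t + y^t (1 - 1 / t) for each a = [a i], with y the
   weighted mean, summed with weights; W y^t is then absorbed on the left. *)
have key : S * y `^ (t - 1) <= T / t + W * (y `^ t * (1 - t^-1)).
  rewrite /S /T /W !mulr_suml -big_split /=.
  apply: ler_sum => i _.
  rewrite -[w i * a i * _]mulrA -[w i * _ / t]mulrA -mulrDr.
  apply: ler_wpM2l => //.
  have tt : t / (t - 1) * (t - 1) = t by rewrite divfK.
  have := @conjugate_powR R (a i) (y `^ (t - 1)) t (t / (t - 1)) (a0 i) (powR_ge0 _ _) t0.
  rewrite -powRrM (mulrC (t - 1)) tt invf_div => /(_ _ _)/le_trans; apply.
  - by rewrite divr_gt0//; lra.
  - by field; rewrite gt_eqF.
  - by rewrite le_eqVlt; apply/orP; left; apply/eqP; field; rewrite gt_eqF.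
have yy : S * y `^ (t - 1) = W * y `^ t by rewrite SWy -mulrA mulr_powRB1.
have le1 : W * y `^ t <= T.
  rewrite yy in key.
  have : t * (W * y `^ t) <= T + (t - 1) * (W * y `^ t).
    have := ler_wpM2l (ltW t0) key; rewrite mulrDr => h.
    apply: le_trans h _; rewrite le_eqVlt; apply/orP; left; apply/eqP.
    by field; rewrite gt_eqF.
  lra.
rewrite {1}SWy powRM//.
have -> : W `^ t = W `^ (t - 1) * W by rewrite mulrC mulr_powRB1.
by rewrite -mulrA ler_wpM2l// powR_ge0.
Qed.

(** Each shell where d lies between r and 2 r adds at most C 2^D r^(D - a), and D - a > 0 makes
    these a geometric progression dominated by its last term. [K] satisfies K + C 2^D <= K 2^(D -
    a), which closes the induction on [L]; its summand C pays for the points with d = h. *)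
Lemma dyadic_sum_le (R : realType) (I : Type) (s : seq I) (d : I -> R)
    (h C a : R) (D : nat) :
  0 < h -> 0 <= C -> 0 < a < D%:R ->
  (forall i, h <= d i) ->
  (forall r, h <= r -> (count (fun i => d i <= r) s)%:R <= C * (r / h) ^+ D) ->
  forall L, \sum_(i <- s | d i <= h * 2 ^+ L) h ^+ D * d i `^ (- a) <=
    (C + C * 2 ^+ D / (2 `^ (D%:R - a) - 1)) * (h * 2 ^+ L) `^ (D%:R - a).
Proof.
move=> h0 C0 /andP[a0 aD] hd cnt.
set K := C + _.
have s0 : 0 < D%:R - a by rewrite subr_gt0.
have two : 0 < 2 `^ (D%:R - a) - 1 :> R.
  have lt12 := @gt0_ltr_powR R _ s0 1 2; rewrite powR1 in lt12.
  by rewrite subr_gt0; apply: lt12; rewrite ?nnegrE//; lra.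
have dominate r (P : pred I) : h <= r -> (forall i, P i -> r <= d i <= 2 * r) ->
    \sum_(i <- s | P i) h ^+ D * d i `^ (- a) <= C * 2 ^+ D * r `^ (D%:R - a).
  move=> hr Pr; have r0 : 0 < r by exact: lt_le_trans hr.
  apply: (@le_trans _ _ (\sum_(i <- s | P i) h ^+ D * r `^ (- a))).
    apply: ler_sum => i /Pr /andP[ri _].
    rewrite ler_wpM2l ?exprn_ge0 ?(ltW h0)// !powRN lef_pV2 ?posrE ?powR_gt0//.
      by apply: ge0_ler_powR; rewrite ?nnegrE ?(ltW a0)//; lra.
    by lra.
  rewrite big_const_seq iter_addr_0 -[X in X <= _]mulr_natl.
  have cP : (count P s <= count (fun i => (d i <= 2 * r)%R) s)%N.
    by apply: sub_count => i /Pr /andP[].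
  have := cnt (2 * r) ltac:(lra).
  have : (count P s)%:R <= (count (fun i => d i <= 2 * r) s)%:R :> R by rewrite ler_nat.
  move=> c1 c2; have c3 := le_trans c1 c2.
  apply: le_trans (ler_wpM2r _ c3) _.
    by rewrite mulr_ge0 ?powR_ge0// exprn_ge0// ltW.
  rewrite gt0_powRD//.
  rewrite powR_mulrn ?(ltW r0)// expr_div_n exprMn.
  rewrite le_eqVlt; apply/orP; left; apply/eqP; field.
  by rewrite expf_neq0// gt_eqF.
elim=> [|L IH].
  rewrite expr0 mulr1.
  apply: (@le_trans _ _ (C * h `^ (D%:R - a))).
    apply: (@le_trans _ _ (\sum_(i <- s | d i <= h) h ^+ D * h `^ (- a))).
      apply: ler_sum => i dih; have -> : d i = h by apply/eqP; rewrite eq_le dih hd.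
      by [].
    rewrite big_const_seq iter_addr_0 -[X in X <= _]mulr_natl.
    apply: le_trans (ler_wpM2r _ (cnt h (lexx h))) _.
      by rewrite mulr_ge0 ?powR_ge0// exprn_ge0// ltW.
    by rewrite divff ?gt_eqF// expr1n mulr1 gt0_powRD// powR_mulrn ?(ltW h0)// mulrA.
  apply: ler_wpM2r; first exact: powR_ge0.
  rewrite /K lerDl divr_ge0 ?(ltW two)// mulr_ge0// exprn_ge0//.
rewrite (bigID (fun i => d i <= h * 2 ^+ L)) /=.
have le1 : h * 2 ^+ L <= h * 2 ^+ L.+1.
  by rewrite ler_pM2l// exprS ler_peMl ?exprn_ge0//; lra.
rewrite (eq_bigl (fun i => d i <= h * 2 ^+ L)); last first.
  by move=> i; apply/andP/idP => [[]//|di]; split => //; exact: le_trans le1.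
apply: le_trans (lerD IH (dominate (h * 2 ^+ L) _ _ _)) _.
- by rewrite ler_peMr ?(ltW h0)// exprn_ege1//; lra.
- move=> i /andP[di]; rewrite -ltNge => /ltW ->/=.
  by rewrite mulrCA -exprS.
rewrite -mulrDl exprS (mulrCA h) [(2 * _) `^ _]powRM ?mulr_ge0 ?exprn_ge0 ?(ltW h0)//.
rewrite mulrA ler_wpM2r ?powR_ge0//.
have -> : K * 2 `^ (D%:R - a) = K + K * (2 `^ (D%:R - a) - 1) by ring.
rewrite lerD2l /K mulrDl divfK ?gt_eqF//.
by rewrite lerDr mulr_ge0// ltW.
Qed.

Lemma exists_dyadic_scale (R : realType) (h r : R) : 0 < h -> h <= r ->
  exists L, r <= h * 2 ^+ L <= 2 * r.
Proof.
move=> h0 hr.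
have r0 : 0 < r by exact: lt_le_trans hr.
have ex : exists L, r <= h * 2 ^+ L.
  exists (Num.bound (r / h)); rewrite -ler_pdivrMl// mulrC ltW//.
  exact: upper_nthrootP.
case: (ex_minnP ex) => -[|L] Lr Lmin.
  by exists 0%N; rewrite Lr/= expr0 mulr1; lra.
exists L.+1; rewrite Lr/=.
rewrite exprS mulrCA ler_pM2l ?ltr0n// ltW// ltNge.
by apply/negP => /Lmin; rewrite ltnn.
Qed.

Lemma power_sum_le (R : realType) (I : Type) (s : seq I) (d : I -> R)
    (h C a r : R) (D : nat) :
  0 < h -> h <= r -> 0 <= C -> 0 < a < D%:R ->
  (forall i, h <= d i <= r) ->
  (forall x, h <= x -> (count (fun i => d i <= x) s)%:R <= C * (x / h) ^+ D) ->
  \sum_(i <- s) h ^+ D * d i `^ (- a) <=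
    (C + C * 2 ^+ D / (2 `^ (D%:R - a) - 1)) * (2 * r) `^ (D%:R - a).
Proof.
move=> h0 hr C0 aD hd cnt.
have [L /andP[rL Lr]] := exists_dyadic_scale h0 hr.
have hd1 i : h <= d i by case/andP: (hd i).
have := dyadic_sum_le h0 C0 aD hd1 cnt L.
rewrite (eq_bigl predT) => [|i]; last by case/andP: (hd i) => _ /le_trans ->.
move=> /le_trans; apply; case/andP: aD => a0 aD.
have s0 : 0 < D%:R - a by rewrite subr_gt0.
apply: ler_wpM2l.
  have lt12 := @gt0_ltr_powR R _ s0 1 2; rewrite powR1 in lt12.
  rewrite addr_ge0// divr_ge0// ?mulr_ge0 ?exprn_ge0// subr_ge0 ltW// lt12 ?nnegrE//; lra.
apply: ge0_ler_powR; rewrite ?nnegrE ?(ltW s0)//; last lra.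
by rewrite mulr_ge0 ?exprn_ge0 ?ltW.
Qed.

(** A discrete fractional integral from dimension D to dimension D + 1. The exponent D is critical
    for sums over [b], so d^(-D) is split as d^(-s1) d^(-g) with s1 < D. Hoelder with weights
    d^(-s1) bounds f^p by a sum of F^p d^(-al), Jensen with weights F^p raises this to the power t,
    and exchanging the sums leaves d^(-al t), summable over [s] because al t < D + 1. *)
Lemma fractional_sum_bound (R : realType) (p q C C0 r V : R) (D : nat) :
  (0 < D)%N -> 1 <= p -> 1 <= q -> q * D%:R < D.+1%:R * p ->
  0 <= C -> 0 <= C0 -> 0 < r -> 0 <= V ->
  exists2 K : R, 0 <= K & forall (h : R) (I J : Type) (s : seq I) (b : seq J)
    (d : I -> J -> R) (F : J -> R) (f : I -> R),
    0 < h -> h <= r ->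
    (forall i j, h <= d i j <= r) ->
    (forall i x, h <= x -> (count (fun j => d i j <= x) b)%:R <= C * (x / h) ^+ D) ->
    (forall j x, h <= x -> (count (fun i => d i j <= x) s)%:R <= C * (x / h) ^+ D.+1) ->
    h ^+ D.+1 * (size s)%:R <= V ->
    (forall j, 0 <= F j) ->
    (forall i, 0 <= f i <= C0 * \sum_(j <- b) F j * (h / d i j) ^+ D) ->
    h ^+ D.+1 * \sum_(i <- s) f i `^ q <=
      K * (h ^+ D * \sum_(j <- b) F j `^ p) `^ (q / p).
Proof.
move=> D0 p1 q1 qD C_ge0 C0_ge0 r0 V0.
have D1 : 1 <= D%:R :> R by rewrite ler1n.
(* The larger exponent is treated, so that t >= 1 and Jensen applies; when q < p the mass bound [V]
   leads back to q. *)
pose P := Num.max p q; pose t := P / p.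
have Pp : p <= P by rewrite le_max lexx.
have Pq : q <= P by rewrite le_max lexx orbT.
have p0 : 0 < p by lra.
have P0 : 0 < P by lra.
have t1 : 1 <= t by rewrite ler_pdivlMr// mul1r.
have t0 : 0 < t by lra.
have tD : t * D%:R < D.+1%:R.
  rewrite /t mulrAC ltr_pdivrMr// /P maxEle; case: ifP => // _.
  by rewrite mulrC ltr_pM2r// ltr_nat.
(* Small enough for s1 > 0 and al t < D + 1, where al = D + g (p - 1). It is positive because t D <
   D + 1, which for q > p is the condition on the exponents. *)
pose g := Num.min (D%:R) (D.+1%:R / t - D%:R) / (2 * p).
have g0 : 0 < g.
  rewrite divr_gt0 ?mulr_gt0// lt_min (lt_le_trans _ D1)//= subr_gt0.
  by rewrite ltr_pdivlMr// mulrC.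
have gD : g * (2 * p) <= D%:R by rewrite divfK ?gt_eqF ?mulr_gt0// ge_min lexx.
have gt_ : g * (2 * p) <= D.+1%:R / t - D%:R.
  by rewrite divfK ?gt_eqF ?mulr_gt0// ge_min lexx orbT.
pose s1 := D%:R - g; pose al := s1 + g * p.
have gp : g <= g * p by rewrite ler_peMr ?(ltW g0).
have s1D : 0 < s1 < D%:R by rewrite /s1; lra.
have alt0 : 0 < al * t < D.+1%:R.
  rewrite mulr_gt0/= ?/al//; last by rewrite /s1; lra.
  rewrite -ltr_pdivlMr//; rewrite /s1; lra.
pose K1 := (C + C * 2 ^+ D / (2 `^ (D%:R - s1) - 1)) * (2 * r) `^ (D%:R - s1).
pose K2 := (C + C * 2 ^+ D.+1 / (2 `^ (D.+1%:R - al * t) - 1)) *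
  (2 * r) `^ (D.+1%:R - al * t).
have K_ge0 (m : nat) (x : R) : x < m%:R ->
    0 <= (C + C * 2 ^+ m / (2 `^ (m%:R - x) - 1)) * (2 * r) `^ (m%:R - x).
  move=> xm; have x0 : 0 < m%:R - x by rewrite subr_gt0.
  have lt12 := @gt0_ltr_powR R _ x0 1 2; rewrite powR1 in lt12.
  rewrite mulr_ge0 ?powR_ge0// addr_ge0// divr_ge0// ?mulr_ge0 ?exprn_ge0//.
  by rewrite subr_ge0 ltW// lt12 ?nnegrE//; lra.
have K1_ge0 : 0 <= K1 by apply: K_ge0; case/andP: s1D.
have K2_ge0 : 0 <= K2 by apply: K_ge0; case/andP: alt0.
pose Kp := C0 `^ P * K1 `^ ((p - 1) * t) * K2.
have Kp_ge0 : 0 <= Kp.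
  by apply: mulr_ge0 => //; apply: mulr_ge0; exact: powR_ge0.
exists ((V `^ (P / q - 1) * Kp) `^ (q / P)); first exact: powR_ge0.
move=> h I J s b d F f h0 hr hd cb cs sV F0 hf.
have d0 i j : 0 < d i j by case/andP: (hd i j) => /(lt_le_trans h0).
have h_ge0 := ltW h0.
pose w := h ^+ D.
have w0 : 0 <= w by exact: exprn_ge0.
pose A := w * \sum_(j <- b) F j `^ p.
have A0 : 0 <= A by rewrite mulr_ge0// sumr_ge0// => j _; rewrite powR_ge0.
have A_E : A = \sum_(j <- b) w * F j `^ p by rewrite /A mulr_sumr.
have f0 i : 0 <= f i by case/andP: (hf i).
have step1 i : f i `^ p <= C0 `^ p * K1 `^ (p - 1) *
    \sum_(j <- b) (w * F j `^ p) * d i j `^ (- al).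
  have fi : f i <= C0 * \sum_(j <- b) (w * d i j `^ (- s1)) * (F j * d i j `^ (- g)).
    case/andP: (hf i) => _ /le_trans; apply; apply: ler_wpM2l => //.
    apply: ler_sum => j _; rewrite expr_div_n -/w.
    rewrite le_eqVlt; apply/orP; left; apply/eqP.
    have -> : (d i j ^+ D)^-1 = d i j `^ (- s1) * d i j `^ (- g).
      rewrite -gt0_powRD//.
      rewrite -powR_invn ?(ltW (d0 i j))//; congr (_ `^ _); rewrite /s1; ring.
    by ring.
  have S0 : 0 <= \sum_(j <- b) (w * d i j `^ (- s1)) * (F j * d i j `^ (- g)).
    by apply: sumr_ge0 => j _; rewrite !mulr_ge0 ?powR_ge0.
  apply: (@le_trans _ _ ((C0 * \sum_(j <- b) (w * d i j `^ (- s1)) *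
      (F j * d i j `^ (- g))) `^ p)).
    by apply: ge0_ler_powR; rewrite ?nnegrE ?mulr_ge0 ?(ltW p0).
  rewrite powRM// -mulrA ler_wpM2l ?powR_ge0//.
  apply: le_trans (sum_powR_le _ p1 _ _) _.
  - by move=> j; rewrite mulr_ge0 ?powR_ge0.
  - by move=> j; rewrite mulr_ge0 ?powR_ge0.
  apply: ler_pM; rewrite ?powR_ge0//.
  - by apply: sumr_ge0 => j _; rewrite !mulr_ge0 ?powR_ge0.
  - have W0 : 0 <= \sum_(j <- b) w * d i j `^ (- s1).
      by apply: sumr_ge0 => j _; rewrite mulr_ge0 ?powR_ge0.
    apply: ge0_ler_powR; rewrite ?nnegrE//; first lra.
    by apply: power_sum_le => //; exact: cb.
  apply: ler_sum => j _; rewrite powRM ?powR_ge0// -powRrM.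
  rewrite le_eqVlt; apply/orP; left; apply/eqP.
  have -> : d i j `^ (- al) = d i j `^ (- s1) * d i j `^ (- g * p).
    rewrite -gt0_powRD//.
    by congr (_ `^ _); rewrite /al; ring.
  by ring.
have step2 i : f i `^ P <= C0 `^ P * K1 `^ ((p - 1) * t) * A `^ (t - 1) *
    \sum_(j <- b) (w * F j `^ p) * d i j `^ (- (al * t)).
  have PE : P = p * t by rewrite /t mulrCA divff ?mulr1// gt_eqF.
  rewrite {1}PE powRrM.
  have S0 : 0 <= \sum_(j <- b) (w * F j `^ p) * d i j `^ (- al).
    by apply: sumr_ge0 => j _; rewrite !mulr_ge0 ?powR_ge0.
  apply: (@le_trans _ _ ((C0 `^ p * K1 `^ (p - 1) *
    \sum_(j <- b) (w * F j `^ p) * d i j `^ (- al)) `^ t)).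
    by apply: ler_powRl; rewrite ?powR_ge0 ?(ltW t0).
  rewrite (powRM _ (mulr_ge0 (powR_ge0 _ _) (powR_ge0 _ _)) S0).
  rewrite (powRM _ (powR_ge0 _ _) (powR_ge0 _ _)) -(powRrM C0) -(powRrM K1) -PE.
  rewrite -[leRHS]mulrA; apply: ler_wpM2l; first by rewrite mulr_ge0// powR_ge0.
  apply: le_trans (sum_powR_le _ t1 _ _) _.
  - by move=> j; rewrite mulr_ge0 ?powR_ge0.
  - by move=> j; rewrite powR_ge0.
  rewrite -A_E ler_wpM2l ?powR_ge0//.
  by apply: ler_sum => j _; rewrite -powRrM mulNr.
have step3 : h ^+ D.+1 * \sum_(i <- s) f i `^ P <= Kp * A `^ t.
  apply: (@le_trans _ _ (C0 `^ P * K1 `^ ((p - 1) * t) * A `^ (t - 1) *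
      \sum_(i <- s) \sum_(j <- b) (w * F j `^ p) *
        (h ^+ D.+1 * d i j `^ (- (al * t))))).
    rewrite mulr_sumr [leRHS]mulr_sumr; apply: ler_sum => i _.
    apply: le_trans (ler_wpM2l (exprn_ge0 _ h_ge0) (step2 i)) _.
    rewrite le_eqVlt; apply/orP; left; apply/eqP.
    rewrite mulrCA; congr (_ * _); rewrite mulr_sumr; apply: eq_bigr => j _.
    by ring.
  rewrite exchange_big /=.
  have -> : Kp * A `^ t = C0 `^ P * K1 `^ ((p - 1) * t) * A `^ (t - 1) * (A * K2).
    by rewrite -(mulr_powRB1 A0 t0) /Kp; ring.
  apply: ler_wpM2l; first by rewrite !mulr_ge0 ?powR_ge0.
  rewrite A_E mulr_suml; apply: ler_sum => j _.
  rewrite -mulr_sumr ler_wpM2l ?mulr_ge0 ?powR_ge0//.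
  by apply: power_sum_le => //; exact: cs.
have q0 : 0 < q by lra.
have Pq1 : 1 <= P / q by rewrite ler_pdivlMr// mul1r.
pose T := h ^+ D.+1 * \sum_(i <- s) f i `^ q.
have T0 : 0 <= T.
  by rewrite mulr_ge0 ?exprn_ge0// sumr_ge0// => i _; rewrite powR_ge0.
(* Jensen over [s] with the constant weights h^(D + 1), of total mass at most [V]. *)
have step4 : T `^ (P / q) <= V `^ (P / q - 1) * (Kp * A `^ t).
  rewrite /T mulr_sumr.
  apply: le_trans (sum_powR_le _ Pq1 _ _) _.
  - by move=> i; rewrite exprn_ge0.
  - by move=> i; rewrite powR_ge0.
  apply: ler_pM; rewrite ?powR_ge0//.
  - by apply: sumr_ge0 => i _; rewrite mulr_ge0 ?exprn_ge0 ?powR_ge0.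
  - apply: ge0_ler_powR; rewrite ?nnegrE//; first lra.
      by apply: sumr_ge0 => i _; rewrite exprn_ge0.
    apply: le_trans sV; rewrite big_const_seq iter_addr_0 count_predT.
    by rewrite -[X in X <= _]mulr_natr.
  apply: le_trans step3; rewrite mulr_sumr; apply: ler_sum => i _.
  by rewrite -powRrM mulrCA divff ?mulr1// gt_eqF.
have -> : h ^+ D.+1 * \sum_(i <- s) f i `^ q = (T `^ (P / q)) `^ (q / P).
  rewrite -powRrM.
  have -> : P / q * (q / P) = 1 by field; rewrite !gt_eqF.
  by rewrite powRr1.
have -> : (V `^ (P / q - 1) * Kp) `^ (q / P) * A `^ (q / p) =
    (V `^ (P / q - 1) * (Kp * A `^ t)) `^ (q / P).
  rewrite mulrA (powRM _ (mulr_ge0 (powR_ge0 _ _) Kp_ge0) (powR_ge0 _ _)); congr (_ * _).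
  rewrite -powRrM; congr (_ `^ _); rewrite /t; field.
  by rewrite !gt_eqF.
by apply: ler_powRl step4; [rewrite divr_ge0// ltW|exact: powR_ge0].
Qed.

(** * Lattice cubes *)

Section Lattice.
Variables (R : realType) (N : nat).
Implicit Types (i j : 'rV[int]_N) (x y : 'rV[R]_N).

Lemma rV_norm_leP (x : 'rV[R]_N) (r : R) : 0 <= r ->
  (`|x| <= r) <-> (forall k, `|x ord0 k| <= r).
Proof.
move=> r0; rewrite (_ : `|x| = mx_norm x)// mx_normrE; split => [xr k|xr].
  apply: le_trans xr.
  exact: (le_bigmax_cond _ (fun ij : 'I_1 * 'I_N => `|x ij.1 ij.2|) (j := (ord0, k))).
by apply/bigmax_leP; split => // -[a k] _ /=; rewrite (ord1 a).
Qed.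

Lemma rV_coord_le_norm (x : 'rV[R]_N) k : `|x ord0 k| <= `|x|.
Proof. by have [+ _] := @rV_norm_leP x `|x| (normr_ge0 x); apply. Qed.

Definition latdist i j : nat := \max_(k < N) `|i ord0 k - j ord0 k|%N.

Lemma latdist_leP i j m :
  reflect (forall k, (`|i ord0 k - j ord0 k| <= m)%N) (latdist i j <= m)%N.
Proof.
by rewrite /latdist; apply: (iffP (bigmax_leqP _ _ _)) => h k; [exact: h|move=> _; exact: h].
Qed.

Lemma latdistC i j : latdist i j = latdist j i.
Proof. by apply: eq_bigr => k _; rewrite distnC. Qed.

Lemma latdistxx i : latdist i i = 0%N.
Proof. by apply/eqP; rewrite -leqn0; apply/latdist_leP => k; rewrite subrr. Qed.

Definition latbox (m : nat) : seq 'rV[int]_N :=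
  [seq \row_k ((f k)%:Z - m%:Z) | f : {ffun 'I_N -> 'I_(m + m).+1}].

Lemma latbox_uniq m : uniq (latbox m).
Proof.
rewrite map_inj_uniq ?enum_uniq// => f g /rowP fg; apply/ffunP => k.
by apply/val_inj; have := fg k; rewrite !mxE => /addIr [].
Qed.

Lemma size_latbox m : size (latbox m) = ((m + m).+1 ^ N)%N.
Proof. by rewrite size_map -cardE card_ffun !card_ord. Qed.

Lemma mem_latbox m i : (i \in latbox m) = (latdist i 0 <= m)%N.
Proof.
apply/idP/idP => [/mapP[f _ ->]|/latdist_leP im].
  apply/latdist_leP => k; rewrite !mxE subr0; case: (f k) => a /=; lia.
apply/mapP; exists [ffun k => inord `|i ord0 k + m%:Z|]; first by rewrite mem_enum.
apply/rowP => k; rewrite !mxE ffunE; have := im k; rewrite mxE subr0.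
rewrite (_ : (0 : 'I_1) = ord0); last exact: val_inj.
by move: (i ord0 k) => z zm; rewrite inordK; lia.
Qed.

Lemma latbox_count (s : seq 'rV[int]_N) i m : uniq s ->
  (forall j, j \in s -> (latdist j i <= m)%N) -> (size s <= (m + m).+1 ^ N)%N.
Proof.
move=> us sm; rewrite -size_latbox -(size_map (fun j => j - i)).
apply: uniq_leq_size; first by rewrite map_inj_uniq// => a b /addIr.
move=> _ /mapP[j /sm jm ->]; rewrite mem_latbox; apply/latdist_leP => k.
by rewrite !mxE subr0; apply: (latdist_leP _ _ _ jm).
Qed.

Definition latpt (h : R) i : 'rV[R]_N := \row_k (h * (i ord0 k)%:~R).

(** Closed on every side: a face lies in both cubes that share it, so an exposed face of an inner
    cube can be estimated through the neighbour across it. *)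
Definition cube (h : R) i : set 'rV[R]_N :=
  [set x | forall k, h * (i ord0 k)%:~R <= x ord0 k <= h * (i ord0 k + 1)%:~R].

Definition cell (h : R) x : 'rV[int]_N := \row_k Num.floor (x ord0 k / h).

Lemma latpt_cube h i : 0 <= h -> cube h i (latpt h i).
Proof. by move=> h0 k; rewrite !mxE lexx/= intrD ler_wpM2l// lerDl. Qed.

Lemma cube_cell h x : 0 < h -> cube h (cell h x) x.
Proof.
move=> h0 k; rewrite !mxE; apply/andP; split; rewrite mulrC.
  by rewrite -ler_pdivlMr// floor_le.
by rewrite -ler_pdivrMr// ltW// floorD1_gt.
Qed.

Lemma cube_norm_le h i x y : 0 <= h -> cube h i x -> cube h i y -> `|x - y| <= h.
Proof.
move=> h0 ix iy; apply/rV_norm_leP => // k; rewrite !mxE ler_norml.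
by have := ix k; have := iy k; rewrite intrD mulrDr mulr1; lra.
Qed.

Lemma cube_latdist_ge h i j x y : 0 < h -> cube h i x -> cube h j y ->
  h * (latdist i j)%:R - h <= `|x - y|.
Proof.
move=> h0 ix jy; have [->|[k kE]] : latdist i j = 0%N \/
    exists k, latdist i j = `|i ord0 k - j ord0 k|%N.
  rewrite /latdist; elim/big_ind : _ => [|a b [->|[k ->]] [->|[l ->]]|k _].
  - by left.
  - by left.
  - by right; exists l; rewrite max0n.
  - by right; exists k; rewrite maxn0.
  - by right; rewrite /maxn; case: ifP => _; [exists l|exists k].
  - by right; exists k.
  by rewrite mulr0 sub0r (@le_trans _ _ 0)// oppr_le0 ltW.
apply: le_trans (rV_coord_le_norm (x - y) k); rewrite !mxE kE.
rewrite natr_absz intr_norm intrB.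
have := ix k; have := jy k; rewrite !intrD !mulrDr !mulr1.
set a := (i ord0 k)%:~R; set b := (j ord0 k)%:~R => jyk ixk.
rewrite -{1}(gtr0_norm h0) -normrM mulrBr.
by case: (ger0P (h * a - h * b)); case: (ger0P (x ord0 k - y ord0 k)); lra.
Qed.

Lemma cube_latdist_le h i j x y m : 0 < h -> cube h i x -> cube h j y ->
  `|x - y| <= h * m%:R -> (latdist i j <= m.+1)%N.
Proof.
move=> h0 ix jy xy; have := le_trans (cube_latdist_ge h0 ix jy) xy.
by rewrite lerBlDr -[X in _ + X](mulr1 h) -mulrDr natr1 ler_pM2l// ler_nat.
Qed.

End Lattice.
Section LatticeCounting.
Variables (R : realType) (N : nat).

Implicit Types (i j : 'rV[int]_N) (x y : 'rV[R]_N).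

Lemma latpt_norm_le (h : R) i m : 0 <= h -> (latdist i 0 <= m)%N ->
  `|latpt h i| <= h * m%:R.
Proof.
move=> h0 /latdist_leP im; apply/rV_norm_leP => [|k]; first by rewrite mulr_ge0.
rewrite mxE normrM (ger0_norm h0) ler_wpM2l//.
by have := im k; rewrite mxE subr0 -intr_norm -natr_absz ler_nat.
Qed.

(* Counting lattice points of a grid finer than all the radii replaces the
   comparison of Lebesgue measures. *)
Lemma ball_cover_volume (c : 'rV[R]_N) (r : R) (L : seq ('rV[R]_N * R)) :
  0 < r -> (forall b, b \in L -> 0 < b.2) ->
  (forall x, `|x - c| <= r -> exists2 b, b \in L & `|x - b.1| <= b.2) ->
  r ^+ N <= 7 ^+ N * \sum_(b <- L) b.2 ^+ N.
Proof.
move=> r0 L0 cov.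
have [t /andP[t0 tr] tL] : exists2 t : R, 0 < t <= r & forall b, b \in L -> t <= b.2.
  elim: L L0 {cov} => [|b L IH] L0; first by exists r; rewrite ?r0/=.
  have [|t /andP[t0 tr] tL] := IH.
    by move=> b' b'L; apply: L0; rewrite inE b'L orbT.
  have b0 : 0 < b.2 by apply: L0; rewrite inE eqxx.
  exists (Num.min t b.2); first by rewrite lt_min t0 b0/= ge_min tr.
  move=> b'; rewrite inE => /predU1P[->|/tL tb']; first by rewrite ge_min lexx orbT.
  by rewrite ge_min tb'.
pose m := Num.truncn (r / t).
have rt0 : 0 <= r / t by rewrite divr_ge0 ?ltW.
have mr : m%:R * t <= r by rewrite -ler_pdivlMr// truncn_le.
have rm : r <= m.+1%:R * t by rewrite -ler_pdivrMr// ltW// truncnS_gt.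
pose X := latbox N m; pose P i := c + latpt t i.
have PX i : i \in X -> exists2 b, b \in L & `|P i - b.1| <= b.2.
  rewrite mem_latbox => im; apply: cov; rewrite /P addrC addKr.
  by apply: le_trans (latpt_norm_le (ltW t0) im) _; rewrite mulrC.
have PB i j : t * (latdist i j)%:R - t <= `|P i - P j|.
  rewrite (_ : P i - P j = latpt t i - latpt t j); last by rewrite /P opprD addrACA subrr add0r.
  exact: cube_latdist_ge t0 (latpt_cube i (ltW t0)) (latpt_cube j (ltW t0)).
have cX b : b \in L ->
    (count (fun i => `|P i - b.1| <= b.2) X)%:R <= 7 ^+ N * (b.2 / t) ^+ N.
  move=> bL; have tb := tL _ bL; rewrite -size_filter.
  have us : uniq [seq i <- X | `|P i - b.1| <= b.2] by rewrite filter_uniq ?latbox_uniq.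
  have b0 : 0 <= b.2 / t by rewrite divr_ge0 ?ltW// (lt_le_trans t0).
  have [->|[i' iB]] : [seq i <- X | `|P i - b.1| <= b.2] = [::] \/
      exists i, i \in [seq i <- X | `|P i - b.1| <= b.2].
    by case: [seq _ <- _ | _] => [|i s]; [left|right; exists i; rewrite inE eqxx].
    by rewrite mulr_ge0 ?exprn_ge0.
  move: i' iB => i; rewrite mem_filter => /andP[iB _].
  (* Two lattice points in one ball are at distance at most 2 b.2. This gives 2 M + 1 <= 4 (b.2 / t)
     + 3 <= 7 (b.2 / t), as b.2 >= t: the origin of 7. *)
  pose M := Num.truncn (2 * (b.2 / t) + 1).
  have dj j : j \in [seq i <- X | `|P i - b.1| <= b.2] -> (latdist j i <= M)%N.
    rewrite mem_filter => /andP[jB _].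
    have : t * (latdist j i)%:R - t <= 2 * b.2.
      apply: le_trans (PB j i) _; rewrite -(subrKA b.1).
      apply: le_trans (ler_normD _ _) _; rewrite [`|b.1 - _|]distrC; lra.
    rewrite lerBlDr => dji; rewrite truncn_ge_nat ?(addr_ge0 (mulr_ge0 (ler0n R 2) b0) ler01)//.
    rewrite -(ler_pM2l t0); apply: le_trans dji _.
    by rewrite le_eqVlt; apply/orP; left; apply/eqP; field; rewrite gt_eqF.
  apply: (@le_trans _ _ ((M + M).+1 ^ N)%:R).
    by rewrite ler_nat; apply: latbox_count dj.
  rewrite natrX -exprMn lerXn2r ?nnegrE ?(mulr_ge0 (ler0n R 7) b0)//.
  have : M%:R <= 2 * (b.2 / t) + 1 by rewrite truncn_le// addr_ge0// mulr_ge0.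
  have : 1 <= b.2 / t by rewrite ler_pdivlMr// mul1r.
  rewrite -[(M + M).+1%:R]natr1 natrD; lra.
have cover : ((m + m).+1 ^ N <= \sum_(b <- L) count (fun i => `|P i - b.1| <= b.2)%R X)%N.
  rewrite -size_latbox -/X -sum1_size big_seq.
  under eq_bigr do [].
  apply: (@leq_trans (\sum_(i <- X | i \in X) \sum_(b <- L) (`|P i - b.1| <= b.2)%R)%N).
    apply: leq_sum => i /PX[b bL ib].
    by rewrite (big_rem b)//= ib.
  rewrite -big_seq exchange_big /=; apply: leq_sum => b _.
  by rewrite -sum1_count [leqRHS]big_mkcond.
have r_le : (r / t) ^+ N <= ((m + m).+1 ^ N)%:R.
  rewrite natrX lerXn2r ?nnegrE// ler_pdivrMr//; apply: le_trans rm _.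
  by rewrite ler_pM2r// ler_nat ltnS leq_addr.
have : (r / t) ^+ N <= 7 ^+ N * \sum_(b <- L) (b.2 / t) ^+ N.
  apply: le_trans r_le _; apply: (@le_trans _ _
    (\sum_(b <- L) count (fun i => `|P i - b.1| <= b.2)%R X)%:R); first by rewrite ler_nat.
  by rewrite natr_sum mulr_sumr big_seq [leRHS]big_seq; apply: ler_sum => b /cX.
under eq_bigr do rewrite expr_div_n.
by rewrite -mulr_suml expr_div_n mulrA ler_pM2r// invr_gt0 exprn_gt0.
Qed.

(* Sliding the cells that meet the zero set of [G] along [e] in [r] far apart
   steps yields pairwise distinct cells of a box of radius O(r). *)
Lemma graph_cell_count (G : 'rV[R]_N -> R) (e : 'rV[R]_N) (La : R) : (0 < N)%N ->
  (forall x y, `|G x - G y| <= La * `|x - y|) ->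
  (forall x t, G (x + t *: e) = G x + t) ->
  exists2 C : nat, True & forall (h : R) (s : seq 'rV[int]_N) (i0 : 'rV[int]_N) (r : nat),
    0 < h -> (0 < r)%N -> uniq s ->
    (forall i, i \in s -> (latdist i i0 <= r)%N) ->
    (forall i, i \in s -> exists2 x, cube h i x & G x = 0) ->
    (size s <= C * r ^ N.-1)%N.
Proof.
move=> N0 GL Ge.
have La0 : 0 <= La.
  have := GL 0 e; have := Ge 0 1; rewrite add0r scale1r => ->.
  rewrite opprD addNKr normrN1 add0r normrN => h1.
  by rewrite leNgt; apply/negP => /ltW La0; have := mulr_le0_ge0 La0 (normr_ge0 e); lra.
(* If two slid cells coincide, their zeros of [G], moved by the difference of the slides, are within
   2 h of each other. [G] then differs by at most 2 La h, whereas distinct slides change it by at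
   least Th h; hence Th > 2 La. *)
have [Th ThE] : exists Th : R, Th = 2 * La + 1 by exists (2 * La + 1).
pose E := (Num.truncn (Th * `|e|)).+1.
have Th0 : 0 <= Th by rewrite ThE; lra.
exists (((E + E).+1 + 2 ) ^ N)%N => // h s i0 r h0 r0 us si sG.
pose sh (j : nat) : 'rV[int]_N := \row_k Num.floor (j%:R * Th * e ord0 k).
pose S := [seq i + sh l | i <- s, l <- iota 0 r].
have uS : uniq S.
  apply: allpairs_uniq; [by []|exact: iota_uniq|].
  move=> [i j] [i' j'] /allpairsP[[a b]/= [ia jb [-> ->]]] /allpairsP[[c d]/= [ic jd [-> ->]]] /rowP eq.
  have [x xi Gx] := sG _ ia; have [y yi Gy] := sG _ ic.
  have close : `|x + (h * (b%:R - d%:R) * Th) *: e - y| <= h * 2.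
    apply/rV_norm_leP => [|k]; first by rewrite mulr_ge0 ?ltW.
    have scaled (u : 'rV[int]_N) (z : 'rV[R]_N) : cube h u z ->
        (u ord0 k)%:~R <= z ord0 k / h <= (u ord0 k)%:~R + 1.
      move=> /(_ k); rewrite ler_pdivlMr// ler_pdivrMr// [_ * h]mulrC [_ * h]mulrC.
      by rewrite intrD.
    have xk := scaled _ _ xi; have yk := scaled _ _ yi.
    have bk := floor_itv (b%:R * Th * e ord0 k); have dk := floor_itv (d%:R * Th * e ord0 k).
    have := eq k; rewrite (_ : (0 : 'I_1) = ord0); last exact: val_inj.
    rewrite !mxE => /(congr1 (fun z : int => z%:~R : R)) eqk.
    rewrite !intrD in bk dk eqk.
    have -> : x ord0 k + h * (b%:R - d%:R) * Th * e ord0 k - y ord0 k =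
      h * (x ord0 k / h + b%:R * Th * e ord0 k - d%:R * Th * e ord0 k - y ord0 k / h).
      by field; rewrite gt_eqF.
    rewrite normrM (gtr0_norm h0) ler_pM2l// ler_norml.
    move: (x ord0 k / h) (y ord0 k / h) (b%:R * _ * _) (d%:R * _ * _) xk yk bk dk eqk.
    by move=> x' y' P Q; lra.
  have : `|h * (b%:R - d%:R) * Th| <= La * (h * 2).
    have := le_trans (GL _ _) (ler_wpM2l La0 close).
    by rewrite Ge Gx Gy subr0 add0r.
  rewrite -mulrA normrM (gtr0_norm h0) mulrCA ler_pM2l// => bd.
  have bd1 : `|b%:R - d%:R : R| < 1.
    rewrite ltNge; apply/negP => bd1.
    have := ler_wpM2r Th0 bd1; rewrite mul1r.
    move: bd; rewrite normrM (ger0_norm Th0) ThE; lra.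
  have bdE : b = d.
    apply/eqP; move: bd1; rewrite distrC; case: (ltngtP b d) => // lt.
      by rewrite gtr0_norm ?subr_gt0 ?ltr_nat// ltrBlDr -[X in _ < X + _]/(1%:R) -natrD ltr_nat add1n ltnS leqNgt lt.
    by rewrite distrC gtr0_norm ?subr_gt0 ?ltr_nat// ltrBlDr -[X in _ < X + _]/(1%:R) -natrD ltr_nat add1n ltnS leqNgt lt.
  congr pair => //; apply/rowP => k; have := eq k; rewrite !mxE bdE; exact: addIr.
have bS : forall z, z \in S -> (latdist z i0 <= r + r * E)%N.
  move=> _ /allpairsP[[i j]/= [/si ii0 jr ->]]; apply/latdist_leP => k.
  have ik := latdist_leP _ _ _ ii0 k; rewrite !mxE.
  suff : (`|Num.floor (j%:R * Th * e ord0 k)| <= r * E)%N.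
    by move: ik; move: (Num.floor _) (i ord0 k) (i0 ord0 k) (r * E)%N => F a c m; lia.
  have eE : `|j%:R * Th * e ord0 k| <= (r * E)%:R.
    rewrite -mulrA normrM normr_nat natrM ler_pM//.
      by rewrite ler_nat; move: jr; rewrite mem_iota; lia.
    rewrite normrM (ger0_norm Th0); apply: le_trans (ler_wpM2l Th0 (rV_coord_le_norm e k)) _.
    by rewrite ltW// truncnS_gt.
  move: eE; rewrite ler_norml => /andP[e1 e2].
  suff : - (r * E)%:Z <= Num.floor (j%:R * Th * e ord0 k) <= (r * E)%:Z.
    by move: (Num.floor _) (r * E)%N => z m; lia.
  apply/andP; split; first by rewrite floor_ge_int intrN.
  rewrite -(@intrKfloor R (r * E)%:Z); exact: le_floor.
have := latbox_count uS bS; rewrite size_allpairs size_iota => cnt.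
(* The [size s * r] slid cells lie in a box with 2 (r + r E) + 1 <= (2 E + 3) r cells a side; one
   factor r cancels. *)
have cnt2 : (size s * r <= ((E + E).+1 + 2) ^ N * r ^ N.-1 * r)%N.
  rewrite -mulnA -expnSr prednK// -expnMn; apply: leq_trans cnt _.
  by rewrite leq_exp2r//; nia.
by rewrite leq_pmul2r in cnt2.
Qed.

End LatticeCounting.

(** * Gradients and the divergence theorem *)

Section Gradient.
Variables (R : realType) (N : nat).
Implicit Types (x y z v : 'rV[R]_N) (g : 'rV[R]_N -> R).

Definition dotv v x : R := \sum_k v ord0 k * x ord0 k.

(** Differentiability at a single point, with nothing asked of the gradient elsewhere: complex
    differentiability gives this directly, and bisection asks no more. *)
Definition has_grad g y v := forall eta, 0 < eta -> exists2 dl : R, 0 < dl &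
  forall z, `|z - y| < dl -> `|g z - g y - dotv v (z - y)| <= eta * `|z - y|.

Definition unitv (k : 'I_N) : 'rV[R]_N := delta_mx ord0 k.

Lemma dotv_norm_le v x : `|dotv v x| <= (\sum_k `|v ord0 k|) * `|x|.
Proof.
rewrite mulr_suml; apply: le_trans (ler_norm_sum _ _ _) _; apply: ler_sum => k _.
by rewrite normrM ler_wpM2l// rV_coord_le_norm.
Qed.

Lemma near_norm y (P : 'rV[R]_N -> Prop) :
  (\forall z \near y, P z) <-> exists2 dl : R, 0 < dl & forall z, `|z - y| < dl -> P z.
Proof.
split=> [/nbhs_normP[e e0 eP]|[e e0 eP]].
  by exists e => // z zy; apply: eP; rewrite /= distrC.
by apply/nbhs_normP; exists e => // z; rewrite /= distrC; exact: eP.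
Qed.

Lemma has_gradP g y v : has_grad g y v <->
  forall eta, 0 < eta -> \forall z \near y, `|g z - g y - dotv v (z - y)| <= eta * `|z - y|.
Proof.
by split => gv eta eta0; apply/near_norm; exact: gv.
Qed.

Lemma has_grad_lip g y v : has_grad g y v -> exists2 C : R, 0 < C &
  \forall z \near y, `|g z - g y| <= C * `|z - y|.
Proof.
move=> /has_gradP gv; exists (1 + \sum_k `|v ord0 k|).
  by rewrite ltr_pwDl// sumr_ge0.
near=> z; rewrite mulrDl -(subrK (dotv v (z - y)) (g z - g y)).
apply: le_trans (ler_normD _ _) _; apply: lerD; last exact: dotv_norm_le.
by near: z; exact: gv.
Unshelve. all: by end_near. Qed.

Lemma near_norm_small y (eta : R) : 0 < eta -> \forall z \near y, `|z - y| <= eta.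
Proof. by move=> eta0; apply/near_norm; exists eta => // z /ltW. Qed.

Lemma has_grad_cont g y v : has_grad g y v ->
  forall eta, 0 < eta -> \forall z \near y, `|g z - g y| <= eta.
Proof.
move=> /has_grad_lip[C C0 gC] eta eta0; near=> z.
have zy : `|z - y| <= eta / C by near: z; apply: near_norm_small; rewrite divr_gt0.
have : `|g z - g y| <= C * `|z - y| by near: z.
move=> /le_trans; apply; apply: le_trans (ler_wpM2l (ltW C0) zy) _.
by rewrite mulrC divfK ?gt_eqF.
Unshelve. all: by end_near. Qed.

Lemma has_grad_cst (c : R) y : has_grad (fun=> c) y 0.
Proof.
move=> eta eta0; exists 1 => // z _.
rewrite subrr sub0r /dotv big1 ?oppr0 ?normr0 ?mulr_ge0 ?(ltW eta0)// => k _.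
by rewrite mxE mul0r.
Qed.

Lemma dotv_unitv k x : dotv (unitv k) x = x ord0 k.
Proof.
rewrite /dotv (bigD1 k)//= big1 ?addr0 => [|j jk]; rewrite mxE eqxx/=.
  by rewrite eqxx mul1r.
by rewrite (negbTE jk) mul0r.
Qed.

Lemma dotvDl v w x : dotv (v + w) x = dotv v x + dotv w x.
Proof. by rewrite -big_split; apply: eq_bigr => k _; rewrite mxE mulrDl. Qed.

Lemma dotvZl (a : R) v x : dotv (a *: v) x = a * dotv v x.
Proof. by rewrite mulr_sumr; apply: eq_bigr => k _; rewrite mxE mulrA. Qed.

Lemma has_grad_coord k (c : R) y : has_grad (fun x => x ord0 k - c) y (unitv k).
Proof.
move=> eta eta0; exists 1 => // z _; rewrite dotv_unitv !mxE.
rewrite (_ : _ - _ = 0) ?normr0 ?mulr_ge0 ?(ltW eta0)//; ring.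
Qed.

Lemma has_gradD f g y v w : has_grad f y v -> has_grad g y w ->
  has_grad (fun x => f x + g x) y (v + w).
Proof.
move=> /has_gradP fv /has_gradP gw; apply/has_gradP => eta eta0.
have e2 : 0 < eta / 2 by rewrite divr_gt0.
near=> z.
have -> : f z + g z - (f y + g y) - dotv (v + w) (z - y) =
  (f z - f y - dotv v (z - y)) + (g z - g y - dotv w (z - y)) by rewrite dotvDl; ring.
apply: le_trans (ler_normD _ _) _.
have -> : eta * `|z - y| = eta / 2 * `|z - y| + eta / 2 * `|z - y| by field.
by apply: lerD; near: z; [exact: fv|exact: gw].
Unshelve. all: by end_near. Qed.

Lemma has_gradM f g y v w : has_grad f y v -> has_grad g y w ->
  has_grad (fun x => f x * g x) y (g y *: v + f y *: w).
Proof.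
move=> fv gw; have [C C0 fC] := has_grad_lip fv; have cg := has_grad_cont gw.
move: fv gw => /has_gradP fv /has_gradP gw; apply/has_gradP => eta eta0.
have p0 (a : R) : 0 < 3 * (`|a| + 1) by rewrite mulr_gt0// ltr_wpDl.
have frac (a : R) : `|a| * (eta / (3 * (`|a| + 1))) <= eta / 3.
  have a1 : 0 < `|a| + 1 by rewrite ltr_wpDl.
  have -> : `|a| * (eta / (3 * (`|a| + 1))) = eta / 3 * (`|a| / (`|a| + 1)).
    by field; rewrite gt_eqF.
  by rewrite ler_piMr ?divr_ge0 ?(ltW eta0)// ler_pdivrMr// mul1r lerDl.
near=> z.
have -> : f z * g z - f y * g y - dotv (g y *: v + f y *: w) (z - y) =
  g y * (f z - f y - dotv v (z - y)) + f y * (g z - g y - dotv w (z - y)) +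
  (f z - f y) * (g z - g y) by rewrite dotvDl !dotvZl; ring.
have h1 : `|g y * (f z - f y - dotv v (z - y))| <= eta / 3 * `|z - y|.
  rewrite normrM; apply: (@le_trans _ _ (`|g y| * (eta / (3 * (`|g y| + 1)) * `|z - y|))).
    rewrite ler_wpM2l//; near: z; apply: fv; by rewrite divr_gt0.
  by rewrite mulrA ler_wpM2r.
have h2 : `|f y * (g z - g y - dotv w (z - y))| <= eta / 3 * `|z - y|.
  rewrite normrM; apply: (@le_trans _ _ (`|f y| * (eta / (3 * (`|f y| + 1)) * `|z - y|))).
    rewrite ler_wpM2l//; near: z; apply: gw; by rewrite divr_gt0.
  by rewrite mulrA ler_wpM2r.
have h3 : `|(f z - f y) * (g z - g y)| <= eta / 3 * `|z - y|.
  rewrite normrM; apply: (@le_trans _ _ (C * `|z - y| * (eta / (3 * C)))).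
    by apply: ler_pM => //; near: z => //; apply: cg; rewrite divr_gt0// mulr_gt0.
  rewrite le_eqVlt; apply/orP; left; apply/eqP; field.
  by rewrite gt_eqF.
apply: le_trans (ler_normD _ _) _.
have := le_trans (ler_normD (g y * (f z - f y - dotv v (z - y)))
  (f y * (g z - g y - dotv w (z - y)))) (lerD h1 h2).
have -> : eta * `|z - y| = eta / 3 * `|z - y| + eta / 3 * `|z - y| + eta / 3 * `|z - y|.
  by field.
move=> h; exact: lerD.
Unshelve. all: by end_near. Qed.

Lemma has_gradV g y v : g y != 0 -> has_grad g y v ->
  has_grad (fun x => (g x)^-1) y (- (g y)^-1 ^+ 2 *: v).
Proof.
move=> gy0 gv; have cg := has_grad_cont gv; have [C C0 gC] := has_grad_lip gv.
move: gv => /has_gradP gv; apply/has_gradP => eta eta0.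
pose a := `|g y|; have a0 : 0 < a by rewrite normr_gt0.
pose B := \sum_k `|v ord0 k|; have B0 : 0 <= B by exact: sumr_ge0.
pose e1 := eta * a ^+ 2 / 4.
have e10 : 0 < e1 by rewrite divr_gt0// mulr_gt0// exprn_gt0.
pose e2 := eta * a ^+ 3 / (4 * (B + 1)).
have B1 : 0 < B + 1 by rewrite ltr_wpDl.
have e20 : 0 < e2 by rewrite divr_gt0// mulr_gt0// exprn_gt0.
near=> z.
have gz_close : `|g z - g y| <= a / 2 by near: z; apply: cg; rewrite divr_gt0.
have gz_big : a / 2 <= `|g z|.
  have := ler_normB (g z) (g z - g y); rewrite subKr -/a; lra.
have gz0 : g z != 0 by rewrite -normr_gt0; apply: lt_le_trans gz_big; rewrite divr_gt0.
have -> : (g z)^-1 - (g y)^-1 - dotv (- (g y)^-1 ^+ 2 *: v) (z - y) =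
   (- g y * (g z - g y - dotv v (z - y)) + dotv v (z - y) * (g z - g y)) *
   ((g z)^-1 * (g y)^-1 ^+ 2) by rewrite dotvZl; field; rewrite gz0 gy0.
rewrite normrM.
have h1 : `|- g y * (g z - g y - dotv v (z - y))| <= a * (e1 * `|z - y|).
  by rewrite normrM normrN ler_wpM2l//; near: z; exact: gv.
have h2 : `|dotv v (z - y) * (g z - g y)| <= (B * `|z - y|) * e2.
  by rewrite normrM; apply: ler_pM => //; [exact: dotv_norm_le|near: z; exact: cg].
have h3 : `|(g z)^-1 * (g y)^-1 ^+ 2| <= 2 / a ^+ 3.
  rewrite normrM normrX !normfV -/a.
  have -> : 2 / a ^+ 3 = (a / 2)^-1 * a^-1 ^+ 2 by field; rewrite gt_eqF.
  rewrite ler_wpM2r ?exprn_ge0 ?invr_ge0 ?(ltW a0)//.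
  by rewrite lef_pV2 ?posrE ?divr_gt0 ?normr_gt0.
apply: (@le_trans _ _ ((a * (e1 * `|z - y|) + B * `|z - y| * e2) * (2 / a ^+ 3))).
  by apply: ler_pM => //; apply: le_trans (ler_normD _ _) (lerD h1 h2).
have -> : (a * (e1 * `|z - y|) + B * `|z - y| * e2) * (2 / a ^+ 3) =
  eta * `|z - y| * (1 / 2 + (B / (B + 1)) / 2).
  by rewrite /e1 /e2; field; rewrite !gt_eqF.
rewrite ler_piMr ?mulr_ge0 ?(ltW eta0)//.
have : B / (B + 1) <= 1 by rewrite ler_pdivrMr// mul1r lerDl.
lra.
Unshelve. all: by end_near. Qed.

Lemma has_gradX g y v n : has_grad g y v ->
  has_grad (fun x => g x ^+ n) y ((n%:R * g y ^+ n.-1) *: v).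
Proof.
move=> gv; elim: n => [|n IH]; first by rewrite mul0r scale0r; exact: has_grad_cst.
have -> : (fun x => g x ^+ n.+1) = (fun x => g x * g x ^+ n).
  by apply/funext => x; rewrite exprS.
have := has_gradM gv IH; congr has_grad.
rewrite scalerA -scalerDl; congr (_ *: _) => /=.
case: n {IH} => [|n] /=; first by rewrite expr0; ring.
by rewrite -[n.+2%:R]natr1 exprS; ring.
Qed.

Lemma has_grad_sqdist (c : 'rV[R]_N) (a : R) y :
  has_grad (fun x => \sum_k (x - c) ord0 k ^+ 2 + a) y (2 *: (y - c)).
Proof.
apply/has_gradP => eta eta0; near=> z.
have -> : \sum_k (z - c) ord0 k ^+ 2 + a - (\sum_k (y - c) ord0 k ^+ 2 + a) -
    dotv (2 *: (y - c)) (z - y) = \sum_k (z - y) ord0 k ^+ 2.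
  rewrite (_ : forall s t : R, s + a - (t + a) = s - t); last by move=> s t; ring.
  rewrite dotvZl /dotv mulr_sumr -!sumrB; apply: eq_bigr => k _.
  by rewrite !mxE; ring.
have zy : `|z - y| <= eta / (N%:R + 1).
  by near: z; apply: near_norm_small; rewrite divr_gt0// ltr_wpDl.
apply: le_trans (ler_norm_sum _ _ _) _.
apply: (@le_trans _ _ (\sum_(k < N) `|z - y| ^+ 2)).
  by apply: ler_sum => k _; rewrite normrX lerXn2r ?nnegrE// rV_coord_le_norm.
rewrite sumr_const card_ord -mulr_natr expr2 -mulrA mulrC ler_wpM2r//.
apply: le_trans (ler_wpM2r _ zy) _ => //.
by rewrite mulrAC ler_pdivrMr ?ltr_wpDl// ler_wpM2l ?(ltW eta0)// lerDl.
Unshelve. all: by end_near. Qed.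

End Gradient.

(** * The divergence theorem by bisection *)

Section Divergence.
Variables (R : realType) (N : nat).
Implicit Types (x y z v : 'rV[R]_N) (g : 'rV[R]_N -> R).

Definition finept (M : nat) (t : R) (f : {ffun 'I_N -> 'I_M}) : 'rV[R]_N :=
  \row_k (t * (f k)%:R).

Lemma finept_setl (M : nat) (t : R) (k : 'I_N) (l : 'I_M) (f : {ffun 'I_N -> 'I_M}) :
  (f k == 0 :> nat)%N ->
  finept t [ffun j => if j == k then l else f j] = finept t f + (t * l%:R) *: unitv R k.
Proof.
move=> /eqP fk; apply/rowP => j; rewrite !mxE ffunE eqxx /=.
by case: eqP => [->|]; rewrite ?fk ?mulr0 ?mulr1 ?addr0 ?add0r.
Qed.

Lemma sum_finept_split (M : nat) (k : 'I_N) (H : {ffun 'I_N -> 'I_M} -> R) :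
  (0 < M)%N ->
  \sum_f H f = \sum_(f : {ffun 'I_N -> 'I_M} | (f k == 0 :> nat)%N) \sum_(l < M)
    H [ffun j => if j == k then l else f j].
Proof.
move=> M0; rewrite exchange_big /= (partition_big (fun f : {ffun _} => f k) predT)//=.
apply: eq_bigr => l _.
rewrite (reindex_onto (fun f : {ffun 'I_N -> 'I_M} => [ffun j => if j == k then l else f j])
  (fun f : {ffun 'I_N -> 'I_M} => [ffun j => if j == k then Ordinal M0 else f j])) /=.
  apply: eq_bigl => f; rewrite ffunE !eqxx /=; apply/eqP/eqP => [/ffunP/(_ k)|fk].
    by rewrite !ffunE eqxx => <-.
  apply/ffunP => j; rewrite !ffunE; case: eqP => [->|//]; exact/val_inj/esym.
move=> f /eqP fk; apply/ffunP => j; rewrite !ffunE.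
by case: eqP => [->|].
Qed.

Lemma sum_telescope (M : nat) (k : 'I_N) (t : R) x g : (0 < M)%N ->
  \sum_(f : {ffun 'I_N -> 'I_M})
    (g (x + finept t f + t *: unitv R k) - g (x + finept t f)) =
  \sum_(f : {ffun 'I_N -> 'I_M} | (f k == 0 :> nat)%N)
    (g (x + finept t f + (t * M%:R) *: unitv R k) - g (x + finept t f)).
Proof.
move=> M0; rewrite (sum_finept_split k)//; apply: eq_bigr => f fk.
rewrite -[RHS](_ : \sum_(0 <= l < M) (g (x + finept t f + (t * l.+1%:R) *: unitv R k) -
  g (x + finept t f + (t * l%:R) *: unitv R k)) = _); last first.
  rewrite (telescope_sumr (fun l => g (x + finept t f + (t * l%:R) *: unitv R k)))//.
  by rewrite mulr0 scale0r addr0.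
rewrite big_mkord; apply: eq_bigr => l _.
rewrite finept_setl// !addrA; congr (g _ - g _).
by apply/rowP => j; rewrite !mxE -natr1; ring.
Qed.

(** Vertices of the unit cube: scaled by half the side, they give the corners of the 2^N halves
    produced by one bisection. *)
Definition boolv (b : {ffun 'I_N -> bool}) : 'rV[R]_N := \row_k (b k)%:R.

Lemma sum_finept_double (M : nat) (t : R) x (H : 'rV[R]_N -> R) :
  \sum_(f : {ffun 'I_N -> 'I_(M + M)}) H (x + finept t f) =
  \sum_(b : {ffun 'I_N -> bool}) \sum_(f : {ffun 'I_N -> 'I_M})
    H (x + (t * M%:R) *: boolv b + finept t f).
Proof.
rewrite pair_big /=.
pose to (bf : {ffun 'I_N -> bool} * {ffun 'I_N -> 'I_M}) : {ffun 'I_N -> 'I_(M + M)} :=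
  [ffun k => if bf.1 k then rshift M (bf.2 k) else lshift M (bf.2 k)].
rewrite (reindex to) /=.
  apply: eq_bigr => -[b f] _ /=; rewrite -addrA; congr (H (x + _)).
  apply/rowP => k; rewrite !mxE ffunE /=; case: (b k) => /=.
    by rewrite natrD mulrDr mulr1.
  by rewrite mulr0 add0r.
pose of_ (f : {ffun 'I_N -> 'I_(M + M)}) : {ffun 'I_N -> bool} * {ffun 'I_N -> 'I_M} :=
  ([ffun k => if fintype.split (f k) is inr _ then true else false],
   [ffun k => match fintype.split (f k) with inl a => a | inr a => a end]).
apply: onW_bij; exists of_.
  move=> [b f]; rewrite /of_ /to; congr pair; apply/ffunP => k; rewrite !ffunE /=;
    by case: (b k); rewrite ?(unsplitK (inr _ (f k))) ?(unsplitK (inl _ (f k))).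
move=> f; apply/ffunP => k; rewrite !ffunE /=.
by have := splitK (f k); case: (fintype.split (f k)) => a /= <-.
Qed.

Variables (W : 'I_N -> 'rV[R]_N -> R) (rho : 'rV[R]_N -> R).

(* Riemann sums of mesh t for the flux of W through the boundary of the cube of
   corner x and side t M, minus those for the integral of rho: the fluxes through
   the small faces telescope. *)
Definition divsum x (t : R) (M : nat) : R :=
  t ^+ N.-1 * \sum_(f : {ffun 'I_N -> 'I_M})
    (\sum_k (W k (x + finept t f + t *: unitv R k) - W k (x + finept t f)) -
     t * rho (x + finept t f)).

Lemma divsum_double x t M :
  divsum x t (M + M) =
  \sum_(b : {ffun 'I_N -> bool}) divsum (x + (t * M%:R) *: boolv b) t M.
Proof.
rewrite /divsum (sum_finept_double _ t x (fun z => \sum_k (W k (z + t *: unitv R k) - W k z) -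
  t * rho z)).
by rewrite mulr_sumr.
Qed.

Definition inbox x (s : R) y := forall k, x ord0 k <= y ord0 k <= x ord0 k + s.

(** Differentiability of [W] at y determines the flux through small cubes to first order; continuity
    of [rho] at y does the same for its Riemann sums. *)
Definition div_at y :=
  (exists2 A : 'I_N -> 'rV[R]_N, forall k, has_grad (W k) y (A k) &
     \sum_k A k ord0 k = rho y) /\
  (forall eta, 0 < eta -> exists2 dl : R, 0 < dl &
     forall z, `|z - y| < dl -> `|rho z - rho y| <= eta).

Lemma inbox_norm_le x s y z : 0 <= s -> inbox x s y -> inbox x s z -> `|z - y| <= s.
Proof.
move=> s0 yx zx; apply/rV_norm_leP => // k; rewrite !mxE ler_norml.
by have := yx k; have := zx k; lra.
Qed.

Lemma inbox_finept x s M (f : {ffun 'I_N -> 'I_M}) : 0 <= s -> (0 < M)%N ->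
  inbox x s (x + finept (s / M%:R) f).
Proof.
move=> s0 M0 k; rewrite !mxE lerDl lerD2l.
have M0' : 0 < M%:R :> R by rewrite ltr0n.
rewrite mulr_ge0 ?divr_ge0 ?(ltW M0')//= mulrAC ler_pdivrMr// ler_wpM2l// ler_nat ltnW//.
Qed.

Lemma inbox_finept_unitv x s M (f : {ffun 'I_N -> 'I_M}) k : 0 <= s -> (0 < M)%N ->
  (f k == 0 :> nat)%N ->
  inbox x s (x + finept (s / M%:R) f + s *: unitv R k).
Proof.
move=> s0 M0 /eqP fk j; have [->|jk] := eqVneq j k.
  by rewrite !mxE fk mulr0 addr0 !eqxx mulr1 lerDl s0 lexx.
by have := inbox_finept x f s0 M0 j; rewrite !mxE (negbTE jk) andbF mulr0 addr0.
Qed.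

Lemma card_zero_coord M (k : 'I_N) : (0 < M)%N ->
  (\sum_(f : {ffun 'I_N -> 'I_M} | (f k == 0 :> nat)%N) 1 = M%:R ^+ N.-1 :> R).
Proof.
move=> M0; have MR : M%:R != 0 :> R by rewrite pnatr_eq0 -lt0n.
apply: (mulfI MR); rewrite -exprS prednK; last by apply: leq_ltn_trans (ltn_ord k).
have := sum_finept_split k (fun=> 1) M0.
rewrite sumr_const card_ffun !card_ord => h.
rewrite -natrX h mulr_sumr; apply: eq_bigr => f _.
by rewrite sumr_const card_ord mulr1.
Qed.

(** Near [y] the field is affine to first order. The flux of the affine part through a cube of side
    s is exactly s^N times the trace, and the sum of [rho] is s^N [rho y] up to a small error; these
    cancel. The bound is uniform in the number [M] of subdivisions, as the bisection requires. *)
Lemma divsum_local y : (0 < N)%N -> div_at y -> forall eta, 0 < eta ->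
  exists2 dl : R, 0 < dl & forall x s M, 0 < s < dl -> (0 < M)%N -> inbox x s y ->
    `|divsum x (s / M%:R) M| <= eta * s ^+ N.
Proof.
move=> N0 [[A WA trA] rhoc] eta eta0.
have K0 : 0 < 2 * N%:R + 1 :> R by rewrite ltr_wpDl// mulr_ge0.
(* Each of the N pairs of opposite faces costs 2 e', and the sum of [rho] costs e'. *)
pose e' := eta / (2 * N%:R + 1); have e'0 : 0 < e' by rewrite divr_gt0.
have [d1 d10 Hd1] := rhoc _ e'0.
have [dW Hd] := @choice _ _ (fun k (d : R) => 0 < d /\ forall z, `|z - y| < d ->
    `|W k z - W k y - dotv (A k) (z - y)| <= e' * `|z - y|)
  (fun k => let: ex_intro2 d d0 Hd := WA k _ e'0 in ex_intro _ d (conj d0 Hd)).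
pose dl := \big[Num.min/d1]_k dW k.
have dl0 : 0 < dl.
  by rewrite /dl; elim/big_ind : _ => // [a b a0 b0|k _]; rewrite ?lt_min ?a0//; case: (Hd k).
have dl1 : dl <= d1 by exact: bigmin_le_id.
have dlW k : dl <= dW k by exact: bigmin_le_cond.
exists dl => // x s M /andP[s0 sdl] M0 yx.
have MR : 0 < M%:R :> R by rewrite ltr0n.
set t := s / M%:R; have t0 : 0 < t by rewrite divr_gt0.
have tM : t * M%:R = s by rewrite divfK ?gt_eqF.
have sE : s ^+ N = s * s ^+ N.-1 by rewrite -exprS prednK.
rewrite /divsum sumrB exchange_big /=.
under eq_bigr => k _ do rewrite sum_telescope// tM.
have tMN : t ^+ N.-1 * M%:R ^+ N.-1 = s ^+ N.-1 by rewrite -exprMn tM.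
have nearb z : inbox x s z -> `|z - y| <= s by exact: inbox_norm_le (ltW s0) yx.
have sumc k (c : R) : t ^+ N.-1 * \sum_(f : {ffun 'I_N -> 'I_M} | (f k == 0 :> nat)%N) c =
    s ^+ N.-1 * c.
  rewrite -tMN -(card_zero_coord k M0) -mulrA mulr_suml.
  by under [in RHS]eq_bigr do rewrite mul1r.
have part1 k : `|t ^+ N.-1 * (\sum_(f : {ffun 'I_N -> 'I_M} | (f k == 0 :> nat)%N)
    (W k (x + finept t f + s *: unitv R k) - W k (x + finept t f))) -
    s ^+ N * A k ord0 k| <= 2 * e' * s ^+ N.
  have -> : s ^+ N * A k ord0 k = s ^+ N.-1 * (s * A k ord0 k) by rewrite sE; ring.
  rewrite -(sumc k) -mulrBr -sumrB normrM (ger0_norm (exprn_ge0 _ (ltW t0))).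
  have -> : 2 * e' * s ^+ N = s ^+ N.-1 * (2 * e' * s) by rewrite sE; ring.
  rewrite -(sumc k) ler_wpM2l ?exprn_ge0 ?(ltW t0)//.
  apply: le_trans (ler_norm_sum _ _ _) _; apply: ler_sum => f fk.
  set p := x + finept t f.
  have np : `|p - y| <= s by apply/nearb/inbox_finept; rewrite ?(ltW s0).
  have nq : `|p + s *: unitv R k - y| <= s.
    by apply/nearb/inbox_finept_unitv; rewrite ?(ltW s0).
  have [_ HW] := Hd k.
  have hp := HW p (le_lt_trans np (lt_le_trans sdl (dlW k))).
  have hq := HW _ (le_lt_trans nq (lt_le_trans sdl (dlW k))).
  have dotE : dotv (A k) (p + s *: unitv R k - y) = dotv (A k) (p - y) + s * A k ord0 k.
    rewrite /dotv (bigD1 k)//= [in RHS](bigD1 k)//= !mxE !eqxx mulr1.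
    rewrite (eq_bigr (fun j => A k ord0 j * (p - y) ord0 j)); first by ring.
    by move=> j jk; rewrite !mxE (negbTE jk) andbF mulr0 addr0.
  have hp' := le_trans hp (ler_wpM2l (ltW e'0) np).
  have hq' := le_trans hq (ler_wpM2l (ltW e'0) nq).
  rewrite dotE in hq'.
  move: hp' hq'; rewrite !ler_norml; lra.
have part2 : `|t ^+ N.-1 * (\sum_(f : {ffun 'I_N -> 'I_M}) t * rho (x + finept t f)) -
    s ^+ N * rho y| <= e' * s ^+ N.
  have sumc' (c : R) : t ^+ N.-1 * \sum_(f : {ffun 'I_N -> 'I_M}) (t * c) = s ^+ N * c.
    have tN : t ^+ N = t * t ^+ N.-1 by rewrite -exprS prednK.
    rewrite sumr_const card_ffun !card_ord -mulr_natr natrX -tM.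
    by rewrite [X in _ = X * _]exprMn tN; ring.
  rewrite -(sumc' (rho y)) -mulrBr -sumrB normrM (ger0_norm (exprn_ge0 _ (ltW t0))).
  rewrite [e' * _]mulrC -(sumc' e') ler_wpM2l ?exprn_ge0 ?(ltW t0)//.
  apply: le_trans (ler_norm_sum _ _ _) _; apply: ler_sum => f _.
  rewrite -mulrBr normrM (gtr0_norm t0) ler_wpM2l ?(ltW t0)//.
  apply: Hd1; apply: le_lt_trans (lt_le_trans sdl dl1).
  by apply/nearb/inbox_finept; rewrite ?(ltW s0).
have -> : t ^+ N.-1 * (\sum_k \sum_(f : {ffun 'I_N -> 'I_M} | (f k == 0 :> nat)%N)
      (W k (x + finept t f + s *: unitv R k) - W k (x + finept t f)) -
      \sum_(f : {ffun 'I_N -> 'I_M}) t * rho (x + finept t f)) =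
    \sum_k (t ^+ N.-1 * (\sum_(f : {ffun 'I_N -> 'I_M} | (f k == 0 :> nat)%N)
      (W k (x + finept t f + s *: unitv R k) - W k (x + finept t f))) - s ^+ N * A k ord0 k) -
    (t ^+ N.-1 * (\sum_(f : {ffun 'I_N -> 'I_M}) t * rho (x + finept t f)) -
      s ^+ N * rho y).
  rewrite sumrB -!mulr_sumr trA mulrBr; ring.
apply: le_trans (ler_normB _ _) _.
apply: le_trans (lerD (le_trans (ler_norm_sum _ _ _) (ler_sum _ (fun k _ => part1 k))) part2) _.
rewrite sumr_const card_ord -[X in X + _ <= _]mulr_natr.
have -> : 2 * e' * s ^+ N * N%:R + e' * s ^+ N = e' * (2 * N%:R + 1) * s ^+ N by ring.
by rewrite divfK ?gt_eqF.
Qed.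

Lemma nested_boxes (x : nat -> 'rV[R]_N) (s : R) : 0 < s ->
  (forall n, exists b, x n.+1 = x n + (s / 2 ^+ n.+1) *: boolv b) ->
  exists y, forall n, inbox (x n) (s / 2 ^+ n) y.
Proof.
move=> s0 xS.
have p2 n : 0 < s / 2 ^+ n by rewrite divr_gt0// exprn_gt0.
have half n : s / 2 ^+ n = s / 2 ^+ n.+1 + s / 2 ^+ n.+1.
  by rewrite exprS; field; rewrite expf_neq0.
have step n k : x n ord0 k <= x n.+1 ord0 k /\
    x n.+1 ord0 k + s / 2 ^+ n.+1 <= x n ord0 k + s / 2 ^+ n.
  have [b ->] := xS n; rewrite !mxE (half n); have := p2 n.+1.
  move: (s / 2 ^+ n.+1) => a.
  by case: (b k); rewrite /= ?mulr1 ?mulr0; lra.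
have mono n m k : x n ord0 k <= x (n + m)%N ord0 k /\
    x (n + m)%N ord0 k + s / 2 ^+ (n + m) <= x n ord0 k + s / 2 ^+ n.
  elim: m => [|m [h1 h2]]; first by rewrite addn0.
  by have [h3 h4] := step (n + m)%N k; rewrite addnS; split; lra.
have ubx n m k : x n ord0 k <= x m ord0 k + s / 2 ^+ m.
  have [h1 _] := mono n m k; have [_ h2] := mono m n k; have := p2 (m + n)%N.
  by rewrite addnC in h1; lra.
exists (\row_k sup (range (fun n => x n ord0 k))) => n k; rewrite !mxE; apply/andP; split.
  apply: ub_le_sup; last by exists n.
  by exists (x n ord0 k + s / 2 ^+ n) => _ [m _ <-]; exact: ubx.
apply: ge_sup; first by exists (x n ord0 k); exists n.
by move=> _ [m _ <-]; exact: ubx.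
Qed.

(* Goursat's bisection argument: no integrability of the derivatives is needed. *)
Lemma divsum_small x s : (0 < N)%N -> 0 < s -> (forall y, inbox x s y -> div_at y) ->
  forall eta, 0 < eta -> exists m0, forall m, (m0 <= m)%N ->
    `|divsum x (s / (2 ^ m)%:R) (2 ^ m)| <= eta * s ^+ N.
Proof.
move=> N0 s0 boxD eta eta0; apply: contrapT => notP.
pose P z r := exists m0, forall m, (m0 <= m)%N ->
    `|divsum z (r / (2 ^ m)%:R) (2 ^ m)| <= eta * r ^+ N.
(* If the bound fails on a cube, it fails on one of its halves: [divsum_double] adds up the 2^N
   halves and 2^N (r / 2)^N = r^N, so [eta] does not deteriorate. *)
have child z r : 0 < r -> ~ P z r -> exists b, ~ P (z + (r / 2) *: boolv b) (r / 2).
  move=> r0 nP; apply: contrapT => /forallNP allP; apply: nP.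
  have /choice[m0 Hm0] : forall b, exists m0, forall m, (m0 <= m)%N ->
      `|divsum (z + (r / 2) *: boolv b) (r / 2 / (2 ^ m)%:R) (2 ^ m)| <= eta * (r / 2) ^+ N.
    by move=> b; exact: contrapT (allP b).
  (* The successor: level [m.+1] on a cube has the mesh of level [m] on its halves. *)
  exists (\max_b m0 b).+1 => -[//|m]; rewrite ltnS => mm.
  have m2 : (2 ^ m.+1 = 2 ^ m + 2 ^ m)%N by rewrite expnS mul2n addnn.
  have m20 : (2 ^ m)%:R != 0 :> R by rewrite pnatr_eq0 expn_eq0.
  rewrite {2}m2 divsum_double.
  have -> : r / (2 ^ m.+1)%:R = r / 2 / (2 ^ m)%:R.
    by rewrite expnS natrM; field.
  rewrite divfK//; apply: le_trans (ler_norm_sum _ _ _) _.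
  apply: (@le_trans _ _ (\sum_(b : {ffun 'I_N -> bool}) eta * (r / 2) ^+ N)).
    apply: ler_sum => b _; apply: Hm0; apply: leq_trans mm.
    by apply: (@leq_bigmax _ (fun b => m0 b)).
  rewrite sumr_const card_ffun card_bool card_ord -[X in X <= _]mulr_natr natrX -mulrA -exprMn.
  by rewrite divfK.
have /choice[nb Hnb] : forall zn : 'rV[R]_N * nat, exists b, ~ P zn.1 (s / 2 ^+ zn.2) ->
    ~ P (zn.1 + (s / 2 ^+ zn.2.+1) *: boolv b) (s / 2 ^+ zn.2.+1).
  move=> [z m] /=; have [Pz|nPz] := pselect (P z (s / 2 ^+ m)); first by exists [ffun=> false].
  have sm : 0 < s / 2 ^+ m by rewrite divr_gt0// exprn_gt0.
  have [b Hb] := child _ _ sm nPz; exists b => _.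
  by rewrite exprSr invfM mulrA.
pose xs := fix xs n := if n is n'.+1 then
  xs n' + (s / 2 ^+ n'.+1) *: boolv (nb (xs n', n')) else x.
have nP n : ~ P (xs n) (s / 2 ^+ n).
  elim: n => [|n IH]; first by rewrite expr0 divr1.
  exact: (Hnb (xs n, n)).
have [|y Hy] := @nested_boxes xs s s0; first by move=> n; exists (nb (xs n, n)).
have /boxD Dy : inbox x s y by have := Hy 0%N; rewrite /= expr0 divr1.
(* At the common point the local bound holds for every subdivision of a small enough cube, against
   the failure kept along the bisection. *)
have [dl dl0 Hdl] := divsum_local N0 Dy eta0.
pose n := Num.bound (s / dl).
have sn : s / 2 ^+ n < dl.
  by rewrite ltr_pdivrMr ?exprn_gt0// mulrC -ltr_pdivrMr// upper_nthrootP.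
apply: (nP n); exists 0%N => m _; apply: Hdl => //; last by rewrite expn_gt0.
by rewrite sn divr_gt0// exprn_gt0.
Qed.

End Divergence.

(** * Integrals and step functions *)

Section IntegralBounds.
Context d (T : measurableType d) (R : realType) (mu : {measure set T -> \bar R}).
Local Open Scope ereal_scope.

(** The integral of a nonnegative function is a supremum over the simple functions below it, so
    monotonicity asks for no measurability. Comparison with step functions then applies to |f|^p and
    |f|^q as they are. *)
Lemma le_integral_ge0 (f g : T -> \bar R) :
  (forall x, 0 <= f x) -> (forall x, f x <= g x) ->
  \int[mu]_x f x <= \int[mu]_x g x.
Proof.
move=> f0 fg; have g0 x : 0 <= g x by exact: le_trans (fg x).
rewrite !ge0_integralTE//; apply: ereal_sup_le => _ [h hf <-].
by exists h => // x; exact: le_trans (fg x).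
Qed.

Lemma integral_step (I : Type) (s : seq I) (c : I -> R) (A : I -> set T) :
  (forall i, 0 <= c i)%R -> (forall i, measurable (A i)) ->
  \int[mu]_x \sum_(i <- s) (c i * \1_(A i) x)%:E = \sum_(i <- s) (c i)%:E * mu (A i).
Proof.
move=> c0 mA; rewrite ge0_integral_sum//; last 2 first.
- move=> i; apply/measurable_EFinP; apply: measurable_funM => //.
- by move=> i x _; rewrite lee_fin mulr_ge0.
apply: eq_bigr => i _; under eq_integral do rewrite EFinM.
rewrite ge0_integralZl_EFin//; first by rewrite integral_indic// setIT.
- by apply/measurable_EFinP.
Qed.

Lemma integral_le_step (I : Type) (s : seq I) (c : I -> R) (A : I -> set T)
    (D : set T) (f : T -> R) :
  (forall i, 0 <= c i)%R -> (forall i, measurable (A i)) ->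
  (forall x, D x -> 0 <= f x <= \sum_(i <- s) (c i * \1_(A i) x))%R ->
  \int[mu]_(x in D) (f x)%:E <= \sum_(i <- s) (c i)%:E * mu (A i).
Proof.
move=> c0 mA fD; rewrite -integral_step// integral_mkcond.
apply: le_integral_ge0 => x; rewrite patchE; case: ifPn => xD//.
- by rewrite lee_fin; case/andP: (fD x (set_mem xD)).
- by rewrite sumEFin lee_fin; case/andP: (fD x (set_mem xD)).
- by rewrite sumEFin lee_fin sumr_ge0// => i _; rewrite mulr_ge0.
Qed.

Lemma step_le_integral (I : Type) (s : seq I) (c : I -> R) (A : I -> set T)
    (D : set T) (f : T -> R) :
  (forall i, 0 <= c i)%R -> (forall i, measurable (A i)) -> (forall i, A i `<=` D) ->
  (forall x, D x -> \sum_(i <- s) (c i * \1_(A i) x) <= f x)%R ->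
  \sum_(i <- s) (c i)%:E * mu (A i) <= \int[mu]_(x in D) (f x)%:E.
Proof.
move=> c0 mA AD fD; rewrite -integral_step// [leRHS]integral_mkcond.
apply: le_integral_ge0 => x.
  by rewrite sumEFin lee_fin sumr_ge0// => i _; rewrite mulr_ge0.
rewrite patchE; case: ifPn => [/set_mem xD|/negP xD]; first by rewrite sumEFin lee_fin fD.
rewrite big1// => i _; rewrite indicE memNset ?mulr0// => /AD Dx.
by apply: xD; rewrite inE.
Qed.

End IntegralBounds.

(** * Measurability for Hausdorff and Lebesgue measures *)

Section MetricOuterMeasure.
Context (R : realType) (T : Type) (mu : {outer_measure set T -> \bar R}).
Variable dist : T -> T -> R.
Hypothesis dist_triangle : forall x y z, (dist x z <= dist x y + dist y z)%R.
Hypothesis mu_separated : forall (A B : set T) (dl : R), (0 < dl)%R ->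
  (forall x y, A x -> B y -> (dl <= dist x y)%R) ->
  (mu A + mu B <= mu (A `|` B))%E.

(** Caratheodory's criterion for metric outer measures. [E m] is the part of X at distance at least
    1 / (m + 1) from [C], and the point is that mu (E m) exhausts X minus C: the shells [D m] of
    equal parity are separated from each other, so their measures are summable and the tails
    vanish. *)
Lemma metric_outer_caratheodory (C : set T) :
  (forall x, ~ C x -> exists2 dl : R, (0 < dl)%R & forall c, C c -> (dl <= dist x c)%R) ->
  mu.-caratheodory C.
Proof.
move=> closedC; apply: le_caratheodory_measurable => X.
have [->|muX] := eqVneq (mu X) +oo%E; first exact: leey.
have mu0 (A : set T) : (0 <= mu A)%E by exact: outer_measure_ge0.
have muX_fin (A : set T) : A `<=` X -> mu A \is a fin_num.
  move=> AX; rewrite ge0_fin_numE ?outer_measure_ge0//.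
  by apply: le_lt_trans (le_outer_measure mu _ _ AX) _; rewrite ltey.
pose E (m : nat) := [set x | X x /\ forall c, C c -> (m.+1%:R^-1 <= dist x c)%R].
have EX m : E m `<=` X by move=> x [].
pose D m := E m.+1 `\` E m.
have DX m : D m `<=` X by move=> x [[]].
have inv_lt m : (m.+2%:R^-1 < m.+1%:R^-1 :> R)%R by rewrite ltf_pV2 ?posrE ?ltr_nat.
have EE m : E m `<=` E m.+1.
  by move=> x [Xx Ex]; split => // c Cc; apply: le_trans (Ex c Cc); rewrite ltW.
have E_le m k : (m <= k)%N -> E m `<=` E k.
  move=> /subnK <-; elim: (k - m)%N => // j IH.
  by rewrite addSn; apply: subset_trans IH _; exact: EE.
have sep m : (mu (E m) + mu (D m.+1) <= mu (E m.+2))%E.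
  apply: (@le_trans _ _ (mu (E m `|` D m.+1))); last first.
    by apply: le_outer_measure => x [/E_le|[]//]; apply; rewrite leqW.
  apply: (@mu_separated _ _ (m.+1%:R^-1 - m.+2%:R^-1)%R); first by rewrite subr_gt0.
  move=> x y [Xx Ex] [[Xy _] nEy].
  have [c [Cc yc]] : exists c, C c /\ (dist y c < m.+2%:R^-1)%R.
    apply: contrapT => nc; apply: nEy; split => // c Cc; rewrite leNgt; apply/negP => yc.
    by apply: nc; exists c.
  have := Ex c Cc; have := dist_triangle x y c.
  by move: (m.+1%:R^-1)%R (m.+2%:R^-1)%R yc => a b; lra.
have mem_E x : X x -> ~ C x -> exists m, E m x.
  move=> Xx /closedC[dl dl0 dlC]; exists (Num.truncn dl^-1); split => // c /dlC.
  by apply: le_trans; rewrite invf_ple ?posrE// ltW// truncnS_gt.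
have XC_E m : (mu (X `&` C) + mu (E m) <= mu X)%E.
  apply: (@le_trans _ _ (mu ((X `&` C) `|` E m))); last first.
    by apply: le_outer_measure => x [[]|/EX].
  rewrite addeC setUC; apply: (@mu_separated _ _ m.+1%:R^-1%R); first by rewrite invr_gt0.
  by move=> x y [_ Ex] [_ /Ex].
(* Both parities at once: the induction carries mu (E M) + mu (E M.+1) and uses one separated pair
   per step, whence twice mu X. *)
have sumD M : (\sum_(0 <= m < M) mu (D m.+1) <= mu X + mu X)%E.
  suff : (\sum_(0 <= m < M) mu (D m.+1) + mu (E 0%N) + mu (E 1%N) <= mu (E M) + mu (E M.+1))%E.
    move=> le1; apply: le_trans (leeD (le_outer_measure mu _ _ (EX M))
      (le_outer_measure mu _ _ (EX M.+1))).
    by apply: le_trans le1; rewrite -addeA leeDl// adde_ge0.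
  elim: M => [|M IH]; first by rewrite big_nil add0e.
  rewrite big_nat_recr//=; apply: le_trans (leeD2l _ (sep M)).
  rewrite addeA [X in (_ <= X + _)%E]addeC.
  apply: le_trans (leeD2r _ IH).
  suff -> : forall a b c d : \bar R, (a + b + c + d = a + c + d + b)%E by [].
  by move=> a b c d; rewrite -!addeA; congr (_ + _)%E; rewrite addeC -addeA.
have serD : (\sum_(0 <= m <oo) mu (D m) < +oo)%E.
  rewrite (nneseries_split _ 1)// add0n big_nat1 -ge0_fin_numE; last first.
    by rewrite adde_ge0// nneseries_ge0.
  rewrite fin_numD muX_fin//= ge0_fin_numE ?nneseries_ge0//.
  apply: (@le_lt_trans _ _ (mu X + mu X)%E); last first.
    by rewrite ltey_eq fin_numD !muX_fin.
  apply: lime_le; first exact: is_cvg_nneseries.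
  apply: nearW => -[|M]; first by rewrite big_geq// adde_ge0.
  by rewrite big_add1 /= sumD.
have tail := nneseries_tail_cvg serD (fun k _ => outer_measure_ge0 mu (D k)).
have bound m : (mu (X `&` C) + mu (X `&` ~` C) <= mu X + \sum_(m <= k <oo) mu (D k))%E.
  apply: le_trans (leeD2r _ (XC_E m)); rewrite -addeA leeD2l//.
  have cover : X `&` ~` C `<=` E m `|` \bigcup_k (D (m + k)%N).
    move=> x [Xx /(mem_E _ Xx)[k Ek]].
    have [km|mk] := leqP k m; first by left; exact: E_le Ek.
    have ex : exists k, x \in E (m + k)%N.
      by exists (k - m)%N; rewrite subnKC ?inE// ltnW.
    case: (ex_minnP ex) => -[|j]; first by rewrite addn0 inE; left.
    rewrite addnS inE => Ej jmin; right; exists j => //; split => // /mem_set /jmin.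
    by rewrite ltnn.
  apply: le_trans (le_outer_measure mu _ _ cover) _.
  apply: le_trans (outer_measureU2 mu _ _) _; rewrite leeD2l//.
  apply: le_trans (outer_measure_sigma_subadditive mu _) _.
  rewrite -(@nneseries_addn _ (fun k => mu (D k)))//.
  by under eq_eseriesr do rewrite addnC.
have lim0 : (mu X + \sum_(m <= k <oo) mu (D k))%E @[m --> \oo] --> mu X.
  rewrite -[X in _ --> X]adde0; apply: cvgeD; [|exact: cvg_cst|exact: tail].
  by rewrite fin_num_adde_defl.
rewrite -(cvg_lim _ lim0)//.
apply: lime_ge; first by apply/cvg_ex; exists (mu X).
exact: nearW.
Qed.

End MetricOuterMeasure.
Section HalfSpaces.
Variables (R : realType) (n : nat).
Local Notation N := (n + n)%N.
Local Open Scope ereal_scope.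

(** The hyperplane cuts each box of a cover into two boxes of the same total volume, so a cover
    splits at no cost. *)
Lemma lebesgue_halfspace_measurable (k : 'I_N) (c : R) :
  (@lebesgue_outer R n).-caratheodory [set z | (realify z ord0 k <= c)%R].
Proof.
set H := [set _ | _]; apply: (@le_caratheodory_measurable R _ (@lebesgue_outer R n)) => X.
apply: le_ereal_inf_tmp => _ [F [PF XF] <-].
pose upd (a : 'rV[R]_N) (r : R) : 'rV[R]_N := \row_j (if j == k then r else a ord0 j).
have updE a r j : upd a r ord0 j = if j == k then r else a ord0 j by rewrite mxE.
(* The cut is [c] clamped to the side of the box, so a box on one side of the hyperplane gives an
   empty second piece of volume 0. *)
pose lo (ab : 'rV[R]_N * 'rV[R]_N) :=
  (ab.1, upd ab.2 (Num.max (ab.1 ord0 k) (Num.min (ab.2 ord0 k) c))).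
pose hi (ab : 'rV[R]_N * 'rV[R]_N) :=
  (upd ab.1 (Num.min (ab.2 ord0 k) (Num.max (ab.1 ord0 k) c)), ab.2).
pose Pbox (ab : 'rV[R]_N * 'rV[R]_N) := forall j, (ab.1 ord0 j <= ab.2 ord0 j)%R.
have lo_box ab : Pbox ab -> Pbox (lo ab).
  by move=> Pab j; rewrite /lo /= updE; case: (eqVneq j k) => [->|_]; rewrite ?le_max ?lexx.
have hi_box ab : Pbox ab -> Pbox (hi ab).
  by move=> Pab j; rewrite /hi /= updE; case: (eqVneq j k) => [->|_]; rewrite ?ge_min ?lexx.
have vol ab : Pbox ab -> box_volume (lo ab) + box_volume (hi ab) = box_volume ab.
  move=> Pab; rewrite /box_volume -EFinD; congr EFin.
  rewrite (bigD1 k)//= [X in (_ + X)%R](bigD1 k)//= [RHS](bigD1 k)//= !mxE eqxx.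
  rewrite (eq_bigr (fun j => ab.2 ord0 j - ab.1 ord0 j)%R); last first.
    by move=> j jk; rewrite mxE (negbTE jk).
  rewrite [X in (_ + _ * X)%R](eq_bigr (fun j => ab.2 ord0 j - ab.1 ord0 j)%R); last first.
    by move=> j jk; rewrite mxE (negbTE jk).
  rewrite -mulrDl; congr (_ * _)%R; have := Pab k.
  rewrite /Num.max /Num.min; do !case: ifP; lra.
have sub_lo ab z : box ab z -> H z -> box (lo ab) z.
  move=> bz Hz j; rewrite /lo /= updE; case: (eqVneq j k) => [->|_]; last exact: bz.
  by have /andP[-> zb] := bz k; rewrite le_max le_min zb [(_ <= c)%R]Hz orbT.
have sub_hi ab z : box ab z -> ~ H z -> box (hi ab) z.
  move=> bz /negP; rewrite -ltNge => Hz j; rewrite /hi /= updE; case: (eqVneq j k) => [->|_]; last exact: bz.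
  by have /andP[az ->] := bz k; rewrite gt_min gt_max az Hz orbT.
pose w := oapp (@box_volume R n) 0.
have w0 (G : nat -> option ('rV[R]_N * 'rV[R]_N)) :
    (forall i, oapp Pbox True (G i)) -> forall i, 0 <= w (G i).
  by move=> PG i; move: (PG i); rewrite /w; case: (G i) => //= ab; exact: box_volume_ge0.
have Plo i : oapp Pbox True (omap lo (F i)).
  by have := PF i; case: (F i) => //= ab; exact: lo_box.
have Phi i : oapp Pbox True (omap hi (F i)).
  by have := PF i; case: (F i) => //= ab; exact: hi_box.
apply: (@le_trans _ _ (\sum_(i <oo) w (omap lo (F i)) + \sum_(i <oo) w (omap hi (F i)))).
  apply: leeD.
  - apply: ereal_inf_lbound; exists (fun i => omap lo (F i)); last by [].
    split=> // z [Xz Hz]; have [i _ iz] := XF _ Xz; exists i => //.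
    by move: iz; case: (F i) => //= ab bz; exact: sub_lo.
  - apply: ereal_inf_lbound; exists (fun i => omap hi (F i)); last by [].
    split=> // z [Xz Hz]; have [i _ iz] := XF _ Xz; exists i => //.
    by move: iz; case: (F i) => //= ab bz; exact: sub_hi.
rewrite -nneseriesD; [|by move=> i _ _; exact: (w0 _ Plo)|by move=> i _ _; exact: (w0 _ Phi)].
rewrite le_eqVlt; apply/orP; left; apply/eqP; apply: eq_eseriesr => i _.
by have := PF i; rewrite /w; case: (F i) => /= [ab Pab|_]; rewrite ?vol ?addr0// adde0.
Qed.

Lemma lebesgue_box_measurable (ab : 'rV[R]_N * 'rV[R]_N) :
  measurable (box ab : set (caratheodory_type (@lebesgue_outer R n))).
Proof.
pose H k c : set (caratheodory_type (@lebesgue_outer R n)) := [set z | (realify z ord0 k <= c)%R].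
have mH k c : measurable (H k c) by exact: lebesgue_halfspace_measurable.
rewrite (_ : box ab = \bigcap_(k in [set: 'I_N]) (~` H k (ab.1 ord0 k) `&` H k (ab.2 ord0 k))).
  by apply: fin_bigcap_measurable => // k _; apply: measurableI => //; exact: measurableC.
apply/seteqP; split => [z bz k _|z bz k].
  by have /andP[h1 h2] := bz k; split => //; apply/negP; rewrite -ltNge.
by have [/negP] := bz k Logic.I; rewrite -ltNge => -> ->.
Qed.

Lemma lebesgue_box_le (ab : 'rV[R]_N * 'rV[R]_N) :
  (forall k, ab.1 ord0 k <= ab.2 ord0 k)%R ->
  @lebesgue_measureC R n (box ab) <= box_volume ab.
Proof.
move=> Pab; apply: ereal_inf_lbound; exists (fun i : nat => if (i == 0)%N then Some ab else None).
  by split=> [[|]//|z bz]; exists 0%N.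
rewrite (nneseries_split _ 1)//; last by case=> [|k] _ //=; exact: box_volume_ge0.
rewrite add0n big_nat1 /= eseries0 ?adde0// => -[]//.
Qed.

End HalfSpaces.

(** * The Bochner-Martinelli representation *)

Section BochnerMartinelliKernel.
Variables (R : realType) (n : nat).
Local Notation N := (n + n)%N.
Variables (u v : 'rV[R]_N -> R).
Implicit Types (x y : 'rV[R]_N).

Lemma has_gradZ (a : R) (g : 'rV[R]_N -> R) y (w : 'rV[R]_N) :
  has_grad g y w -> has_grad (fun x => a * g x) y (a *: w).
Proof.
move=> gw; have := has_gradM (has_grad_cst a y) gw.
by rewrite scaler0 add0r.
Qed.

(** [al + i be] is the vector of complex partial derivatives of u + i v; coordinates are ordered as
    in [realify], real parts first. *)
Definition cauchy_riemann_at y := exists al be : 'rV[R]_n,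
  has_grad u y (row_mx al (- be)) /\ has_grad v y (row_mx be al).

Variables (z : 'rV[R]_N) (eps : R).
Hypotheses (n0 : (0 < n)%N) (eps0 : 0 < eps).

Definition bm_q x : R := \sum_k (x - z) ord0 k ^+ 2 + eps ^+ 2.

(* The real field (Re (f K_j), - Im (f K_j)) for f = u + i v and the regularised
   Bochner-Martinelli kernel K_j = conj (w_j - z_j) / (|w - z|^2 + eps^2)^n. *)
Definition bm_field (k : 'I_N) x : R := (bm_q x)^-1 ^+ n *
  match fintype.split k with
  | inl j => u x * (x ord0 (lshift n j) - z ord0 (lshift n j)) +
             v x * (x ord0 (rshift n j) - z ord0 (rshift n j))
  | inr j => u x * (x ord0 (rshift n j) - z ord0 (rshift n j)) +
             (-1 * v x) * (x ord0 (lshift n j) - z ord0 (lshift n j))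
  end.

(** The divergence of [bm_field]. Its factor eps^2 / (|x - z|^2 + eps^2)^(n + 1) concentrates at [z]
    and, by scaling in dimension 2 n, has a mass independent of [eps]. *)
Definition bm_div x : R := 2 * n%:R * eps ^+ 2 * (u x * (bm_q x)^-1 ^+ n.+1).

Lemma bm_q_gt0 x : 0 < bm_q x.
Proof.
by rewrite ltr_wpDl ?exprn_gt0// sumr_ge0// => k _; rewrite sqr_ge0.
Qed.

Lemma bm_q_norm_ge x : `|x - z| ^+ 2 <= bm_q x.
Proof.
have [->|xz0] := eqVneq (x - z) 0; first by rewrite normr0 expr0n /= ltW// bm_q_gt0.
have xz1 : mx_norm (x - z) != 0 by rewrite -[mx_norm _]/(`|x - z|) normr_eq0.
have [[a k] ak] := mx_norm_neq0 xz1; rewrite [`|_|]ak /= (ord1 a).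
rewrite /bm_q (bigD1 k)//= -addrA real_normK ?num_real// lerDl addr_ge0 ?sqr_ge0//.
by apply: sumr_ge0 => j _; rewrite sqr_ge0.
Qed.

Lemma bm_q_norm_le x r : `|x - z| <= r -> bm_q x <= N%:R * r ^+ 2 + eps ^+ 2.
Proof.
move=> xr; have r0 : 0 <= r by apply: le_trans xr.
rewrite lerD2r; apply: (@le_trans _ _ (\sum_(k < N) r ^+ 2)).
  apply: ler_sum => k _; rewrite -real_normK ?num_real// lerXn2r ?nnegrE//.
  exact: le_trans (rV_coord_le_norm _ _) xr.
by rewrite sumr_const card_ord mulr_natl.
Qed.

(** One factor |x - z| in the numerator against the n-th power of [bm_q] >= |x - z|^2; the bound is
    uniform in [eps]. *)
Lemma bm_field_le k x F : `|u x| <= F -> `|v x| <= F -> 0 < `|x - z| ->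
  `|bm_field k x| <= 2 * F * `|x - z| ^- N.-1.
Proof.
move=> uF vF xz0; have F0 : 0 <= F by apply: le_trans uF.
have kapE : `|(bm_q x)^-1 ^+ n| <= `|x - z| ^- N.
  have -> : `|x - z| ^- N = (`|x - z| ^+ 2)^-1 ^+ n by rewrite exprVn -exprM mul2n -addnn.
  rewrite normrX normfV gtr0_norm ?bm_q_gt0//.
  rewrite lerXn2r ?nnegrE ?invr_ge0 ?exprn_ge0 ?(ltW (bm_q_gt0 x))//.
  by rewrite lef_pV2 ?posrE ?bm_q_gt0 ?exprn_gt0// bm_q_norm_ge.
have xN : `|x - z| ^+ N = `|x - z| * `|x - z| ^+ N.-1 by rewrite -exprS prednK ?addn_gt0 ?n0.
have coord k' : `|x ord0 k' - z ord0 k'| <= `|x - z|.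
  by have := rV_coord_le_norm (x - z) k'; rewrite !mxE.
have two a b k1 k2 : `|a| <= F -> `|b| <= F ->
    `|a * (x ord0 k1 - z ord0 k1) + b * (x ord0 k2 - z ord0 k2)| <= 2 * F * `|x - z|.
  move=> aF bF; apply: le_trans (ler_normD _ _) _; rewrite !normrM.
  have -> : 2 * F * `|x - z| = F * `|x - z| + F * `|x - z| by ring.
  by apply: lerD; apply: ler_pM.
rewrite /bm_field normrM; set X := match _ with inl _ => _ | inr _ => _ end.
have XF : `|X| <= 2 * F * `|x - z|.
  rewrite /X; case: fintype.split => j; apply: two => //.
  by rewrite mulN1r normrN.
apply: le_trans (ler_pM _ _ kapE XF) _ => //.
rewrite xN le_eqVlt; apply/orP; left; apply/eqP; field.
by rewrite !gt_eqF// exprn_gt0.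
Qed.

(** By the Cauchy-Riemann equations the derivatives of [u] and [v] cancel and leave 2 n u q^(-n),
    with q = [bm_q]; differentiating q^(-n) adds - 2 n u q^(-n - 1) (q - eps^2). The sum is
    [bm_div]. *)
Lemma bm_div_at y : cauchy_riemann_at y -> div_at bm_field bm_div y.
Proof.
move=> [al [be [ug vg]]].
have [gu [{}ug [gul gur]]] : exists gu : 'rV[R]_N, has_grad u y gu /\
    ((forall j, gu ord0 (lshift n j) = al ord0 j) /\
     (forall j, gu ord0 (rshift n j) = - be ord0 j)).
  by exists (row_mx al (- be)); split=> //; split=> j; rewrite ?row_mxEl// row_mxEr mxE.
have [gv [{}vg [gvl gvr]]] : exists gv : 'rV[R]_N, has_grad v y gv /\
    ((forall j, gv ord0 (lshift n j) = be ord0 j) /\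
     (forall j, gv ord0 (rshift n j) = al ord0 j)).
  by exists (row_mx be al); split=> //; split=> j; rewrite ?row_mxEl// row_mxEr.
have qn0 : bm_q y != 0 by rewrite gt_eqF// bm_q_gt0.
have qg : has_grad bm_q y (2 *: (y - z)) by exact: has_grad_sqdist.
have pg := has_gradV qn0 qg; set p := fun x => (bm_q x)^-1 in pg.
have kg := has_gradX n pg.
split; last first.
  move=> eta eta0; apply/near_norm.
  have := has_gradZ (2 * n%:R * eps ^+ 2) (has_gradM ug (has_gradX n.+1 pg)).
  by move=> /has_grad_cont; exact.
pose K := n%:R * p y ^+ n.-1 * (- p y ^+ 2 * 2).
pose Xl j := y ord0 (lshift n j) - z ord0 (lshift n j).
pose Xr j := y ord0 (rshift n j) - z ord0 (rshift n j).
pose val (k : 'I_N) : R := match fintype.split k with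
  | inl j => (u y * Xl j + v y * Xr j) * (K * Xl j) +
     p y ^+ n * (Xl j * al ord0 j + u y + Xr j * be ord0 j)
  | inr j => (u y * Xr j - v y * Xl j) * (K * Xr j) +
     p y ^+ n * (- Xr j * be ord0 j + u y - Xl j * al ord0 j)
  end.
have /choice[A HA] : forall k, exists w : 'rV[R]_N,
    has_grad (bm_field k) y w /\ w ord0 k = val k.
  move=> k.
  rewrite /bm_field /val; have := splitK k; case: (fintype.split k) => j /= /esym kE.
  - have := has_gradM kg (has_gradD
      (has_gradM ug (@has_grad_coord R N (lshift n j) (z ord0 (lshift n j)) y))
      (has_gradM vg (@has_grad_coord R N (rshift n j) (z ord0 (rshift n j)) y))).
    set w := (X in has_grad _ _ X) => gw; exists w; split => //.
    rewrite /w kE !mxE gul gvl !eqxx eq_lrshift /= -/(Xl j) -/(Xr j).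
    by rewrite -[(bm_q y)^-1]/(p y) /K; ring.
  - have := has_gradM kg (has_gradD
      (has_gradM ug (@has_grad_coord R N (rshift n j) (z ord0 (rshift n j)) y))
      (has_gradM (has_gradZ (-1) vg) (@has_grad_coord R N (lshift n j) (z ord0 (lshift n j)) y))).
    set w := (X in has_grad _ _ X) => gw; exists w; split => //.
    rewrite /w kE !mxE gur gvr !eqxx eq_rlshift /= -/(Xl j) -/(Xr j).
    by rewrite -[(bm_q y)^-1]/(p y) /K; ring.
exists A => [k|]; first by case: (HA k).
rewrite (eq_bigr val) => [|k _]; last by case: (HA k).
rewrite big_split_ord /= -big_split /=.
rewrite (eq_bigr (fun j => u y * K * (Xl j ^+ 2 + Xr j ^+ 2) + 2 * p y ^+ n * u y)); last first.
  move=> j _; rewrite /val.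
  by rewrite (unsplitK (inl _ j)) (unsplitK (inr _ j)); ring.
rewrite big_split /= -mulr_sumr sumr_const card_ord -[_ *+ n]mulr_natl.
have -> : \sum_(j < n) (Xl j ^+ 2 + Xr j ^+ 2) = bm_q y - eps ^+ 2.
  rewrite /bm_q addrK big_split_ord /= -big_split /=.
  by apply: eq_bigr => j _; rewrite !mxE.
have pq : p y * bm_q y = 1 by rewrite /p mulVf.
rewrite /bm_div /K -/(p y).
have -> : p y ^+ n.+1 = p y ^+ n.-1 * p y ^+ 2 by rewrite -exprD addn2 prednK.
have -> : p y ^+ n = p y ^+ n.-1 * p y ^+ 2 * bm_q y.
  by rewrite expr2 !mulrA -mulrA pq mulr1 -exprSr prednK.
by ring.
Qed.

End BochnerMartinelliKernel.

(** * Cancellation of fluxes and the pointwise bound *)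

Section Representation.
Variables (R : realType) (n : nat).
Local Notation N := (n + n)%N.
Variables (D : set 'rV[R]_N) (u v : 'rV[R]_N -> R) (K : R).
Hypotheses (n0 : (0 < n)%N) (CR : forall y, D y -> cauchy_riemann_at u v y).
Hypotheses (K0 : 0 <= K) (uK : forall y, D y -> `|u y| <= K).
Implicit Types (i j b : 'rV[int]_N) (x y : 'rV[R]_N).

Definition unitz (k : 'I_N) : 'rV[int]_N := delta_mx ord0 k.

Lemma latptD (h : R) i j : latpt h (i + j) = latpt h i + latpt h j.
Proof. by apply/rowP => k; rewrite !mxE intrD mulrDr. Qed.

Lemma latpt_unitz (h : R) k : latpt h (unitz k) = h *: unitv R k.
Proof. by apply/rowP => j; rewrite !mxE; case: (_ && _). Qed.

(** A face between two cubes of [I] occurs once with each sign. *)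
Lemma sum_shift_diff (I : seq 'rV[int]_N) k (F : 'rV[int]_N -> R) : uniq I ->
  \sum_(i <- I) (F (i + unitz k) - F i) =
  \sum_(i <- I | i + unitz k \notin I) F (i + unitz k) -
  \sum_(i <- I | i - unitz k \notin I) F i.
Proof.
move=> uI; rewrite sumrB.
rewrite (bigID (fun i => i + unitz k \in I))/= [X in _ - X](bigID (fun i => i - unitz k \in I))/=.
suff -> : \sum_(i <- I | i + unitz k \in I) F (i + unitz k) =
    \sum_(i <- I | i - unitz k \in I) F i by ring.
rewrite -big_filter -[RHS]big_filter -(big_map (fun i => i + unitz k) predT F).
apply: perm_big; apply: uniq_perm; rewrite ?filter_uniq//.
  by rewrite map_inj_uniq ?filter_uniq//; exact: addIr.
move=> i; rewrite mem_filter; apply/mapP/andP => [[j + ->]|[ik iI]].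
  by rewrite mem_filter addrK => /andP[].
by exists (i - unitz k); rewrite ?subrK// mem_filter subrK iI.
Qed.

Lemma inbox_cube (h : R) i y : inbox (latpt h i) h y <-> cube h i y.
Proof.
by split => yi k; have := yi k; rewrite !mxE intrD mulrDr mulr1.
Qed.

Section Grid.
Variables (h : R) (I S : seq 'rV[int]_N) (iz : 'rV[int]_N) (F : 'rV[int]_N -> R).
Hypotheses (h0 : 0 < h) (uI : uniq I) (ID : forall i, i \in I -> cube h i `<=` D).
Hypotheses (izI : iz \in I) (uS : uniq S) (F0 : forall b, 0 <= F b).
Hypothesis bdry : forall i k, i \in I ->
  (i + unitz k \notin I -> i + unitz k \in S) /\
  (i - unitz k \notin I -> i - unitz k \in S).
Hypothesis Sfar : forall b, b \in S -> (2 <= latdist b iz)%N.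
Hypothesis FS : forall b x, b \in S -> cube h b x -> D x -> `|u x| <= F b /\ `|v x| <= F b.
Let z := latpt h iz.

Let bound b : R := 2 ^+ N * F b * (latdist b iz)%:R ^- N.-1.

Let bound_ge0 b : 0 <= bound b.
Proof. by rewrite !mulr_ge0 ?exprn_ge0 ?invr_ge0 ?exprn_ge0. Qed.

Section Eps.
Variable eps : R.
Hypothesis eps0 : 0 < eps.
Local Notation W := (bm_field u v z eps).
Local Notation rho := (bm_div u z eps).
(** Index distance d >= 2 gives |x - z| >= h d - h >= h d / 2; the N - 1 halves and the factor 2 of
    [bm_field_le] make up the 2^N of [bound]. *)
Lemma bm_field_bdry k b x : b \in S -> cube h b x -> D x ->
  h ^+ N.-1 * `|W k x| <= bound b.
Proof.
move=> bS bx Dx; have [uF vF] := FS bS bx Dx.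
have d2 := Sfar bS; set d := latdist b iz in d2 *.
have dR : 2 <= d%:R :> R by rewrite ler_nat.
have far : h * d%:R / 2 <= `|x - z|.
  have := cube_latdist_ge h0 bx (latpt_cube iz (ltW h0)); rewrite -/d -/z.
  by have := ler_wpM2l (ltW h0) dR; lra.
have hd0 : 0 < h * d%:R / 2 by rewrite divr_gt0// mulr_gt0//; lra.
have xz0 : 0 < `|x - z| by exact: lt_le_trans far.
have := bm_field_le (z := z) n0 eps0 k uF vF xz0.
move=> /(ler_wpM2l (exprn_ge0 N.-1 (ltW h0))) /le_trans; apply.
apply: (@le_trans _ _ (h ^+ N.-1 * (2 * F b * (h * d%:R / 2) ^- N.-1))).
  rewrite !ler_wpM2l ?mulr_ge0 ?exprn_ge0 ?(ltW h0)//.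
  by rewrite lef_pV2 ?posrE ?exprn_gt0// lerXn2r// ?nnegrE// ltW.
have p2 : 2 ^+ N = 2 * 2 ^+ N.-1 :> R by rewrite -exprS prednK ?addn_gt0 ?n0.
rewrite /bound -/d p2 !exprMn exprVn le_eqVlt; apply/orP; left; apply/eqP; field.
by rewrite !expf_neq0 ?gt_eqF ?(lt_le_trans _ dR).
Qed.

(** An exposed face lies in the inner cube, hence in [D], and in its neighbour of [S], where [F]
    controls the field. In a fixed direction a cube of [S] is reached at most once from either side,
    whence the factor 2. *)
Lemma fluxes_bound k (M : nat) : (0 < M)%N ->
  `|\sum_(i <- I) ((h / M%:R) ^+ N.-1 * \sum_(f : {ffun 'I_N -> 'I_M} | (f k == 0 :> nat)%N)
     (W k (latpt h i + finept (h / M%:R) f + h *: unitv R k) -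
      W k (latpt h i + finept (h / M%:R) f)))| <= 2 * \sum_(b <- S) bound b.
Proof.
move=> M0; set t := h / M%:R; have MR : 0 < M%:R :> R by rewrite ltr0n.
have t0 : 0 < t by rewrite divr_gt0.
have tM : t * M%:R = h by rewrite divfK ?gt_eqF.
pose Phi i := t ^+ N.-1 * \sum_(f : {ffun 'I_N -> 'I_M} | (f k == 0 :> nat)%N)
  W k (latpt h i + finept t f).
rewrite (eq_bigr (fun i => Phi (i + unitz k) - Phi i)); last first.
  move=> i _; rewrite /Phi -mulrBr -sumrB; congr (_ * _); apply: eq_bigr => f _.
  by rewrite latptD latpt_unitz; congr (W k _ - _); apply/rowP => j; rewrite !mxE; ring.
have PhiB i b : b \in S ->
   (forall f : {ffun 'I_N -> 'I_M}, (f k == 0 :> nat)%N -> cube h b (latpt h i + finept t f) /\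
      D (latpt h i + finept t f)) -> `|Phi i| <= bound b.
  move=> bS fD; rewrite /Phi normrM ger0_norm ?exprn_ge0 ?(ltW t0)//.
  have -> : bound b = t ^+ N.-1 * \sum_(f : {ffun 'I_N -> 'I_M} | (f k == 0 :> nat)%N)
      (h ^- N.-1 * bound b).
    have hN : h ^+ N.-1 = t ^+ N.-1 * M%:R ^+ N.-1 by rewrite -exprMn tM.
    rewrite -[h ^- _ * _]mulr1 -mulr_sumr card_zero_coord//.
    rewrite mulrCA -hN mulrAC mulVf ?mul1r// expf_neq0// gt_eqF//.
  rewrite ler_wpM2l ?exprn_ge0 ?(ltW t0)//.
  apply: le_trans (ler_norm_sum _ _ _) _; apply: ler_sum => f fk.
  have [bf Df] := fD f fk; rewrite ler_pdivlMl ?exprn_gt0//.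
  exact: bm_field_bdry.
have inI i (f : {ffun 'I_N -> 'I_M}) : i \in I -> cube h i (latpt h i + finept t f) /\ D (latpt h i + finept t f).
  move=> iI; have ic : cube h i (latpt h i + finept t f).
    by apply/inbox_cube/inbox_finept; rewrite // ltW.
  by split=> //; exact: (ID iI).
have inI' i (f : {ffun 'I_N -> 'I_M}) : i \in I -> (f k == 0 :> nat)%N ->
    cube h i (latpt h (i + unitz k) + finept t f) /\ D (latpt h (i + unitz k) + finept t f).
  move=> iI fk; have ic : cube h i (latpt h (i + unitz k) + finept t f).
    rewrite latptD latpt_unitz addrAC.
    by apply/inbox_cube/inbox_finept_unitv; rewrite // ltW.
  by split=> //; exact: (ID iI).
rewrite sum_shift_diff//.
apply: le_trans (ler_normB _ _) _; rewrite mulr_natl mulr2n.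
have inj_le (g : 'rV[int]_N -> 'rV[int]_N) (P : pred 'rV[int]_N) : injective g ->
    (forall i, i \in I -> P i -> g i \in S) ->
    \sum_(i <- I | P i) bound (g i) <= \sum_(b <- S) bound b.
  move=> ginj gS; rewrite -big_filter -(big_map g predT bound).
  have ug : uniq [seq g i | i <- I & P i] by rewrite map_inj_uniq ?filter_uniq.
  have sub : {subset [seq g i | i <- I & P i] <= S}.
    by move=> _ /mapP[i + ->]; rewrite mem_filter => /andP[Pi iI]; exact: gS.
  rewrite [leRHS](bigID (mem [seq g i | i <- I & P i])) /= -[leLHS]addr0 lerD ?sumr_ge0//.
  rewrite -[leRHS]big_filter le_eqVlt; apply/orP; left; apply/eqP.
  apply: perm_big; apply: uniq_perm => //; first by rewrite filter_uniq.
  by move=> b; rewrite mem_filter; apply/idP/andP => [bg|[]//]; split => //; exact: sub.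
apply: lerD.
- apply: le_trans (ler_norm_sum _ _ _) _.
  apply: (@le_trans _ _ (\sum_(i <- I | i + unitz k \notin I) bound (i + unitz k))); last first.
    apply: inj_le => [|i iI]; first exact: addIr.
    by have [h1 _] := bdry k iI.
  rewrite big_seq_cond [leRHS]big_seq_cond; apply: ler_sum => i /andP[iI iN].
  have [h1 _] := bdry k iI; apply: PhiB (h1 iN) _ => f fk.
  have [ic Df] := inI' i f iI fk; split=> //.
  by apply/inbox_cube/inbox_finept; rewrite // ltW.
- apply: le_trans (ler_norm_sum _ _ _) _.
  apply: (@le_trans _ _ (\sum_(i <- I | i - unitz k \notin I) bound (i - unitz k))); last first.
    apply: inj_le => [|i iI]; first by move=> ? ? /addIr.
    by have [_ h1] := bdry k iI.
  rewrite big_seq_cond [leRHS]big_seq_cond; apply: ler_sum => i /andP[iI iN].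
  have [_ h1] := bdry k iI; apply: PhiB (h1 iN) _ => f fk.
  have [_ Df] := inI i f iI; split=> //.
  rewrite -{2}(subrK (unitz k) i) latptD latpt_unitz addrAC.
  by apply/inbox_cube/inbox_finept_unitv; rewrite // ltW.
Qed.

(* Fluxes through a face shared by two cubes of I cancel; the remaining faces lie
   on cubes of S. *)
Lemma bm_div_sum_le eta : 0 < eta -> exists m0, forall m, (m0 <= m)%N ->
  (h / (2 ^ m)%:R) ^+ N * \sum_(i <- I) \sum_(f : {ffun 'I_N -> 'I_(2 ^ m)})
     rho (latpt h i + finept (h / (2 ^ m)%:R) f) <=
  N%:R * (2 * \sum_(b <- S) bound b) + (size I)%:R * (eta * h ^+ N).
Proof.
move=> eta0; have N0 : (0 < N)%N by rewrite addn_gt0 n0.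
have /choice[mi Hmi] : forall i, exists m0, i \in I -> forall m, (m0 <= m)%N ->
    `|divsum W rho (latpt h i) (h / (2 ^ m)%:R) (2 ^ m)| <= eta * h ^+ N.
  move=> i; have [iI|//] := boolP (i \in I); last by exists 0%N.
  have [y /inbox_cube iy|m0 Hm0] := @divsum_small R N W rho (latpt h i) h N0 h0 _ eta eta0.
    by apply: bm_div_at => //; apply: CR; exact: (ID iI).
  by exists m0.
exists (\max_(i <- I) mi i) => m mm.
have M0 : (0 < 2 ^ m)%N by rewrite expn_gt0.
set t := h / (2 ^ m)%:R.
have MR : 0 < (2 ^ m)%:R :> R by rewrite ltr0n.
have t0 : 0 < t by rewrite divr_gt0.
have tM : t * (2 ^ m)%:R = h by rewrite divfK ?gt_eqF.
have dsum : `|\sum_(i <- I) divsum W rho (latpt h i) t (2 ^ m)| <= (size I)%:R * (eta * h ^+ N).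
  apply: le_trans (ler_norm_sum _ _ _) _.
  apply: (@le_trans _ _ (\sum_(i <- I) eta * h ^+ N)).
    rewrite big_seq [leRHS]big_seq; apply: ler_sum => i iI; apply: Hmi => //.
    by apply: leq_trans mm; apply: leq_bigmax_seq.
  by rewrite big_const_seq count_predT iter_addr_0 mulr_natl.
have fl : `|\sum_(i <- I) \sum_k (t ^+ N.-1 * \sum_(f : {ffun 'I_N -> 'I_(2 ^ m)} | (f k == 0 :> nat)%N)
     (W k (latpt h i + finept t f + h *: unitv R k) - W k (latpt h i + finept t f)))| <=
   N%:R * (2 * \sum_(b <- S) bound b).
  rewrite exchange_big /=; apply: le_trans (ler_norm_sum _ _ _) _.
  apply: (@le_trans _ _ (\sum_(k < N) (2 * \sum_(b <- S) bound b))).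
    by apply: ler_sum => k _; exact: fluxes_bound.
  by rewrite sumr_const card_ord [leRHS]mulr_natl.
have E : t ^+ N * \sum_(i <- I) \sum_(f : {ffun 'I_N -> 'I_(2 ^ m)}) rho (latpt h i + finept t f) =
   \sum_(i <- I) \sum_k (t ^+ N.-1 * \sum_(f : {ffun 'I_N -> 'I_(2 ^ m)} | (f k == 0 :> nat)%N)
     (W k (latpt h i + finept t f + h *: unitv R k) - W k (latpt h i + finept t f))) -
   \sum_(i <- I) divsum W rho (latpt h i) t (2 ^ m).
  rewrite -sumrB mulr_sumr; apply: eq_bigr => i _.
  rewrite /divsum sumrB exchange_big /=.
  under [X in _ = _ - _ * (X - _)]eq_bigr => k _ do rewrite sum_telescope// tM.
  have tN : t ^+ N = t ^+ N.-1 * t by rewrite -exprSr prednK.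
  rewrite -[X in _ = X - _]mulr_sumr -[X in _ = _ - _ * (_ - X)]mulr_sumr tN.
  have aux (a b A B : R) : a * b * A = a * B - a * (B - b * A) by ring.
  exact: aux.
rewrite E; apply: le_trans (lerD fl dsum).
apply: lerD; first exact: ler_norm.
by rewrite -normrN; exact: ler_norm.
Qed.
End Eps.

Lemma exists_small_dyadic (d : R) : 0 < d -> exists l, h / 2 ^+ l < d.
Proof.
move=> d0; exists (Num.bound (h / d)).
by rewrite ltr_pdivrMr ?exprn_gt0// mulrC -ltr_pdivrMr// upper_nthrootP.
Qed.

(** With the grid fixed, [eps] tends to 0 in [bm_div_sum_le]. The small cube of side eps with corner
    z alone yields the left side; other points near z contribute nonnegatively, as u stays close to
    u z > 0, and points beyond distance [d0] contribute no less than - O(eps^2). *)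
Lemma cauchy_estimate_re :
  n%:R * (N%:R + 1) ^- n.+1 * u z <= N%:R * (2 * \sum_(b <- S) bound b).
Proof.
have N1 : 0 < N%:R + 1 :> R by rewrite ltr_wpDl.
have RHS0 : 0 <= N%:R * (2 * \sum_(b <- S) bound b) by rewrite !mulr_ge0 ?sumr_ge0.
have [uz0|uz0] := leP (u z) 0.
  by apply: le_trans RHS0; rewrite mulr_ge0_le0// mulr_ge0// invr_ge0 exprn_ge0// ltW.
have Dz : D z by apply: (ID izI); exact: latpt_cube (ltW h0).
have [al [be [ug _]]] := CR Dz.
have uz2 : 0 < u z / 2 by rewrite divr_gt0.
have /near_norm[d0 d00 ud0] := has_grad_cont ug uz2.
(* Bounds the divergence, divided by eps^2, at distance at least [d0] from z. *)
pose far := 2 * n%:R * K * (d0 ^+ 2)^-1 ^+ n.+1.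
have far0 : 0 <= far by rewrite !mulr_ge0 ?exprn_ge0 ?invr_ge0 ?exprn_ge0// ltW.
pose s := (size I)%:R * h ^+ N.
have s0 : 0 <= s by rewrite mulr_ge0 ?exprn_ge0 ?(ltW h0).
apply/ler_addgt0Pr => e e0.
pose eta := e / 2 / (s + 1).
have eta0 : 0 < eta by rewrite !divr_gt0// ltr_wpDl.
have seta : s * eta <= e / 2.
  rewrite mulrC mulrAC ler_pdivrMr ?ltr_wpDl// ler_wpM2l ?divr_ge0 ?(ltW e0)//.
  by rewrite lerDl.
have sf0 : 0 < s * far + 1 by rewrite ltr_wpDl// mulr_ge0.
(* A dyadic fraction of h, so that the cube of side [eps] at z is made of cells of the fine grid and
   its points are counted exactly. *)
have [l ldl] := @exists_small_dyadic (Num.min (Num.min d0 1) (e / 2 / (s * far + 1)))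
  ltac:(by rewrite !lt_min d00 ltr01 !divr_gt0).
set eps := h / 2 ^+ l in ldl.
have eps0 : 0 < eps by rewrite divr_gt0// exprn_gt0.
move: ldl; rewrite !lt_min => /andP[/andP[epsd0 eps1] epse].
have eps2 : eps ^+ 2 <= eps by rewrite expr2 ler_piMl ?(ltW eps0)// ltW.
have sfar : s * (far * eps ^+ 2) <= e / 2.
  rewrite mulrA; apply: (@le_trans _ _ ((s * far + 1) * eps)).
    by apply: ler_pM eps2; rewrite ?sqr_ge0 ?lerDl// mulr_ge0.
  by rewrite mulrC -ler_pdivlMr// ltW.
have [m0 Hm0] := bm_div_sum_le eps0 eta0.
pose m := maxn m0 l; have lm : (l <= m)%N by rewrite leq_maxr.
have := Hm0 m (leq_maxl _ _); set t := h / (2 ^ m)%:R.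
rewrite [(size I)%:R * _]mulrCA -/s [eta * s]mulrC => upper.
have MR : 0 < (2 ^ m)%:R :> R by rewrite ltr0n expn_gt0.
have t0 : 0 < t by rewrite divr_gt0.
have tM : t * (2 ^ m)%:R = h by rewrite divfK ?gt_eqF.
pose M' := (2 ^ (m - l))%N.
have tM' : t * M'%:R = eps.
  rewrite /t /eps /M' -{1}(subnK lm) expnD natrM !natrX; field.
  by rewrite !expf_neq0.
pose small (f : {ffun 'I_N -> 'I_(2 ^ m)}) := [forall k, (f k < M')%N].
(* Lower bound for the divergence at the points counted: there [bm_q] <= (N + 1) eps^2 and u >= u z
   / 2. Multiplied by eps^N it no longer depends on [eps]. *)
pose rmin := 2 * n%:R * eps ^+ 2 * (u z / 2 * ((N%:R + 1) * eps ^+ 2)^-1 ^+ n.+1).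
have q10 : 0 <= (N%:R + 1) * eps ^+ 2 by rewrite mulr_ge0 ?sqr_ge0 ?(ltW N1).
have n2e : 0 <= 2 * n%:R * eps ^+ 2 by rewrite mulr_ge0 ?sqr_ge0// mulr_ge0.
have rmin0 : 0 <= rmin.
  by apply: mulr_ge0 => //; apply: mulr_ge0; [exact: ltW|rewrite exprn_ge0// invr_ge0].
have lower i (f : {ffun 'I_N -> 'I_(2 ^ m)}) : i \in I ->
    (if (i == iz) && small f then rmin else 0) - far * eps ^+ 2 <=
    bm_div u z eps (latpt h i + finept t f).
  move=> iI; set x := latpt h i + _.
  have Dx : D x.
    by apply: (ID iI); apply/inbox_cube/inbox_finept; rewrite ?expn_gt0// ltW.
  have q0 := bm_q_gt0 z eps0 x.
  have f0 : 0 <= far * eps ^+ 2 by rewrite mulr_ge0 ?sqr_ge0.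
  have [xd0|xd0] := ltP `|x - z| d0.
    have ux : u z / 2 <= u x by have := ud0 x xd0; rewrite ler_norml; lra.
    case: ifPn => [/andP[/eqP iE /forallP sm]|_]; last first.
      apply: (@le_trans _ _ 0); first by rewrite sub0r oppr_le0.
      apply: (mulr_ge0 n2e); apply: mulr_ge0; first exact: le_trans (ltW uz2) ux.
      by rewrite exprn_ge0// invr_ge0 ltW.
    have xz : `|x - z| <= eps.
      apply/rV_norm_leP => [|k]; first exact: ltW.
      have tf0 : 0 <= t * (f k)%:R by rewrite mulr_ge0// ltW.
      rewrite /x iE /z !mxE addrAC subrr add0r (ger0_norm tf0).
      by rewrite -tM' ler_pM2l// ler_nat ltnW.
    apply: (@le_trans _ _ rmin); first by rewrite gerBl.
    rewrite /rmin /bm_div; apply: (ler_wpM2l n2e).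
    apply: ler_pM => //; first exact: ltW.
      by rewrite exprn_ge0// invr_ge0.
    rewrite lerXn2r ?nnegrE ?invr_ge0 ?q10 ?(ltW q0)//.
    rewrite lef_pV2 ?posrE ?mulr_gt0 ?exprn_gt0//.
    by have := bm_q_norm_le eps xz; rewrite mulrDl mul1r.
  have -> : (if (i == iz) && small f then rmin else 0) = 0.
    case: ifP => // /andP[/eqP iE /forallP sm]; exfalso.
    have : `|x - z| <= eps.
      apply/rV_norm_leP => [|k]; first exact: ltW.
      have tf0 : 0 <= t * (f k)%:R by rewrite mulr_ge0// ltW.
      rewrite /x iE /z !mxE addrAC subrr add0r (ger0_norm tf0).
      by rewrite -tM' ler_pM2l// ler_nat ltnW.
    by move=> /(le_trans xd0); rewrite leNgt epsd0.
  rewrite sub0r lerNl; apply: le_trans (ler_norm _) _; rewrite normrN.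
  rewrite /bm_div normrM (ger0_norm n2e).
  have -> : far * eps ^+ 2 = 2 * n%:R * eps ^+ 2 * (K * (d0 ^+ 2)^-1 ^+ n.+1) by rewrite /far; ring.
  apply: (ler_wpM2l n2e); rewrite normrM.
  apply: ler_pM => //; first exact: uK.
  rewrite normrX gtr0_norm ?invr_gt0// lerXn2r ?nnegrE ?invr_ge0 ?sqr_ge0 ?(ltW q0)//.
  rewrite lef_pV2 ?posrE ?exprn_gt0//; apply: le_trans (bm_q_norm_ge _ eps0 _).
  by rewrite lerXn2r ?nnegrE// ltW.
have card_small : \sum_(f : {ffun 'I_N -> 'I_(2 ^ m)}) (if small f then rmin else 0) =
    M'%:R ^+ N * rmin.
  rewrite -big_mkcond /= sumr_const -[LHS]mulr_natl -natrX; congr (_%:R * _).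
  have -> : #|small| = #|ffun_on (fun a : 'I_(2 ^ m) => (a < M')%N) : pred {ffun 'I_N -> 'I_(2 ^ m)}|.
    apply: eq_card => f; rewrite !inE; apply/forallP/ffun_onP => H k; exact: H.
  rewrite card_ffun_on card_ord; congr (_ ^ _)%N.
  have MM : (M' <= 2 ^ m)%N by rewrite leq_exp2l// leq_subr.
  have winj : injective (widen_ord MM) by move=> a b /(congr1 val) /= /val_inj.
  rewrite -[RHS]card_ord -(card_imset _ winj).
  apply: eq_card => a; rewrite -[LHS]/(a < M')%N; apply/idP/imsetP => [aM|[b _ ->]]; last exact: (ltn_ord b).
  by exists (Ordinal aM) => //; exact: val_inj.
have lower_sum : eps ^+ N * rmin - s * (far * eps ^+ 2) <=
    t ^+ N * \sum_(i <- I) \sum_(f : {ffun 'I_N -> 'I_(2 ^ m)})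
       bm_div u z eps (latpt h i + finept t f).
  apply: (@le_trans _ _ (t ^+ N * \sum_(i <- I) \sum_(f : {ffun 'I_N -> 'I_(2 ^ m)})
      ((if (i == iz) && small f then rmin else 0) - far * eps ^+ 2))); last first.
    rewrite ler_wpM2l ?exprn_ge0 ?(ltW t0)// big_seq [leRHS]big_seq.
    by apply: ler_sum => i iI; apply: ler_sum => f _; exact: lower.
  under eq_bigr do rewrite sumrB.
  rewrite sumrB (bigD1_seq iz)//= eqxx /= card_small big1 ?addr0; last first.
    by move=> i /negbTE ->; rewrite big1.
  rewrite sumr_const card_ffun !card_ord big_const_seq count_predT iter_addr_0.
  have tN : t ^+ N * M'%:R ^+ N = eps ^+ N by rewrite -exprMn tM'.
  have sE : s = (size I)%:R * (t ^+ N * (2 ^ m)%:R ^+ N) by rewrite -exprMn tM.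
  have nat2 (X : R) (a b : nat) : X *+ a *+ b = b%:R * (a%:R * X) by rewrite !mulr_natl.
  by rewrite nat2 (natrX R _ N) sE -tN le_eqVlt; apply/orP; left; apply/eqP; ring.
have epsrmin : eps ^+ N * rmin = n%:R * (N%:R + 1) ^- n.+1 * u z.
  have -> : eps ^+ N = (eps ^+ 2) ^+ n by rewrite -exprM mul2n addnn.
  have aux (E M a U : R) : 0 < E -> 0 < M ->
      E ^+ n * (2 * a * E * (U / 2 * (M * E)^-1 ^+ n.+1)) = a * M ^- n.+1 * U.
    move=> E0 M0; rewrite exprVn exprMn [E ^+ n.+1]exprS.
    by field; rewrite !expf_neq0 ?gt_eqF.
  by apply: aux => //; rewrite exprn_gt0.
have := le_trans lower_sum upper; rewrite epsrmin; lra.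
Qed.

End Grid.
End Representation.

(** * Covers of Lipschitz graphs *)

Section Ahlfors.
Variables (R : realType) (n : nat).
Local Notation N := (n + n)%N.

Lemma norm_le_euclid (m : nat) (x : 'rV[R]_m) : `|x| <= euclid_norm x.
Proof.
apply/rV_norm_leP => [|k]; first exact: sqrtr_ge0.
rewrite /euclid_norm -sqrtr_sqr ler_wsqrtr// (bigD1 k)//= lerDl sumr_ge0// => j _.
exact: sqr_ge0.
Qed.

Lemma norm_le_diameter (B : set 'rV[R[i]]_n) (d : R) (z w : 'rV[R[i]]_n) :
  (diameter B <= d%:E)%E -> B z -> B w -> `|realify z - realify w| <= d.
Proof.
move=> Bd Bz Bw; rewrite -lee_fin; apply: le_trans Bd.
apply: (@le_trans _ _ (euclid_norm (realify z - realify w))%:E).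
  by rewrite lee_fin norm_le_euclid.
by apply: ereal_sup_ubound; exists (z, w).
Qed.

Lemma exprD_le (m : nat) (a b : R) : 0 <= a -> 0 <= b ->
  (a + b) ^+ m <= 2 ^+ m * (a ^+ m + b ^+ m).
Proof.
move=> a0 b0; wlog ab : a b a0 b0 / a <= b.
  move=> H; have [/H|/ltW /H] := leP a b; first exact.
  by rewrite addrC [b ^+ m + _]addrC; exact.
apply: (@le_trans _ _ ((2 * b) ^+ m)).
  by rewrite lerXn2r ?nnegrE ?addr_ge0 ?mulr_ge0//; lra.
by rewrite exprMn ler_wpM2l ?exprn_ge0// lerDr exprn_ge0.
Qed.

Lemma sum_half_le (m : nat) : \sum_(k < m) (2 ^+ k)^-1 <= 2 :> R.
Proof.
suff -> : \sum_(k < m) (2 ^+ k)^-1 = 2 - 2 * (2 ^+ m)^-1 :> R.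
  by rewrite gerBl mulr_ge0// invr_ge0 exprn_ge0.
elim: m => [|m IH]; first by rewrite big_ord0 expr0; field.
by rewrite big_ord_recr /= IH exprS; field; rewrite expf_neq0.
Qed.

(* The graph {G = 0} projects along e onto a whole ball, so a cover of the graph by
   small sets thickens along e to a cover of a ball. *)
Lemma graph_cover_sum (G : 'rV[R]_N -> R) (e : 'rV[R]_N) (La : R) :
  (0 < n)%N -> 0 <= La ->
  (forall x y, `|G x - G y| <= La * `|x - y|) ->
  (forall x t, G (x + t *: e) = G x + t) ->
  exists2 C : R, 0 < C & forall (c : 'rV[R]_N) (r S : R) (F : nat -> option ('rV[R]_N * R)),
    0 < r -> G c = 0 ->
    (forall k, oapp (fun b => 0 <= b.2 <= r) true (F k)) ->
    (forall x, G x = 0 -> `|x - c| <= r ->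
       exists k, oapp (fun b => `|x - b.1| <= b.2) false (F k)) ->
    (forall m, \sum_(k < m) oapp (fun b => b.2 ^+ N.-1) 0 (F k) <= S) ->
    r ^+ N.-1 <= C * S.
Proof.
move=> n0 La0 GL Ge.
have N0 : (0 < N)%N by rewrite addn_gt0 n0.
have N1 : (0 < N.-1)%N by rewrite -ltnS prednK//; lia.
pose E := `|e|; have E0 : 0 <= E by exact: normr_ge0.
(* A point within th r of c reaches the graph along [e] with a parameter at most La th r, and so
   stays within r of c. The summand La keeps the parameter itself below r. *)
pose th := (1 + La + La * E)^-1.
have den : 1 <= 1 + La + La * E by rewrite -addrA lerDl addr_ge0// mulr_ge0.
have th0 : 0 < th by rewrite invr_gt0; lra.
have th1 : th * (1 + La + La * E) = 1 by rewrite mulVf// gt_eqF//; lra.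
pose C1 := 7 ^+ N * (2 * (E + 2) * 2 ^+ N * 2 ^+ N.-1).
have C10 : 0 < C1 by rewrite !mulr_gt0 ?exprn_gt0//; lra.
exists (C1 / th ^+ N); first by rewrite divr_gt0// exprn_gt0.
move=> c r S F r0 Gc Fr Fcov FS.
suff main : (th * r) ^+ N <= C1 * r * S.
  rewrite mulrAC ler_pdivlMr ?exprn_gt0// mulrC -(ler_pM2l r0).
  have -> : r * (th ^+ N * r ^+ N.-1) = (th * r) ^+ N.
    by rewrite exprMn mulrCA -exprS prednK.
  by rewrite mulrCA mulrA.
apply/ler_addgt0Pr => e1 e10.
have C1r0 : 0 < C1 * r by rewrite mulr_gt0.
(* Radii may be 0: the k-th one is enlarged by om / 2^k, which leaves strict inequalities for the
   compactness argument and costs at most [e1] in all. *)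
pose om := Num.min (Num.min r 1) (e1 / (C1 * r * 2)).
have om0 : 0 < om by rewrite !lt_min r0 ltr01 divr_gt0// mulr_gt0.
have omr : om <= r by rewrite /om !ge_min lexx.
have om1 : om <= 1 by rewrite /om !ge_min lexx orbT.
have ome : C1 * r * (2 * om) <= e1.
  have -> : C1 * r * (2 * om) = om * (C1 * r * 2) by ring.
  have X0 : 0 < C1 * r * 2 by rewrite mulr_gt0.
  have : om <= e1 / (C1 * r * 2) by rewrite /om ge_min lexx orbT.
  by rewrite ler_pdivlMr.
pose omk k := om / 2 ^+ k.
have omk0 k : 0 < omk k by rewrite divr_gt0// exprn_gt0.
have omk_le k : omk k <= om.
  by rewrite ler_pdivrMr ?exprn_gt0// ler_peMr ?(ltW om0)// exprn_ege1//; lra.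
have omkX k : omk k ^+ N.-1 <= om * (2 ^+ k)^-1.
  rewrite -(prednK N1) exprS -[leRHS]mulr1 ler_wpM2l ?(ltW (omk0 k))//.
  by rewrite exprn_ile1 ?(ltW (omk0 k))//; exact: le_trans (omk_le k) om1.
pose d' k (b : 'rV[R]_N * R) := b.2 + omk k.
(* A step along [e] that moves points by at most d', so that doubling the radius closes the gaps
   between translates. About r / d' balls of volume d'^N replace one set, hence the power N - 1. *)
pose st k b := d' k b / (E + 1).
have E1 : 0 < E + 1 by lra.
pose J k b := Num.truncn (2 * r / st k b).
pose balls k (b : 'rV[R]_N * R) : seq ('rV[R]_N * R) :=
  [seq (b.1 - (- r + j%:R * st k b) *: e, 2 * d' k b) | j <- iota 0 (J k b).+1].
pose Bk k : seq ('rV[R]_N * R) := oapp (balls k) [::] (F k).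
have d'0 k b : F k = Some b -> 0 < d' k b /\ d' k b <= 2 * r.
  move=> Fk; have := Fr k; rewrite Fk /= => /andP[b0 br].
  by have := omk0 k; have := omk_le k; rewrite /d'; lra.
have st0 k b : F k = Some b -> 0 < st k b.
  by move=> /d'0[d0 _]; rewrite divr_gt0.
have cover x : `|x - c| <= th * r -> exists k b, b \in Bk k /\ `|x - b.1| < b.2.
  move=> xc; pose t := - G x; pose y := x + t *: e.
  have Gx : `|G x| <= La * (th * r).
    by rewrite -[G x]subr0 -Gc; apply: le_trans (GL _ _) _; rewrite ler_wpM2l.
  have thr : La * (th * r) + La * E * (th * r) + th * r = r.
    by rewrite -[RHS]mul1r -th1; ring.
  have thr0 : 0 <= th * r by rewrite mulr_ge0 ?ltW.
  have yc : `|y - c| <= r.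
    rewrite /y addrAC; apply: le_trans (ler_normD _ _) _; rewrite normrZ /t normrN.
    have := ler_wpM2r E0 Gx; have := mulr_ge0 La0 thr0; rewrite -/E.
    move=> h1 h2; rewrite -[leRHS]thr.
    have -> : La * E * (th * r) = La * (th * r) * E by ring.
    lra.
  have tr : - r <= t <= r.
    rewrite -ler_norml normrN; apply: le_trans Gx _; rewrite -[leRHS]thr.
    by have := mulr_ge0 (mulr_ge0 La0 E0) thr0; lra.
  have [k] := Fcov y ltac:(by rewrite /y Ge /t addrN) yc.
  case Fk : (F k) => [b|//] /= yb.
  have [dk0 dk2] := d'0 _ _ Fk; have s0 := st0 _ _ Fk.
  pose j := Num.truncn ((t + r) / st k b).
  have tr0 : 0 <= (t + r) / st k b by rewrite divr_ge0 ?(ltW s0)//; lra.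
  have jle : j%:R * st k b <= t + r by rewrite -ler_pdivlMr// truncn_le.
  have jge : t + r < j%:R * st k b + st k b.
    have := truncnS_gt ((t + r) / st k b); rewrite ltr_pdivrMr// -natr1 mulrDl mul1r.
    exact.
  exists k, (b.1 - (- r + j%:R * st k b) *: e, 2 * d' k b); split => /=.
    rewrite /Bk Fk /=; apply/mapP; exists j => //; rewrite mem_iota /= add0n ltnS.
    rewrite truncn_ge_nat; last by rewrite divr_ge0 ?(ltW s0)// mulr_ge0 ?ltW.
    by rewrite ler_pdivlMr//; lra.
  have -> : x - (b.1 - (- r + j%:R * st k b) *: e) =
      (y - b.1) + (- (t + r) + j%:R * st k b) *: e.
    by apply/rowP => l; rewrite /y !mxE; ring.
  apply: le_lt_trans (ler_normD _ _) _; rewrite normrZ -/E.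
  have h1 : `|- (t + r) + j%:R * st k b| * E <= st k b * E.
    by rewrite ler_wpM2r// ler_norml; lra.
  have h2 : st k b * E <= d' k b.
    rewrite /st mulrAC ler_pdivrMr// ler_wpM2l ?(ltW dk0)//; lra.
  have : b.2 < d' k b by rewrite ltrDl.
  lra.
(* [ball_cover_volume] takes finite lists; compactness reduces the cover to the indices below some
   [m]. *)
have [m Km] : exists m, forall x, `|x - c| <= th * r ->
    exists2 b, b \in flatten [seq Bk k | k <- index_iota 0 m] & `|x - b.1| <= b.2.
  have cptK : compact [set x : 'rV[R]_N | `|x - c| <= th * r].
    apply: bounded_closed_compact.
      exists (`|c| + th * r); split; first by rewrite num_real.
      move=> M cM x /= xc; apply: ltW; apply: le_lt_trans cM.
      by rewrite -[x](subrK c) addrC [leRHS]addrC; apply: le_trans (ler_normD _ _) _; rewrite addrC lerD.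
    have -> : [set x : 'rV[R]_N | `|x - c| <= th * r] = closed_ball c (th * r).
      rewrite closed_ballE ?mulr_gt0//; apply/seteqP; split => x /=; by rewrite /closed_ball_ /= distrC.
    exact: closed_ball_closed.
  have near_cov := (compact_near_coveringP _).1 cptK nat \oo
    (fun m x => exists2 b, b \in flatten [seq Bk k | k <- index_iota 0 m] & `|x - b.1| <= b.2) _.
  have [|m _ Hm] := near_cov; last by exists m; exact: (Hm m (leqnn m)).
  move=> x xK; have [k [b [bk xb]]] := cover x xK.
  near=> x' m; exists b.
    apply/flattenP; exists (Bk k) => //; apply/mapP; exists k => //.
    by rewrite mem_index_iota/=; near: m; exact: nbhs_infty_gt.
  rewrite -(subrK x x') -addrA; apply: le_trans (ler_normD _ _) _.
  rewrite -lerBrDr; near: x'; apply: near_norm_small; lra.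
have balls0 b : b \in flatten [seq Bk k | k <- index_iota 0 m] -> 0 < b.2.
  move=> /flattenP[_ /mapP[k _ ->]]; rewrite /Bk; case Fk : (F k) => [a|//] /=.
  by move=> /mapP[j _ ->] /=; rewrite mulr_gt0//; case: (d'0 _ _ Fk).
have := ball_cover_volume (mulr_gt0 th0 r0) balls0 Km.
move=> /le_trans; apply; rewrite big_flatten big_map.
have perk k : \sum_(b <- Bk k) b.2 ^+ N <= 2 * r * (E + 2) * 2 ^+ N * 2 ^+ N.-1 *
    (oapp (fun b => b.2 ^+ N.-1) 0 (F k) + om * (2 ^+ k)^-1).
  have P0 : 0 <= 2 * r * (E + 2) * 2 ^+ N * 2 ^+ N.-1.
    by rewrite !mulr_ge0 ?exprn_ge0 ?(ltW r0)//; lra.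
  rewrite /Bk; case Fk : (F k) => [b|] /=; last first.
    by rewrite big_nil add0r; apply: mulr_ge0 => //; rewrite divr_ge0 ?exprn_ge0 ?(ltW om0).
  have [dk0 dk2] := d'0 _ _ Fk; have s0 := st0 _ _ Fk.
  have := Fr k; rewrite Fk /= => /andP[b0 br].
  rewrite /balls big_map (eq_bigr (fun=> (2 * d' k b) ^+ N))// big_const_seq count_predT iter_addr_0 size_iota -[X in X <= _]mulr_natl.
  have JJ : (J k b).+1%:R * d' k b <= 2 * r * (E + 2).
    have : (J k b)%:R <= 2 * r / st k b by rewrite truncn_le// divr_ge0 ?(ltW s0)// mulr_ge0 ?ltW.
    rewrite ler_pdivlMr// /st mulrA ler_pdivrMr//.
    rewrite -[(J k b).+1%:R]natr1 [(_%:R + 1) * _]mulrDl [1 * d' _ _]mul1r.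
    have -> : 2 * r * (E + 2) = 2 * r * (E + 1) + 2 * r by ring.
    by move=> h1; exact: lerD.
  rewrite exprMn -{2}(prednK N0) exprS.
  have -> : (J k b).+1%:R * (2 ^+ N * (d' k b * d' k b ^+ N.-1)) =
    ((J k b).+1%:R * d' k b) * 2 ^+ N * d' k b ^+ N.-1 by ring.
  rewrite -[leRHS]mulrA; apply: ler_pM.
  - by rewrite !mulr_ge0 ?exprn_ge0 ?(ltW dk0).
  - by rewrite exprn_ge0 ?(ltW dk0).
  - by rewrite ler_wpM2r ?exprn_ge0.
  apply: le_trans (exprD_le _ b0 (ltW (omk0 k))) _.
  by rewrite ler_wpM2l ?exprn_ge0// lerD2l omkX.
apply: (@le_trans _ _ (7 ^+ N * \sum_(0 <= k < m) 2 * r * (E + 2) * 2 ^+ N * 2 ^+ N.-1 *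
    (oapp (fun b => b.2 ^+ N.-1) 0 (F k) + om * (2 ^+ k)^-1))).
  by rewrite ler_wpM2l ?exprn_ge0//; apply: ler_sum.
rewrite -mulr_sumr big_mkord big_split /= -mulr_sumr.
have -> : 7 ^+ N * (2 * r * (E + 2) * 2 ^+ N * 2 ^+ N.-1 *
    (\sum_(k < m) oapp (fun b => b.2 ^+ N.-1) 0 (F k) + om * \sum_(k < m) (2 ^+ k)^-1)) =
  C1 * r * \sum_(k < m) oapp (fun b => b.2 ^+ N.-1) 0 (F k) +
  C1 * r * (om * \sum_(k < m) (2 ^+ k)^-1) by rewrite /C1; ring.
apply: lerD; first by rewrite ler_pM2l.
apply: le_trans ome; rewrite ler_pM2l// [2 * _]mulrC ler_pM2l//; exact: sum_half_le.
Unshelve. all: by end_near. Qed.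

End Ahlfors.

(** * Complex and real coordinates *)

Section Realification.
Variables (R : realType) (n : nat).
Local Notation N := (n + n)%N.
Implicit Types (x y : 'rV[R]_N) (z w : 'rV[R[i]]_n).

Definition complexify x : 'rV[R[i]]_n :=
  \row_j (x ord0 (lshift n j) +i* x ord0 (rshift n j)).

Lemma realifyK : cancel (@realify R n) complexify.
Proof.
move=> z; apply/rowP => j; rewrite [LHS]mxE /realify row_mxEl row_mxEr !mxE.
by case: (z _ j).
Qed.

Lemma complexifyK : cancel complexify (@realify R n).
Proof.
move=> x; rewrite -[RHS]hsubmxK /realify; congr row_mx; apply/rowP => j; rewrite !mxE;
  by rewrite (_ : (0 : 'I_1) = ord0)//; exact: val_inj.
Qed.

Lemma normc_normE (c : R[i]) : `|c| = (Normc.normc c)%:C.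
Proof. by rewrite normc_def; case: c. Qed.

Lemma Re_le_normc (c : R[i]) : `|complex.Re c| <= Normc.normc c.
Proof.
case: c => a b /=; rewrite -sqrtr_sqr ler_wsqrtr// lerDl sqr_ge0//.
Qed.

Lemma Im_le_normc (c : R[i]) : `|complex.Im c| <= Normc.normc c.
Proof.
case: c => a b /=; rewrite -sqrtr_sqr ler_wsqrtr// lerDr sqr_ge0//.
Qed.

Lemma normc_le (a b : R) : Normc.normc (a +i* b) <= `|a| + `|b|.
Proof.
rewrite /= -[leRHS]ger0_norm ?addr_ge0// -sqrtr_sqr ler_wsqrtr// sqrrD.
rewrite !real_normK ?num_real// -addrA [_ *+ 2 + _]addrC addrA lerDl mulrn_wge0// mulr_ge0//.
Qed.

Lemma complexify_norm_le x : `|complexify x| <= (2 * `|x|)%:C.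
Proof.
have [->|xz0] := eqVneq (complexify x) 0; first by rewrite normr0 lecR mulr_ge0.
have xz1 : mx_norm (complexify x) != 0 by rewrite -[mx_norm _]/(`|complexify x|) normr_eq0.
have [[a k] ak] := mx_norm_neq0 xz1; rewrite [`|complexify x|]ak /= (ord1 a) !mxE normc_normE lecR.
apply: le_trans (normc_le _ _) _; rewrite mulr_natl mulr2n.
by apply: lerD; exact: rV_coord_le_norm.
Qed.

Lemma realifyB z w : realify (z - w) = realify z - realify w.
Proof.
rewrite /realify opp_row_mx add_row_mx; congr row_mx; apply/rowP => j; rewrite !mxE;
  by case: (z _ j) => a b; case: (w _ j).
Qed.

Lemma complexifyB x y : complexify (x - y) = complexify x - complexify y.
Proof. by apply: (can_inj realifyK); rewrite realifyB !complexifyK. Qed.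

Lemma realify_ball_norm z w (e : R) : ball z e%:C w -> `|realify w - realify z| < e.
Proof.
move=> [e0 zw]; rewrite ltcR in e0.
have zwj j : Normc.normc (w ord0 j - z ord0 j) < e.
  have := zw ord0 j; rewrite -ball_normE /= distrC normc_normE ltcR; exact.
pose m := \big[Num.max/0]_j Normc.normc (w ord0 j - z ord0 j).
have me : m < e by apply/bigmax_ltP; split => // j _; exact: zwj.
apply: le_lt_trans me; rewrite -realifyB; apply/rV_norm_leP => [|k].
  by rewrite /m; elim/big_ind : _ => // [a b a0 b0|j _]; rewrite ?le_max ?a0//; case: (_ - _) => a b; exact: sqrtr_ge0.
rewrite /realify -(splitK k); case: (fintype.split k) => j /=.
  rewrite row_mxEl !mxE; apply: le_trans (Re_le_normc _) _.
  exact: (le_bigmax_cond _ (fun j => Normc.normc (w ord0 j - z ord0 j))).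
rewrite row_mxEr !mxE; apply: le_trans (Im_le_normc _) _.
exact: (le_bigmax_cond _ (fun j => Normc.normc (w ord0 j - z ord0 j))).
Qed.

Lemma nbhs_complexify x (U : set 'rV[R[i]]_n) : nbhs (complexify x) U <->
  \forall y \near x, U (complexify y).
Proof.
split=> [/nbhs_normP[e e0 eU]|].
  have [r r0 re] : exists2 r : R, 0 < r & r%:C = e.
    exists (complex.Re e); first by move: e0; rewrite /= ltcE => /andP[].
    by rewrite RRe_real// gtr0_real.
  apply/near_norm; exists (r / 2); first by rewrite divr_gt0.
  move=> y yx; apply: eU; rewrite /= -re -complexifyB.
  apply: le_lt_trans (complexify_norm_le _) _; rewrite ltcR distrC.
  by rewrite mulrC -ltr_pdivlMr.
move=> /near_norm[r r0 rU]; apply/nbhs_ballP; exists r%:C; first by rewrite /= ltcR.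
move=> w /realify_ball_norm; rewrite complexifyK => /rU.
by rewrite realifyK.
Qed.

Lemma complexify_continuous : continuous complexify.
Proof. by move=> x U /nbhs_complexify. Qed.

Lemma open_complexify (A : set 'rV[R[i]]_n) : open A -> open (complexify @^-1` A).
Proof. by move=> oA; apply: open_comp => // x _; exact: complexify_continuous. Qed.

Lemma closure_complexify (A : set 'rV[R[i]]_n) x :
  closure (complexify @^-1` A) x <-> closure A (complexify x).
Proof.
split=> clA U.
  by move=> /nbhs_complexify /clA[y [Ay Uy]]; exists (complexify y).
move=> Ux; have [|w [Aw Uw]] := clA (fun w => U (realify w)).
  by apply/nbhs_complexify; apply: filterS Ux => y; rewrite complexifyK.
by exists (realify w); split => //; rewrite /= realifyK.
Qed.

Lemma boundary_complexify (A : set 'rV[R[i]]_n) z : open A ->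
  topological_boundary A z <->
  (closure (complexify @^-1` A) `\` (complexify @^-1` A)) (realify z).
Proof.
move=> oA; rewrite /topological_boundary ((interior_id A).1 oA).
by split => -[clA nA]; split => //;
  [apply/closure_complexify|move: nA|move/closure_complexify : clA|move: nA]; rewrite /= realifyK.
Qed.

Lemma bounded_complexify (A : set 'rV[R[i]]_n) : bounded_set A ->
  exists2 r : R, 0 < r & forall x, A (complexify x) -> `|x| <= r.
Proof.
move=> [M [Mreal AM]].
have [m Mm] : exists m : R, M = m%:C by exists (complex.Re M); rewrite RRe_real.
exists (`|m| + 2); first by rewrite ltr_wpDl.
move=> x /(AM (`|m| + 1)%:C _) h.
have : ball 0 (`|m| + 2)%:C (complexify x).
  rewrite mx_norm_ball /ball_ /= sub0r normrN; apply: le_lt_trans (h _) _.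
    by rewrite Mm ltcR; have := ler_norm m; lra.
  by rewrite ltcR; lra.
move=> /realify_ball_norm /ltW; rewrite complexifyK.
rewrite (_ : realify 0 = 0) ?subr0//.
by rewrite -[0 in LHS](subrr 0) realifyB subrr.
Qed.

(** The differential is complex linear, and the real and imaginary parts of w_j c_j have the
    Cauchy-Riemann pattern. The factor [th] serves to rotate a value of [f] onto the real axis. *)
Lemma differentiable_cauchy_riemann (f : 'rV[R[i]]_n -> R[i]) (th : R[i]) x :
  Normc.normc th <= 1 -> differentiable f (complexify x) ->
  cauchy_riemann_at (fun y => complex.Re (th * f (complexify y)))
    (fun y => complex.Im (th * f (complexify y))) x.
Proof.
move=> th1 df; set z := complexify x.
pose L := 'd f z : 'rV[R[i]]_n -> R[i].
pose c j := th * L (delta_mx 0 j).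
have LE w : th * L w = \sum_j w ord0 j * c j.
  rewrite {1}[w]row_sum_delta /L linear_sum mulr_sumr; apply: eq_bigr => j _.
  by rewrite linearZ /= /c mulrCA.
have rem eps : 0 < eps -> \forall y \near x,
    Normc.normc (th * f (complexify y) - th * f z - th * L (complexify (y - x))) <= eps * `|y - x|.
  move=> eps0.
  have := diff_locally df => /eqaddoP /(_ (eps / 2)%:C).
  rewrite ltcR divr_gt0// => /(_ isT) dfn.
  have : \forall y \near x, `|f (complexify y) - f z - L (complexify (y - x))| <=
      (eps / 2)%:C * `|complexify (y - x)|.
    have h0 : complexify 0 = 0 by rewrite -[0 in LHS](subrr 0) complexifyB subrr.
    have : nbhs (complexify 0) (fun w : 'rV[R[i]]_n =>
        `|f (w + z) - (f z + L w)| <= (eps / 2)%:C * `|w|).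
      by rewrite h0; exact: dfn.
    move=> /nbhs_complexify /near_norm[r r0 rP]; apply/near_norm; exists r => // y yx.
    have := rP (y - x); rewrite subr0 => /(_ yx).
    by rewrite complexifyB subrK opprD addrA.
  apply: filterS => y; rewrite normc_normE => yP.
  have := le_trans yP (ler_wpM2l _ (complexify_norm_le _)).
  rewrite lecR ?divr_ge0 ?(ltW eps0)// -rmorphM lecR => /(_ isT) {}yP.
  rewrite -!mulrBr Normc.normcM.
  apply: le_trans (ler_wpM2r _ th1) _; first by case: (_ - _) => a b; exact: sqrtr_ge0.
  rewrite mul1r; apply: le_trans yP _.
  by rewrite mulrA divfK.
have coord (y : 'rV[R]_N) j : (complexify y) ord0 j = y ord0 (lshift n j) +i* y ord0 (rshift n j).
  by rewrite mxE.
have ReB (a b : R[i]) : complex.Re (a - b) = complex.Re a - complex.Re b by case: a; case: b.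
have ImB (a b : R[i]) : complex.Im (a - b) = complex.Im a - complex.Im b by case: a; case: b.
have Re_sum (a : 'I_n -> R[i]) : complex.Re (\sum_j a j) = \sum_j complex.Re (a j).
  by apply: (big_morph _ _ (erefl _)) => - [? ?] [? ?].
have Im_sum (a : 'I_n -> R[i]) : complex.Im (\sum_j a j) = \sum_j complex.Im (a j).
  by apply: (big_morph _ _ (erefl _)) => - [? ?] [? ?].
exists (\row_j complex.Re (c j)), (\row_j complex.Im (c j)); split; apply/has_gradP => eps eps0;
    apply: filterS (rem _ eps0) => y; apply: le_trans.
- apply: le_trans (Re_le_normc _); rewrite LE le_eqVlt; apply/orP; left; apply/eqP; congr `|_|.
  rewrite !ReB Re_sum /dotv big_split_ord /= -big_split /=; congr (_ - _).
  apply: eq_bigr => j _; rewrite row_mxEl row_mxEr coord !mxE.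
  by case: (c j) => a b /=; ring.
- apply: le_trans (Im_le_normc _); rewrite LE le_eqVlt; apply/orP; left; apply/eqP; congr `|_|.
  rewrite !ImB Im_sum /dotv big_split_ord /= -big_split /=; congr (_ - _).
  apply: eq_bigr => j _; rewrite row_mxEl row_mxEr coord !mxE.
  by case: (c j) => a b /=; ring.
Qed.

End Realification.

(** * Lipschitz boundaries *)

(** The families of supersets of sets in [P] generate a filter, to which the near-covering form of
    compactness applies. This turns estimates in charts into global ones. *)
Lemma compact_ideal_ind (T : topologicalType) (P : set T -> Prop) (K : set T) :
  compact K -> P set0 -> (forall A B, P A -> P B -> P (A `|` B)) ->
  (forall A B, A `<=` B -> P B -> P A) ->
  (forall x, K x -> exists2 U, nbhs x U & P U) -> P K.
Proof.
move=> cK P0 PU PS PK.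
pose F := filter_from P (fun X => [set Y | X `<=` Y]).
have FF : Filter F.
  apply: filter_from_filter; first by exists set0.
  move=> A B PA PB; exists (A `|` B); first exact: PU.
  by move=> Y /=; rewrite subUset.
have := (compact_near_coveringP K).1 cK (set T) F (fun Y x => Y x) FF.
case=> [x Kx|X PX XK].
  have [U xU PU'] := PK x Kx; exists (U, [set Y | U `<=` Y]) => /=.
    by split => //; exists U.
  by move=> [y Y] /= [Uy]; exact.
by apply: PS PX; exact: (XK X).
Qed.

Section Charts.
Variables (R : realType) (N : nat).
Implicit Types (x y : 'rV[R]_N) (D : set 'rV[R]_N).

Definition bd D := closure D `\` D.

(** [G] is the signed height over the graph and [e] the vertical direction. Keeping the Lipschitz
    bound and the unit growth along [e] removes the orthogonal matrix from the geometry; [G] is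
    global, only its link with [D] is local. *)
Definition lipschitz_chart D a rho (G : 'rV[R]_N -> R) e La :=
  [/\ 0 < rho, 0 <= La, forall x y, `|G x - G y| <= La * `|x - y|,
    forall x t, G (x + t *: e) = G x + t &
    forall x, `|x - a| < rho -> D x <-> 0 < G x].

Lemma closed_bd D : open D -> closed (bd D).
Proof. by move=> oD; rewrite /bd setDE; apply: closedI; [exact: closed_closure|exact: open_closedC]. Qed.

(** Where G < 0 the Lipschitz bound keeps a whole ball out of [D]; where G = 0 a small move along
    [e] enters [D]. *)
Lemma chart_bd D a rho G e La : lipschitz_chart D a rho G e La ->
  forall x, `|x - a| < rho -> bd D x <-> G x = 0.
Proof.
move=> [rho0 La0 GL Ge DG] x xa; split.
  move=> [clx nDx]; have Gx0 : G x <= 0 by rewrite leNgt; apply/negP => /(DG _ xa).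
  apply/eqP; rewrite eq_le Gx0 leNgt; apply/negP => Gx.
  have d0 : 0 < Num.min (rho - `|x - a|) (- G x / (La + 1)).
    by rewrite lt_min subr_gt0 xa divr_gt0 ?oppr_gt0// ltr_wpDl.
  have [|y [Dy yx]] := clx (fun y => `|y - x| < Num.min (rho - `|x - a|) (- G x / (La + 1))).
    by apply/near_norm; exists (Num.min (rho - `|x - a|) (- G x / (La + 1))).
  move: yx; rewrite lt_min => /andP[yx1].
  rewrite ltr_pdivlMr ?ltr_wpDl// => yx2.
  have ya : `|y - a| < rho.
    by apply: le_lt_trans (ler_distD x _ _) _; rewrite -ltrBrDr.
  have := (DG _ ya).1 Dy; have := GL y x; rewrite ler_norml => /andP[_].
  have := normr_ge0 (y - x); nra.
move=> Gx0; split; last by move/(DG _ xa); rewrite Gx0 ltxx.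
move=> U /near_norm[d d0 dU].
have e0 : 0 <= `|e| by exact: normr_ge0.
have m0 : 0 < Num.min d (rho - `|x - a|) by rewrite lt_min d0 subr_gt0.
pose t := Num.min d (rho - `|x - a|) / (`|e| + 1).
have t0 : 0 < t by rewrite divr_gt0// ltr_wpDl.
have te : `|t *: e| < Num.min d (rho - `|x - a|).
  rewrite normrZ gtr0_norm// /t mulrAC ltr_pdivrMr ?ltr_wpDl//.
  by rewrite ltr_pM2l// ltrDl.
move: te; rewrite lt_min => /andP[te1 te2].
exists (x + t *: e); split; last by apply: dU; rewrite addrAC subrr add0r.
apply/DG; last by rewrite Ge Gx0 add0r.
rewrite addrAC; apply: le_lt_trans (ler_normD _ _) _.
by rewrite -ltrBrDl.
Qed.

Hypothesis N0 : (0 < N)%N.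
Variable D : set 'rV[R]_N.
Hypotheses (oD : open D).
Variable M : R.
Hypothesis DM : forall x, D x -> `|x| <= M.
Hypothesis charts : forall a, bd D a -> exists rho G e La, lipschitz_chart D a rho G e La.

Lemma closure_bounded x : closure D x -> `|x| <= M.
Proof.
move=> clx; rewrite leNgt; apply/negP => Mx.
have [|y [/DM yM]] := clx (fun y => `|y - x| < `|x| - M).
  by apply/near_norm; exists (`|x| - M); rewrite ?subr_gt0.
apply/negP; rewrite -leNgt distrC.
by apply: le_trans (lerB_dist _ _); rewrite lerB.
Qed.

Lemma compact_closure_bounded : compact (closure D).
Proof.
apply: bounded_closed_compact; last exact: closed_closure.
exists M; split; first exact: num_real.
by move=> x Mx y /closure_bounded yM; apply: le_trans yM (ltW Mx).
Qed.

Lemma compact_bd : compact (bd D).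
Proof.
by apply: subclosed_compact (closed_bd oD) compact_closure_bounded _; exact: subDsetl.
Qed.

Lemma nbhs_norm_ball (a : 'rV[R]_N) (r : R) : 0 < r -> nbhs a [set x : 'rV[R]_N | `|x - a| < r].
Proof. by move=> r0; apply/near_norm; exists r. Qed.

Lemma boundary_cell_count : exists C : nat,
  forall (h : R) (s : seq 'rV[int]_N) (i0 : 'rV[int]_N) (r : nat),
    0 < h -> (0 < r)%N -> uniq s -> (forall i, i \in s -> (latdist i i0 <= r)%N) ->
    (forall i, i \in s -> cube h i `&` bd D !=set0) ->
    (size s <= C * r ^ N.-1)%N.
Proof.
(* [X] localises the boundary, not the scale: [G] is global, so one chart gives the count for all
   [h] and [r]. *)
pose P (X : set 'rV[R]_N) := exists C : nat,
  forall (h : R) (s : seq 'rV[int]_N) (i0 : 'rV[int]_N) (r : nat),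
    0 < h -> (0 < r)%N -> uniq s -> (forall i, i \in s -> (latdist i i0 <= r)%N) ->
    (forall i, i \in s -> cube h i `&` (bd D `&` X) !=set0) ->
    (size s <= C * r ^ N.-1)%N.
suff [C HC] : P (bd D).
  exists C => h s i0 r h0 r0 us si0 sbd; apply: HC h0 r0 us si0 _ => i /sbd.
  by rewrite setIid.
apply: compact_ideal_ind compact_bd _ _ _ _.
- exists 0%N => h s i0 r _ _ _ _; case: s => // i s /(_ i (mem_head _ _)).
  by case=> x [_ []].
- move=> A B [CA HA] [CB HB]; exists (CA + CB)%N => h s i0 r h0 r0 us si0 sbd.
  pose a i := `[< cube h i `&` (bd D `&` A) !=set0 >].
  rewrite -(count_predC a s) mulnDl -!size_filter; apply: leq_add.
    apply: HA h0 r0 (filter_uniq _ us) _ _ => i; rewrite mem_filter => /andP[].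
      by move=> _; exact: si0.
    by move=> /asboolP.
  apply: HB h0 r0 (filter_uniq _ us) _ _ => i; rewrite mem_filter => /andP[].
    by move=> _; exact: si0.
  move=> /asboolP nA /sbd[x [xi [xb [xA|xB]]]]; last by exists x.
  by case: nA; exists x.
- move=> A B AB [C HC]; exists C => h s i0 r h0 r0 us si0 sbd.
  apply: HC h0 r0 us si0 _ => i /sbd[x [xi [xb /AB xB]]].
  by exists x.
move=> a /charts[rho [G [e [La ch]]]].
have [rho0 La0 GL Ge DG] := ch.
exists [set x | `|x - a| < rho]; first exact: nbhs_norm_ball.
have [C _ HC] := graph_cell_count N0 GL Ge.
exists C => h s i0 r h0 r0 us si0 sbd; apply: HC h0 r0 us si0 _ => i /sbd[x [xi [xb xa]]].
by exists x => //; exact/(chart_bd ch).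
Qed.

(** The cube is convex: on the segment from x to y, [D] would be open and closed if no boundary
    point were met. *)
Lemma cube_meets_bd (h : R) i x y : 0 <= h -> cube h i x -> cube h i y -> D x -> ~ D y ->
  cube h i `&` bd D !=set0.
Proof.
move=> h0 xi yi Dx Dy; apply/set0P/negP => /eqP Ebd.
pose g (t : R) := x + t *: (y - x).
pose E := g @` `[0, 1]%classic.
have Ei : E `<=` cube h i.
  move=> _ [t t01 <-] k; move: t01; rewrite /= in_itv /= => /andP[t0 t1].
  have := xi k; have := yi k; rewrite !mxE => /andP[y1 y2] /andP[x1 x2].
  by apply/andP; split; nra.
have cE : connected E.
  apply: connected_continuous_connected; first exact: segment_connected.
  apply: continuous_subspaceT => t; apply: cvgD; first exact: cvg_cst.
  by apply: cvgZr_tmp; exact: cvg_id.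
have EE : E `&` D = E.
  apply: cE; first by exists x; split => //; exists 0; rewrite /= ?in_itv /= ?lexx ?ler01// /g scale0r addr0.
    by exists D.
  exists (closure D); first exact: closed_closure.
  rewrite eqEsubset; split => z [Ez]; first by move/subset_closure.
  move=> clz; split => //; apply: contrapT => nDz.
  suff : set0 z by []. 
  by rewrite -Ebd; split; [exact: Ei|].
have : E y by exists 1; rewrite /= ?in_itv /= ?lexx ?ler01// /g scale1r addrC subrK.
by rewrite -EE => -[].
Qed.

End Charts.

(** * Charts of the domain and Hausdorff measure of its boundary *)

Section ComplexBoundary.
Variables (R : realType) (n : nat).
Local Notation N := (n + n)%N.
Implicit Types (x y : 'rV[R]_N) (z w : 'rV[R[i]]_n).

Lemma norm_mulmx_le (m1 m2 : nat) (Q : 'M[R]_(m1, m2)) :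
  exists2 C, 0 <= C & forall x : 'rV[R]_m1, `|x *m Q| <= C * `|x|.
Proof.
exists (\sum_k \sum_j `|Q k j|); first by rewrite sumr_ge0// => k _; rewrite sumr_ge0.
move=> x; apply/rV_norm_leP => [|j].
  by rewrite mulr_ge0// sumr_ge0// => k _; rewrite sumr_ge0.
rewrite !mxE; apply: le_trans (ler_norm_sum _ _ _) _; rewrite mulr_suml; apply: ler_sum => k _.
rewrite normrM mulrC; apply: ler_pM => //; last exact: rV_coord_le_norm.
by rewrite (bigD1 j)//= lerDl sumr_ge0.
Qed.

Lemma norm_col'_le (m : nat) (i : 'I_m) (x : 'rV[R]_m) : `|col' i x| <= `|x|.
Proof. by apply/rV_norm_leP => // j; rewrite mxE rV_coord_le_norm. Qed.

Lemma lipschitzP (m : nat) (phi : 'rV[R]_m -> R) : lipschitz phi ->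
  exists2 L, 0 <= L & forall x y : 'rV[R]_m, `|phi x - phi y| <= L * `|x - y|.
Proof.
move=> [L0 [_ HL]]; exists (`|L0| + 1); first by rewrite addr_ge0.
move=> x y; apply: (HL (`|L0| + 1) _ (x, y)) => //.
by have := ler_norm L0; lra.
Qed.

Lemma lipschitz_boundary_chart (Omega : set 'rV[R[i]]_n) : open Omega ->
  lipschitz_boundary Omega -> forall a, bd (@complexify R n @^-1` Omega) a ->
  exists rho G e La, lipschitz_chart (@complexify R n @^-1` Omega) a rho G e La.
Proof.
move=> oO lip a bda.
have : topological_boundary Omega (complexify a).
  by apply/boundary_complexify; rewrite ?complexifyK.
move=> /lip[Q [i [phi [U [QQ lphi aU DU]]]]].
have [L L0 HL] := lipschitzP lphi.
have [C C0 HC] := norm_mulmx_le Q.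
have [rho rho0 rhoU] : exists2 rho, 0 < rho & forall x, `|x - a| < rho -> U (complexify x).
  by move/nbhs_complexify : aU => /near_norm.
(* The vector that Q sends to the i-th basis vector: moving along it raises coordinate i and fixes
   the others, hence the value of [phi]. *)
pose e := delta_mx ord0 i *m Q^T : 'rV[R]_N.
have eQ : e *m Q = delta_mx ord0 i by rewrite -mulmxA (mulmx1C QQ) mulmx1.
exists rho, (fun x => (x *m Q) ord0 i - phi (col' i (x *m Q))), e, (C + L * C); split => //.
- by rewrite addr_ge0// mulr_ge0.
- move=> x y; have aux (r1 r2 s1 s2 : R) : r1 - s1 - (r2 - s2) = (r1 - r2) - (s1 - s2) by ring.
  have xyQ : (x *m Q) ord0 i - (y *m Q) ord0 i = ((x - y) *m Q) ord0 i by rewrite mulmxBl !mxE.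
  rewrite aux xyQ.
  apply: le_trans (ler_normB _ _) _; rewrite mulrDl; apply: lerD.
    exact: le_trans (rV_coord_le_norm _ _) (HC _).
  apply: le_trans (HL _ _) _; rewrite -mulrA ler_wpM2l//.
  by rewrite -linearB /= -mulmxBl; exact: le_trans (norm_col'_le _ _) (HC _).
- move=> x t; rewrite mulmxDl -scalemxAl eQ !mxE !eqxx /= mulr1.
  have -> : col' i (x *m Q + t *: delta_mx ord0 i) = col' i (x *m Q).
    by apply/rowP => j; rewrite !mxE [lift _ _ == _]eq_sym (negbTE (neq_lift i j)) andbF mulr0 addr0.
  by ring.
move=> x /rhoU Ux; rewrite /= subr_gt0.
have := congr1 (fun X : set _ => X (complexify x)) DU; rewrite /setI /= complexifyK.
move=> E; split => [Dx|xG].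
  by have [] : phi (col' i (x *m Q)) < (x *m Q) ord0 i /\ U (complexify x) by rewrite -E.
by have [] : Omega (complexify x) /\ U (complexify x) by rewrite E.
Qed.

Lemma diameter_fineK (B : set 'rV[R[i]]_n) (d : R) : B !=set0 -> (diameter B <= d%:E)%E ->
  [/\ diameter B = (fine (diameter B))%:E, 0 <= fine (diameter B) & fine (diameter B) <= d].
Proof.
move=> B0 Bd; have D0 := diameter_ge0 B0.
have Dfin : diameter B \is a fin_num by rewrite ge0_fin_numE// (le_lt_trans Bd)// ltry.
by split; rewrite ?fineK// -lee_fin fineK.
Qed.

Lemma le_hausdorff_premeasure s (d1 d2 : R) (A : set 'rV[R[i]]_n) : d1 <= d2 ->
  (hausdorff_premeasure s d2 A <= hausdorff_premeasure s d1 A)%E.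
Proof.
move=> d12; apply: ereal_inf_le_tmp => _ [F [PF AF] <-]; exists F => //; split => // k.
have := PF k; case: (F k) => //= B [B0 Bd]; split => //.
by apply: le_trans Bd _; rewrite lee_fin.
Qed.

(** A set of diameter at most d < dl cannot meet both [A] and [B], so each member of a cover is
    charged to one of them only. *)
Lemma hausdorff_premeasure_separated s (d dl : R) (A B : set 'rV[R[i]]_n) : d < dl ->
  (forall z w, A z -> B w -> dl <= `|realify z - realify w|) ->
  (hausdorff_premeasure s d A + hausdorff_premeasure s d B <=
   hausdorff_premeasure s d (A `|` B))%E.
Proof.
move=> ddl AB; apply: le_ereal_inf_tmp => _ [F [PF XF] <-].
pose r (X : set 'rV[R[i]]_n) k : option (set 'rV[R[i]]_n) :=
  if F k is Some Y then if `[< Y `&` X !=set0 >] then Some Y else None else None.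
have rX X : X `<=` A `|` B -> (hausdorff_premeasure s d X <=
    \sum_(k <oo) oapp (@hausdorff_weight R n s) 0 (r X k))%E.
  move=> XAB; apply: ereal_inf_lbound; exists (r X) => //; split.
    by move=> k; rewrite /r; have := PF k; case: (F k) => //= S; case: ifP.
  move=> z Xz; have [k _ zk] := XF z (XAB z Xz); exists k => //; rewrite /r.
  move: zk; case: (F k) => //= S Sz; case: ifPn => //= /asboolPn; case.
  by exists z.
apply: le_trans (leeD (rX A _) (rX B _)) _; [exact: subsetUl|exact: subsetUr|].
have w0 k : (0 <= oapp (@hausdorff_weight R n s) 0 (F k))%E.
  by have := PF k; case: (F k) => //= S; exact: hausdorff_weight_ge0.
have r0 X k : (0 <= oapp (@hausdorff_weight R n s) 0 (r X k))%E.
  by rewrite /r; have := w0 k; case: (F k) => //= S; case: ifP.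
rewrite -nneseriesD//; apply: lee_nneseries => [k _ _|k _]; first exact: adde_ge0.
rewrite /r; have := PF k; have := w0 k; case: (F k) => [S|_ _] /=; last by rewrite adde0.
move=> S0 [_ Sd]; case: ifPn => [/asboolP[z [Sz Az]]|_]; case: ifPn => [/asboolP[w [Sw Bw]]|_];
  rewrite /= ?adde0 ?add0e//.
have := le_trans (AB z w Az Bw) (norm_le_diameter Sd Sz Sw).
by rewrite leNgt ddl.
Qed.

Lemma hausdorff_outer_separated s (dl : R) (A B : set 'rV[R[i]]_n) : 0 < dl ->
  (forall z w, A z -> B w -> dl <= `|realify z - realify w|) ->
  (hausdorff_outer s A + hausdorff_outer s B <= hausdorff_outer s (A `|` B))%E.
Proof.
move=> dl0 AB; set X := A `|` B.
have [->|Xoo] := eqVneq (hausdorff_outer s X) +oo%E; first exact: leey.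
have Hfin (Y : set 'rV[R[i]]_n) : Y `<=` X -> hausdorff_outer s Y \is a fin_num.
  move=> YX; rewrite ge0_fin_numE ?hausdorff_outer_ge0//.
  by apply: le_lt_trans (le_hausdorff_outer _ YX) _; rewrite ltey.
have pre_le d (Y : set 'rV[R[i]]_n) : 0 < d -> (hausdorff_premeasure s d Y <= hausdorff_outer s Y)%E.
  by move=> d0; apply: ereal_sup_ubound; exists d.
have pre_fin d (Y : set 'rV[R[i]]_n) : 0 < d -> Y `<=` X -> hausdorff_premeasure s d Y \is a fin_num.
  move=> d0 YX; rewrite ge0_fin_numE; last first.
    by apply: cover_outer_ge0 => S; exact: hausdorff_weight_ge0.
  by apply: le_lt_trans (pre_le _ _ d0) _; rewrite ltey_eq Hfin.
have AX : A `<=` X by exact: subsetUl.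
have BX : B `<=` X by exact: subsetUr.
have main d1 d2 : 0 < d1 -> 0 < d2 ->
    (hausdorff_premeasure s d1 A + hausdorff_premeasure s d2 B <= hausdorff_outer s X)%E.
  move=> d10 d20; pose d := Num.min (Num.min d1 d2) (dl / 2).
  have d0 : 0 < d by rewrite !lt_min d10 d20 divr_gt0.
  have ddl : d < dl.
    by apply: le_lt_trans (_ : dl / 2 < dl); [rewrite ge_min lexx orbT|lra].
  apply: le_trans (pre_le d X d0); apply: le_trans (hausdorff_premeasure_separated s ddl AB).
  by apply: leeD; apply: le_hausdorff_premeasure; rewrite !ge_min lexx ?orbT.
rewrite -leeBrDr ?Hfin//; apply: ge_ereal_sup => _ [d1 d10 <-].
rewrite leeBrDr ?Hfin// addeC -leeBrDr ?pre_fin//; apply: ge_ereal_sup => _ [d2 d20 <-].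
by rewrite leeBrDr ?pre_fin// addeC; exact: main.
Qed.

Lemma hausdorff_closed_measurable s (C : set 'rV[R]_N) : closed C ->
  measurable (@realify R n @^-1` C : set (caratheodory_type (@hausdorff_outer R n s))).
Proof.
move=> cC; apply: (@metric_outer_caratheodory R _ (@hausdorff_outer R n s)
  (fun z w => `|realify z - realify w|)).
- by move=> x y z; exact: ler_distD.
- by move=> A B dl dl0 AB; exact: hausdorff_outer_separated dl0 AB.
move=> z /= nCz; have oC := closed_openC cC.
have /near_norm[dl dl0 zC] : \forall y \near realify z, (~` C) y by exact: open_nbhs_nbhs.
exists dl => // w Cw; rewrite leNgt; apply/negP => zw.
by apply: (zC (realify w)) => //; rewrite distrC.
Qed.

Lemma closed_norm_ball (m : nat) (b : 'rV[R]_m) (r : R) : closed [set x | `|x - b| <= r].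
Proof.
rewrite -openC openE => x /= /negP; rewrite -ltNge => xb.
apply/near_norm; exists (`|x - b| - r); first by rewrite subr_gt0.
move=> y yx; apply/negP; rewrite -ltNge.
by have := ler_distD y x b; rewrite (distrC x y); lra.
Qed.

Definition bdball (D : set 'rV[R]_N) b r : set 'rV[R[i]]_n :=
  @realify R n @^-1` (bd D `&` [set x | `|x - b| <= r]).

(** A covering set is replaced by the ball about one of its points with radius its diameter, and
    [graph_cover_sum] bounds the sum of the diameters to the power N - 1 from below. Halving [rho]
    keeps the ball about b inside the chart. *)
Lemma chart_ahlfors (D : set 'rV[R]_N) a rho G e La : (0 < n)%N -> lipschitz_chart D a rho G e La ->
  exists2 c : R, 0 < c & forall b r, `|b - a| < rho / 2 -> bd D b -> 0 < r -> r <= rho / 2 ->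
    ((c * r ^+ N.-1)%:E <=
     hausdorff_outer (2 * n - 1) (bdball D b r))%E.
Proof.
move=> n0 ch; have [rho0 La0 GL Ge DG] := ch.
have [C C0 HC] := graph_cover_sum n0 La0 GL Ge.
have sN : (2 * n - 1 = N.-1)%N by lia.
rewrite sN; set s := N.-1.
have ball_gt0 m : 0 < ball_volume R m.
  suff : 0 < ball_volume R m /\ 0 < ball_volume R m.+1 by case.
  elim: m => [|m [IH1 IH2]]; first by [].
  by split => //=; rewrite mulr_gt0// divr_gt0// mulr_gt0// pi_gt0.
pose w := ball_volume R s / 2 ^+ s.
have w0 : 0 < w by rewrite divr_gt0// exprn_gt0.
exists (w / C); first exact: divr_gt0.
move=> b r ba bdb r0 rrho; set A := bdball D b r.
(* Scale [r] is enough, the Hausdorff measure being a supremum over scales; it bounds the diameters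
   by [r], as [graph_cover_sum] asks. *)
apply: (@le_trans _ _ (hausdorff_premeasure s r A)); last by apply: ereal_sup_ubound; exists r.
apply: le_ereal_inf_tmp => _ [F [PF AF] <-].
set W := (\sum_(k <oo) _)%E.
have F0 k : (0 <= oapp (@hausdorff_weight R n s) 0 (F k))%E.
  by have := PF k; case: (F k) => //= S; exact: hausdorff_weight_ge0.
have [->|Woo] := eqVneq W +oo%E; first exact: leey.
have W0 : (0 <= W)%E by exact: nneseries_ge0.
have Wfin : W \is a fin_num by rewrite ge0_fin_numE// ltey.
pose F' k : option ('rV[R]_N * R) :=
  omap (fun B => (realify (xget 0 B), fine (diameter B))) (F k).
rewrite -(fineK Wfin) lee_fin.
suff : r ^+ N.-1 <= C * (fine W / w).
  by rewrite mulrA ler_pdivlMr// mulrAC ler_pdivrMr// [w * _]mulrC [fine W * C]mulrC.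
apply: (HC b r (fine W / w) F') => //.
- apply/(chart_bd ch) => //; apply: lt_trans ba _; lra.
- move=> k; rewrite /F'; have := PF k; case: (F k) => //= S [S0 Sr].
  by have [_ -> ->] := diameter_fineK S0 Sr.
- move=> x Gx xb.
  have xa : `|x - a| < rho by apply: le_lt_trans (ler_distD b _ _) _; lra.
  have bdx : bd D x by exact/(chart_bd ch).
  have [|k _ Fk] := AF (complexify x); first by rewrite /A /bdball /preimage /mkset complexifyK.
  exists k; rewrite /F'; move: Fk; have := PF k; case: (F k) => //= S [S0 Sr] Sx.
  have [dE _ _] := diameter_fineK S0 Sr.
  rewrite -{1}[x]complexifyK; apply: norm_le_diameter Sx (xgetPex _ S0).
  by rewrite -dE.
move=> m; rewrite ler_pdivlMr// -lee_fin fineK// mulr_suml -sumEFin.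
apply: le_trans (nneseries_lim_ge m _); last by move=> k _ _; exact: F0.
rewrite big_mkord; apply: lee_sum => k _; rewrite /F'; have := PF k; case: (F k) => [S|_] /=.
  move=> [S0 Sr]; have [dE _ _] := diameter_fineK S0 Sr.
  by rewrite /hausdorff_weight dE -EFin_expe -EFinM mulrC.
by rewrite mul0r.
Qed.

Lemma boundary_ahlfors (D : set 'rV[R]_N) : (0 < n)%N -> compact (bd D) ->
  (forall a, bd D a -> exists rho G e La, lipschitz_chart D a rho G e La) ->
  exists c r0 : R, [/\ 0 < c, 0 < r0 & forall b r, bd D b -> 0 < r -> r <= r0 ->
    ((c * r ^+ N.-1)%:E <= hausdorff_outer (2 * n - 1) (bdball D b r))%E].
Proof.
move=> n0 cD charts.
pose P (X : set 'rV[R]_N) := exists c r0 : R, [/\ 0 < c, 0 < r0 &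
  forall b r, X b -> bd D b -> 0 < r -> r <= r0 ->
    ((c * r ^+ N.-1)%:E <= hausdorff_outer (2 * n - 1) (bdball D b r))%E].
suff [c [r0 [c0 r00 H]]] : P (bd D) by exists c, r0; split => // b r bb; exact: H.
apply: compact_ideal_ind cD _ _ _ _.
- by exists 1, 1.
- move=> A B [c1 [r1 [c10 r10 H1]]] [c2 [r2 [c20 r20 H2]]].
  exists (Num.min c1 c2), (Num.min r1 r2); rewrite !lt_min c10 c20 r10 r20; split => // b r.
  rewrite le_min => AB bb r0 /andP[rr1 rr2].
  by case: AB => [Ab|Bb]; [apply: le_trans (H1 b r Ab bb r0 rr1)|apply: le_trans (H2 b r Bb bb r0 rr2)];
    rewrite lee_fin ler_wpM2r ?exprn_ge0 ?(ltW r0)// ge_min lexx ?orbT.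
- move=> A B AB [c [r0 [c0 r00 H]]]; exists c, r0; split => // b r /AB; exact: H.
move=> a /charts[rho [G [e [La ch]]]]; have [rho0 _ _ _ _] := ch.
have [c c0 H] := chart_ahlfors n0 ch.
exists [set x | `|x - a| < rho / 2]; first by apply: nbhs_norm_ball; rewrite divr_gt0.
exists c, (rho / 2); split => //; first by rewrite divr_gt0.
Qed.

End ComplexBoundary.

(** * The grid estimate *)

Section Grid.
Variables (R : realType) (n : nat).
Local Notation N := (n + n)%N.
Implicit Types (x y : 'rV[R]_N) (i j b : 'rV[int]_N) (h : R).

Variables (D : set 'rV[R]_N) (M : R).

(** At least M / h + 2, whereas a cube that meets the closure of [D] has indices of size at most M /
    h + 1. *)
Definition grid_radius h : nat := (Num.truncn (M / h)).+3.

Definition grid h : seq 'rV[int]_N := latbox N (grid_radius h).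

Definition boundary_cells h : seq 'rV[int]_N :=
  [seq i <- grid h | `[< cube h i `&` bd D !=set0 >]].

Definition inner_cells h : seq 'rV[int]_N :=
  [seq i <- grid h | `[< cube h i `<=` D >]].

(** Index distance at least 2 is the separation under which a kernel with pole in the cell is
    estimated on boundary cells. The cells left out that meet [D] form a layer of volume O(h). *)
Definition far_cell h i : bool :=
  (i \in inner_cells h) && all (fun b => 1 < latdist b i)%N (boundary_cells h).

Hypothesis n0 : (0 < n)%N.
Hypothesis oD : open D.
Hypothesis M0 : 0 <= M.
Hypothesis DM : forall x, D x -> `|x| <= M.
Variable C : nat.
Hypothesis HC : forall h (s : seq 'rV[int]_N) i0 (r : nat),
  0 < h -> (0 < r)%N -> uniq s -> (forall i, i \in s -> (latdist i i0 <= r)%N) ->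
  (forall i, i \in s -> cube h i `&` bd D !=set0) -> (size s <= C * r ^ N.-1)%N.

Let N0 : (0 < N)%N. Proof. by rewrite addn_gt0 n0. Qed.

Lemma grid_radius_ge h : 0 < h -> M / h + 2 <= (grid_radius h)%:R.
Proof.
move=> h0; rewrite /grid_radius -addn3 natrD.
have := truncnS_gt (M / h); rewrite -natr1; set a := (Num.truncn _)%:R; lra.
Qed.

Lemma grid_radius_le h : 0 < h -> h <= 1 -> h * (grid_radius h + grid_radius h).+1%:R <= 2 * M + 7.
Proof.
move=> h0 h1; have : (grid_radius h)%:R <= M / h + 3.
  rewrite /grid_radius -addn3 natrD lerD2r.
  by rewrite truncn_le// divr_ge0// ltW.
rewrite -[(_ + _).+1]addn1 !natrD; set a := (grid_radius h)%:R => aM.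
have : h * a <= h * (M / h + 3) by rewrite ler_pM2l.
have hM : h * (M / h) = M by rewrite mulrC divfK ?gt_eqF.
by rewrite [h * (_ + 3)]mulrDr hM; lra.
Qed.

Lemma grid_uniq h : uniq (grid h).
Proof. exact: latbox_uniq. Qed.

Lemma mem_grid h i x : 0 < h -> cube h i x -> closure D x -> i \in grid h.
Proof.
move=> h0 ix /(closure_bounded DM) xM; rewrite mem_latbox.
apply/latdist_leP => k; rewrite mxE subr0.
have := ix k; have := le_trans (rV_coord_le_norm x k) xM; rewrite ler_norml.
move=> /andP[xM1 xM2] /andP[ix1 ix2].
have rM := grid_radius_ge h0.
have i1 : (i ord0 k)%:~R <= M / h.
  by rewrite ler_pdivlMr// mulrC; apply: le_trans ix1 xM2.
have i2 : - (M / h) - 1 <= (i ord0 k)%:~R.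
  have : - (M / h) <= (i ord0 k + 1)%:~R.
    by rewrite -mulNr ler_pdivrMr// mulrC; apply: le_trans xM1 ix2.
  by rewrite intrD; lra.
rewrite -(ler_nat R) natr_absz intr_norm ler_norml; apply/andP; split; lra.
Qed.

Lemma boundary_cellsP h b : 0 < h ->
  reflect (cube h b `&` bd D !=set0) (b \in boundary_cells h).
Proof.
move=> h0; rewrite mem_filter; apply: (iffP andP) => [[/asboolP]//|bb].
by split; [exact/asboolP|case: bb => x [bx [clx _]]; exact: mem_grid bx clx].
Qed.

Lemma inner_cellsP h i : 0 < h -> reflect (cube h i `<=` D) (i \in inner_cells h).
Proof.
move=> h0; rewrite mem_filter; apply: (iffP andP) => [[/asboolP]//|iD].
split; first exact/asboolP.
have ii := latpt_cube i (ltW h0).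
exact: mem_grid ii (subset_closure (iD _ ii)).
Qed.

Lemma boundary_cells_uniq h : uniq (boundary_cells h).
Proof. by rewrite filter_uniq// grid_uniq. Qed.

Lemma cell_inner_or_boundary h i x : 0 < h -> cube h i x -> D x ->
  i \notin inner_cells h -> i \in boundary_cells h.
Proof.
move=> h0 ix Dx /(inner_cellsP _ h0) /existsNP[y /not_implyP[iy nDy]].
exact/(boundary_cellsP _ h0)/(cube_meets_bd oD (ltW h0) ix iy Dx nDy).
Qed.

(** Adjacent closed cubes share a vertex, which lies in [D]. *)
Lemma inner_neighbour h i k : 0 < h -> i \in inner_cells h ->
  (i + unitz k \notin inner_cells h -> i + unitz k \in boundary_cells h) /\
  (i - unitz k \notin inner_cells h -> i - unitz k \in boundary_cells h).
Proof.
move=> h0 /(inner_cellsP _ h0) iD.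
have hz (a : int) : h * a%:~R <= h * (a + 1)%:~R by rewrite intrD ler_wpM2l ?(ltW h0)// lerDl.
split.
  apply: (@cell_inner_or_boundary _ _ (latpt h (i + unitz k))) => //.
    exact: latpt_cube (ltW h0).
  apply: iD => l; rewrite /unitz !mxE eqxx /=; case: (eqVneq l k) => _ /=.
    by rewrite lexx hz.
  by rewrite addr0 lexx hz.
apply: (@cell_inner_or_boundary _ _ (latpt h i)) => //; last by apply: iD; exact: latpt_cube (ltW h0).
move=> l; rewrite /unitz !mxE eqxx /=; case: (eqVneq l k) => _ /=.
  by rewrite subrK lexx andbT -{2}[i ord0 l](subrK 1) hz.
by rewrite oppr0 addr0 lexx hz.
Qed.

Lemma boundary_cells_count h i (r : nat) : 0 < h -> (0 < r)%N ->
  (count (fun b => (latdist b i <= r)%N) (boundary_cells h) <= C * r ^ N.-1)%N.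
Proof.
move=> h0 r0; rewrite -size_filter.
apply: HC (h0) r0 (filter_uniq _ (boundary_cells_uniq h)) _ _ => b.
  by rewrite mem_filter => /andP[bi _]; exact: bi.
by rewrite mem_filter => /andP[_ /boundary_cellsP]; exact.
Qed.

Lemma size_boundary_cells h : 0 < h -> (size (boundary_cells h) <= C * grid_radius h ^ N.-1)%N.
Proof.
move=> h0; apply: leq_trans (boundary_cells_count 0 h0 (ltn0Sn _)).
rewrite leq_eqVlt eq_sym -all_count; apply/orP; left; apply/allP => b; rewrite mem_filter mem_latbox.
by case/andP.
Qed.

Lemma far_cell_near h i x : 0 < h -> cube h i x -> D x -> ~~ far_cell h i ->
  exists2 b, b \in boundary_cells h & (latdist i b <= 1)%N.
Proof.
move=> h0 ix Dx; rewrite negb_and => /orP[iI|].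
  by exists i; rewrite ?latdistxx//; exact: cell_inner_or_boundary ix Dx iI.
by rewrite -has_predC => /hasP[b bS /=]; rewrite -leqNgt latdistC => bi; exists b.
Qed.

Lemma count_near_boundary h :
  (count (fun i => has (fun b => latdist i b <= 1)%N (boundary_cells h)) (grid h) <=
   size (boundary_cells h) * 3 ^ N)%N.
Proof.
elim: (boundary_cells h) => [|b s IH] /=; first by rewrite count_pred0.
rewrite mulSn; apply: leq_trans (leq_add _ IH); last first.
  have := @latbox_count N [seq i <- grid h | latdist i b <= 1]%N b 1%N.
  by rewrite size_filter; apply; [rewrite filter_uniq// grid_uniq|move=> j; rewrite mem_filter => /andP[]].
by rewrite -count_predUI leq_addr.
Qed.

Variables (p q : R).
Hypotheses (p1 : 1 <= p) (q1 : 1 <= q) (pq : q * N.-1%:R < N%:R * p).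

Lemma grid_sum_bound (C0 : R) : 0 <= C0 ->
  exists2 K : R, 0 <= K & forall h (F f : 'rV[int]_N -> R),
    0 < h -> h <= 1 -> (forall b, 0 <= F b) -> (forall i, 0 <= f i) ->
    (forall i, far_cell h i -> f i <= C0 *
       \sum_(b <- boundary_cells h) F b / (latdist b i)%:R ^+ N.-1) ->
    h ^+ N * \sum_(i <- grid h | far_cell h i) f i `^ q <=
      K * (h ^+ N.-1 * \sum_(b <- boundary_cells h) F b `^ p) `^ (q / p).
Proof.
(* The width of the grid: 2 (M / h + 3) + 1 cells of side h <= 1. *)
move=> C00; set r := 2 * M + 7.
have r7 : 7 <= r by rewrite /r lerDr mulr_ge0.
have r0 : 0 < r by apply: lt_le_trans r7.
have D0 : (0 < N.-1)%N by rewrite -ltnS prednK//; lia.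
have NE : N.-1.+1 = N by rewrite prednK.
have [|||K K0 HK] := @fractional_sum_bound R p q (C%:R + 3 ^+ N) C0 r (r ^+ N) N.-1 D0 p1 q1 _ _ C00 r0.
- by rewrite NE.
- by rewrite addr_ge0// exprn_ge0.
- by rewrite exprn_ge0// ltW.
exists K => // h F f h0 h1 F0 f0 fF.
(* Distances forced into [h, r]. On far cells the lower cut is idle, and the cut at [r] only
   enlarges h / d. *)
pose d i b := Num.min r (h * (maxn 1 (latdist b i))%:R).
pose f' i := if far_cell h i then f i else 0.
have hr : h <= r by apply: le_trans h1 (le_trans _ r7); rewrite ler1n.
have hd i b : h <= d i b <= r.
  by rewrite /d le_min hr ge_min lexx andbT ler_peMr ?(ltW h0)// ler1n leq_maxl.
have dist_le i b (x : R) : h <= x -> x < r -> d i b <= x -> (latdist b i <= Num.truncn (x / h))%N.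
  move=> hx xr; rewrite /d ge_min leNgt xr /= mulrC -ler_pdivlMr// => dx.
  rewrite truncn_ge_nat ?divr_ge0 ?(le_trans (ltW h0) hx) ?(ltW h0)//.
  by apply: le_trans dx; rewrite ler_nat leq_maxr.
have trunc_gt0 (x : R) : h <= x -> (0 < Num.truncn (x / h))%N.
  by move=> hx; rewrite truncn_gt0 ler_pdivlMr// mul1r.
have trunc_le (x : R) : h <= x -> (Num.truncn (x / h))%:R <= x / h.
  by move=> hx; rewrite truncn_le// divr_ge0// ?(ltW h0)// (le_trans (ltW h0) hx).
have xh0 (x : R) : h <= x -> 0 <= x / h.
  by move=> hx; rewrite divr_ge0// ?(ltW h0)// (le_trans (ltW h0) hx).
have C3 (a : R) : 0 <= a -> C%:R * a <= (C%:R + 3 ^+ N) * a /\ 3 ^+ N * a <= (C%:R + 3 ^+ N) * a.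
  by move=> a0; split; rewrite ler_wpM2r// ?lerDl ?lerDr// exprn_ge0.
have gr := grid_radius_le h0 h1.
have grx (x : R) : r <= x -> (grid_radius h + grid_radius h).+1%:R <= x / h.
  by move=> rx; rewrite ler_pdivlMr// mulrC; exact: le_trans gr rx.
have -> : \sum_(i <- grid h | far_cell h i) f i `^ q = \sum_(i <- grid h) f' i `^ q.
  rewrite big_mkcond; apply: eq_bigr => i _; rewrite /f'; case: ifP => // _.
  by rewrite powR0// gt_eqF// (lt_le_trans _ q1).
have := HK h _ _ (grid h) (boundary_cells h) d F f' h0 hr hd _ _ _ F0 _; rewrite NE.
apply.
(* Below [r] the count is local; from [r] on, x / h exceeds the width of the grid and all boundary
   cells are counted. *)
- move=> i x hx; have [xr|rx] := ltP x r.
    apply: le_trans (_ : C%:R * (x / h) ^+ N.-1 <= _); last by have [] := C3 _ (exprn_ge0 N.-1 (xh0 _ hx)).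
    apply: (@le_trans _ _ (C * Num.truncn (x / h) ^ N.-1)%:R).
      rewrite ler_nat; apply: leq_trans (boundary_cells_count i h0 (trunc_gt0 _ hx)).
      by apply: sub_count => b; exact: dist_le.
    by rewrite natrM ler_wpM2l// natrX lerXn2r ?nnegrE ?xh0// trunc_le.
  apply: le_trans (_ : C%:R * (x / h) ^+ N.-1 <= _); last by have [] := C3 _ (exprn_ge0 N.-1 (xh0 _ hx)).
  apply: (@le_trans _ _ (C * grid_radius h ^ N.-1)%:R).
    by rewrite ler_nat; apply: leq_trans (count_size _ _) (size_boundary_cells h0).
  rewrite natrM ler_wpM2l// natrX lerXn2r ?nnegrE ?xh0//.
  by apply: le_trans (grx _ rx); rewrite ler_nat leqW// leq_addr.
- move=> b x hx; have [xr|rx] := ltP x r.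
    apply: le_trans (_ : 3 ^+ N * (x / h) ^+ N <= _); last by have [] := C3 _ (exprn_ge0 N (xh0 _ hx)).
    set t := Num.truncn (x / h).
    apply: (@le_trans _ _ ((t + t).+1 ^ N)%:R).
      rewrite ler_nat -size_filter; apply: (@latbox_count N _ b).
        by rewrite filter_uniq// grid_uniq.
      by move=> i; rewrite mem_filter => /andP[+ _]; rewrite latdistC; exact: dist_le.
    have x3 : 0 <= 3 * (x / h) by apply: mulr_ge0; rewrite ?xh0.
    rewrite -exprMn natrX lerXn2r ?nnegrE//.
    apply: (@le_trans _ _ (3 * t%:R)); last by rewrite ler_pM2l// trunc_le.
    have tt : ((t + t).+1 <= 3 * t)%N by move: (trunc_gt0 _ hx); rewrite -/t; clearbody t; clear; lia.
    by have := tt; rewrite -(ler_nat R) natrM.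
  apply: le_trans (_ : 1 * (x / h) ^+ N <= _); last first.
    rewrite ler_wpM2r ?exprn_ge0 ?xh0//; apply: ler_wpDl => //.
    by rewrite exprn_ege1// ler1n.
  rewrite mul1r; apply: (@le_trans _ _ (size (grid h))%:R); first by rewrite ler_nat count_size.
  by rewrite size_latbox natrX lerXn2r ?nnegrE ?xh0// grx.
- by rewrite size_latbox natrX -exprMn lerXn2r ?nnegrE ?mulr_ge0 ?(ltW h0) ?(ltW r0).
move=> i; rewrite /f'; have S0 : 0 <= \sum_(j <- boundary_cells h) F j * (h / d i j) ^+ N.-1.
  apply: sumr_ge0 => b _; rewrite mulr_ge0// exprn_ge0// divr_ge0 ?(ltW h0)//.
  by have /andP[/(le_trans (ltW h0))] := hd i b.
case: ifPn => [gi|_]; last by rewrite lexx mulr_ge0.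
rewrite f0 /=; apply: le_trans (fF _ gi) _; rewrite ler_wpM2l// big_seq [leRHS]big_seq.
apply: ler_sum => b bS; rewrite ler_wpM2l// -exprVn.
have bi : (1 < latdist b i)%N by have /andP[_ /allP /(_ _ bS)] := gi.
have d0 : 0 < d i b by have /andP[/(lt_le_trans h0)] := hd i b.
have bi0 : 0 < (latdist b i)%:R :> R by rewrite ltr0n ltnW.
rewrite lerXn2r ?nnegrE ?invr_ge0 ?divr_ge0 ?(ltW h0) ?(ltW d0)//.
rewrite ler_pdivlMr// mulrC ler_pdivrMr//.
by rewrite /d ge_min (maxn_idPr (ltnW bi)) lexx orbT.
Qed.

End Grid.

(** * Uniform continuity of the modulus up to the boundary *)

Section UniformContinuity.
Variables (R : realType) (n : nat).
Local Notation N := (n + n)%N.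
Variables (Omega : set 'rV[R[i]]_n) (f : 'rV[R[i]]_n -> R[i]) (M : R).
Local Notation D := (@complexify R n @^-1` Omega).

Definition modulus (x : 'rV[R]_N) : R := Normc.normc (f (complexify x)).

Lemma normc_ge0 (c : R[i]) : 0 <= Normc.normc c.
Proof. by case: c => a b; exact: sqrtr_ge0. Qed.

Lemma modulus_ge0 x : 0 <= modulus x.
Proof. exact: normc_ge0. Qed.

Hypothesis DM : forall x, D x -> `|x| <= M.
Hypothesis cf : {within closure Omega, continuous f}.

Lemma dist_normc_le (a b : R[i]) : `|Normc.normc a - Normc.normc b| <= Normc.normc (a - b).
Proof.
have tri (x y : R[i]) : Normc.normc x <= Normc.normc (x - y) + Normc.normc y.
  by rewrite -lecR rmorphD -!normc_normE -{1}(subrK y x) ler_normD.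
have symm : Normc.normc (b - a) = Normc.normc (a - b).
  by have := distrC b a; rewrite !normc_normE => /(congr1 (@complex.Re R)).
rewrite ler_norml; have := tri a b; have := tri b a; rewrite symm; lra.
Qed.

Lemma modulus_continuous a (e : R) : closure D a -> 0 < e ->
  exists2 d : R, 0 < d & forall x, closure D x -> `|x - a| < d ->
    `|modulus x - modulus a| <= e.
Proof.
move=> /closure_complexify cla e0.
have := (subspace_continuousP _ _).1 cf _ cla.
move=> /cvgrPdist_lt /(_ e%:C); rewrite ltcR => /(_ e0).
rewrite near_withinE => /nbhs_complexify/near_norm[d d0 H]; exists d => // x clx xa.
have := H x xa ((closure_complexify _ _).1 clx).
rewrite normc_normE ltcR => /ltW; apply: le_trans.
by rewrite distrC; exact: dist_normc_le.
Qed.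

Lemma modulus_bounded : exists2 C : R, 0 <= C & forall x, closure D x -> modulus x <= C.
Proof.
pose P (X : set 'rV[R]_N) := exists2 C : R, 0 <= C & forall x, closure D x -> X x -> modulus x <= C.
suff [C C0 HC] : P (closure D) by exists C => // x Dx; exact: HC.
apply: compact_ideal_ind (compact_closure_bounded DM) _ _ _ _.
- by exists 0.
- move=> A B [C1 C10 H1] [C2 C20 H2]; exists (C1 + C2); first exact: addr_ge0.
  by move=> x Dx [/(H1 x Dx)|/(H2 x Dx)]; lra.
- by move=> A B AB [C C0 H]; exists C => // x Dx /AB; exact: H.
move=> a cla; have [d d0 H] := modulus_continuous cla (ltr01 : (0 : R) < 1).
exists [set x | `|x - a| < d]; first exact: nbhs_norm_ball.
exists (modulus a + 1); first by rewrite addr_ge0// modulus_ge0.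
by move=> x clx /(H x clx); rewrite ler_norml; lra.
Qed.

Lemma modulus_uniform (e : R) : 0 < e ->
  exists2 d : R, 0 < d & forall x y, closure D x -> closure D y -> `|x - y| < d ->
    `|modulus x - modulus y| <= e.
Proof.
move=> e0.
(* Only [x] is confined to [X]: with both points confined, a pair split between two pieces would
   escape the union step. *)
pose P (X : set 'rV[R]_N) := exists2 d : R, 0 < d & forall x y, X x -> closure D x -> closure D y ->
  `|x - y| < d -> `|modulus x - modulus y| <= e.
suff [d d0 H] : P (closure D) by exists d => // x y Dx; exact: H.
apply: compact_ideal_ind (compact_closure_bounded DM) _ _ _ _.
- by exists 1.
- move=> A B [d1 d10 H1] [d2 d20 H2]; exists (Num.min d1 d2); first by rewrite lt_min d10.
  by move=> x y [Ax|Bx] Dx Dy; rewrite lt_min => /andP[xy1 xy2]; [exact: H1|exact: H2].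
- by move=> A B AB [d d0 H]; exists d => // x y /AB; exact: H.
move=> a cla; have e20 : 0 < e / 2 by rewrite divr_gt0.
have [d d0 H] := modulus_continuous cla e20.
have d20 : 0 < d / 2 by rewrite divr_gt0.
exists [set x | `|x - a| < d / 2]; first exact: nbhs_norm_ball.
exists (d / 2) => // x y /= xa clx cly xy.
have ya : `|y - a| < d.
  by apply: le_lt_trans (ler_distD x _ _) _; rewrite distrC; lra.
have := H x clx (lt_trans xa _); have := H y cly ya; rewrite !ler_norml => Hy Hx.
by have := Hx ltac:(lra); lra.
Qed.

End UniformContinuity.

(** * From cell sums to integrals *)

Section InteriorEstimate.
Variables (R : realType) (n : nat).
Local Notation N := (n + n)%N.
Variables (Omega : set 'rV[R[i]]_n) (M : R).
Local Notation D := (@complexify R n @^-1` Omega).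
Hypothesis n0 : (0 < n)%N.
Hypothesis oO : open Omega.
Hypothesis M0 : 0 <= M.
Hypothesis DM : forall x, D x -> `|x| <= M.

Lemma far_cell_estimate : exists2 C0 : R, 0 <= C0 & forall f K h F i,
  holomorphic_on Omega f -> (forall x, D x -> modulus f x <= K) -> 0 < h ->
  (forall b, 0 <= F b) ->
  (forall b x, b \in boundary_cells D M h -> cube h b x -> D x -> modulus f x <= F b) ->
  far_cell D M h i ->
  modulus f (latpt h i) <= C0 *
    \sum_(b <- boundary_cells D M h) F b / (latdist b i)%:R ^+ N.-1.
Proof.
have oD : open D by exact: open_complexify.
pose w : R := n%:R * (N%:R + 1) ^- n.+1.
have w0 : 0 < w by rewrite divr_gt0 ?ltr0n// exprn_gt0// ltr_wpDl.
exists (N%:R * (2 * 2 ^+ N) / w).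
  by rewrite divr_ge0 ?(ltW w0)// mulr_ge0// mulr_ge0// exprn_ge0.
move=> f K h F i holf fK h0 F0 FS /andP[iI /allP ifar].
set z := latpt h i.
have iD := inner_cellsP DM i h0 iI.
have Dz : D z by apply: iD; exact: latpt_cube (ltW h0).
have K0 : 0 <= K by exact: le_trans (modulus_ge0 f z) (fK z Dz).
set sumb := \sum_(b <- _) _.
have sumb0 : 0 <= sumb by apply: sumr_ge0 => b _; rewrite divr_ge0// exprn_ge0.
have [fz0|fz0] := eqVneq (f (complexify z)) 0.
  rewrite /modulus fz0 Normc.normc0; apply: mulr_ge0 sumb0.
  by rewrite divr_ge0 ?(ltW w0)// mulr_ge0// mulr_ge0// exprn_ge0.
(* Of modulus 1 with th f(z) = |f z|, so the estimate of a real part at z becomes one of |f z|,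
   while |u| and |v| stay below |f|. *)
pose th := (modulus f z)%:C / f (complexify z).
have mz0 : modulus f z != 0 by apply: contra_neq fz0; exact: Normc.eq0_normc.
have thE : th * f (complexify z) = (modulus f z)%:C by rewrite divfK.
have th1 : Normc.normc th = 1.
  apply: (mulIf mz0); rewrite /modulus -Normc.normcM thE mul1r.
  by rewrite /= expr0n addr0 sqrtr_sqr ger0_norm ?modulus_ge0.
pose u x := complex.Re (th * f (complexify x)).
pose v x := complex.Im (th * f (complexify x)).
have thf x : Normc.normc (th * f (complexify x)) = modulus f x by rewrite Normc.normcM th1 mul1r.
have uK x : `|u x| <= modulus f x by rewrite -thf; exact: Re_le_normc.
have vK x : `|v x| <= modulus f x by rewrite -thf; exact: Im_le_normc.
have CR y : D y -> cauchy_riemann_at u v y.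
  by move=> Dy; apply: differentiable_cauchy_riemann; [rewrite th1|exact: holf].
have := @cauchy_estimate_re R n D u v K n0 CR K0 _ h (inner_cells D M h) (boundary_cells D M h) i F
  h0 _ _ iI _ F0 _ _ _.
have -> : u (latpt h i) = modulus f z by rewrite /u -/z thE.
have -> : \sum_(b <- boundary_cells D M h) 2 ^+ N * F b / (latdist b i)%:R ^+ N.-1 = 2 ^+ N * sumb.
  by rewrite mulr_sumr; apply: eq_bigr => b _; rewrite mulrA.
move=> H; rewrite mulrAC ler_pdivlMr// mulrC.
have -> : N%:R * (2 * 2 ^+ N) * sumb = N%:R * (2 * (2 ^+ N * sumb)) by rewrite !mulrA.
apply: H.
- by move=> y Dy; exact: le_trans (uK y) (fK y Dy).
- by rewrite filter_uniq// grid_uniq.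
- by move=> j /(inner_cellsP DM _ h0).
- exact: boundary_cells_uniq.
- by move=> j k jI; exact: inner_neighbour.
- exact: ifar.
by move=> b x bS bx Dx; split; [apply: le_trans (uK x) _|apply: le_trans (vK x) _]; exact: FS bS bx Dx.
Qed.

Lemma volume_integral_le (h : R) (g : 'rV[R]_N -> R) (c : 'rV[int]_N -> R) : 0 < h ->
  (forall x, 0 <= g x) -> (forall i, 0 <= c i) ->
  (forall i x, i \in grid n M h -> cube h i x -> D x -> g x <= c i) ->
  (\int[@lebesgue_measureC R n]_(z in Omega) (g (realify z))%:E <=
     (h ^+ N * \sum_(i <- grid n M h) c i)%:E)%E.
Proof.
move=> h0 g0 c0 gc.
pose bx i : 'rV[R]_N * 'rV[R]_N := (latpt h i, latpt h (i + const_mx 1)).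
have bxE i k : (bx i).2 ord0 k - (bx i).1 ord0 k = h.
  by rewrite !mxE intrD mulrDr mulr1 addrAC subrr add0r.
have := @integral_le_step _ _ _ (@lebesgue_measureC R n) _ (grid n M h) c (fun i => box (bx i))
  Omega (fun z => g (realify z)) c0 (fun i => lebesgue_box_measurable (bx i)).
move=> /(_ _) H; apply: le_trans (H _) _.
  move=> z Oz; rewrite g0 /=.
  have Dz : D (realify z) by rewrite /= realifyK.
  (* Ceiling minus 1 rather than floor: the boxes are open on the left. *)
  pose i : 'rV[int]_N := \row_k (Num.ceil (realify z ord0 k / h) - 1).
  have iz k : h * (i ord0 k)%:~R < realify z ord0 k <= h * (i ord0 k + 1)%:~R.
    rewrite !mxE subrK; apply/andP; split; rewrite mulrC.
      by rewrite -ltr_pdivlMr// ceilB1_lt.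
    by rewrite -ler_pdivrMr// ceil_ge.
  have iz' : cube h i (realify z) by move=> k; have /andP[/ltW -> ->] := iz k.
  have ig : i \in grid n M h by exact: mem_grid DM _ _ _ h0 iz' (subset_closure Dz).
  rewrite (bigD1_seq i)//= ?grid_uniq//; apply: ler_wpDr.
    by apply: sumr_ge0 => j _; rewrite mulr_ge0.
  rewrite indicE mem_set ?mulr1; first exact: gc ig iz' Dz.
  by move=> k; have := iz k; rewrite !mxE.
rewrite mulr_sumr -sumEFin; apply: lee_sum => i _.
rewrite [(h ^+ N * c i)%R]mulrC EFinM; apply: lee_pmul => //; first by rewrite lee_fin.
apply: le_trans (lebesgue_box_le _) _.
  by move=> k; rewrite -subr_ge0 bxE ltW.
rewrite /box_volume lee_fin; under eq_bigr do rewrite bxE.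
by rewrite prodr_const card_ord.
Qed.

(** On the part of the boundary within h of [xb b], g is at least g (xb b) - eta, and that part has
    measure at least c h^(N - 1). A point lies in such parts only for cells [b] at index distance at
    most 2 from its own, so in at most 5^N of them. *)
Lemma boundary_integral_ge (s : nat) (h c eta p : R) (g : 'rV[R]_N -> R) (xb : 'rV[int]_N -> 'rV[R]_N) :
  0 < h -> 0 <= c -> 0 <= p -> (forall x, 0 <= g x) ->
  (forall x y, bd D x -> bd D y -> `|x - y| <= h -> g x <= g y + eta) ->
  (forall b, b \in boundary_cells D M h -> cube h b (xb b) /\ bd D (xb b)) ->
  (forall b, bd D b -> ((c * h ^+ N.-1)%:E <= hausdorff_outer s (bdball D b h))%E) ->
  ((c / 5 ^+ N * (h ^+ N.-1 * \sum_(b <- boundary_cells D M h) (Num.max 0 (g (xb b) - eta)) `^ p))%:E <=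
   \int[@hausdorff_measure R n s]_(z in topological_boundary Omega) (g (realify z) `^ p)%:E)%E.
Proof.
move=> h0 c0 p0 g0 geta xbP Hc.
have oD : open D by exact: open_complexify.
pose m b := (Num.max 0 (g (xb b) - eta)) `^ p.
have m0 b : 0 <= m b / 5 ^+ N by rewrite divr_ge0 ?powR_ge0// exprn_ge0.
have := @step_le_integral _ _ _ (@hausdorff_measure R n s) _ (boundary_cells D M h)
  (fun b => m b / 5 ^+ N) (fun b => bdball D (xb b) h)
  (topological_boundary Omega) (fun z => g (realify z) `^ p) m0 _ _ _ => H.
apply: le_trans (H _ _ _) => {H}.
- rewrite mulr_sumr mulr_sumr -sumEFin big_seq [leRHS]big_seq; apply: lee_sum => b bS.
  have [_ bxb] := xbP b bS; have := Hc _ bxb => Hb.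
  have -> : (c / 5 ^+ N * (h ^+ N.-1 * m b))%R = (m b / 5 ^+ N * (c * h ^+ N.-1))%R by ring.
  by rewrite EFinM; apply: lee_pmul => //; rewrite lee_fin// mulr_ge0// exprn_ge0// ltW.
- move=> b; apply: hausdorff_closed_measurable; apply: closedI; last exact: closed_norm_ball.
  exact: closed_bd.
- by move=> b z [bz _]; apply/boundary_complexify.
move=> z /(boundary_complexify _ oO) bz; set x := realify z in bz *.
pose near b := (latdist b (cell h x) <= 2)%N.
apply: (@le_trans _ _ (\sum_(b <- boundary_cells D M h) (g x `^ p / 5 ^+ N * (near b)%:R))).
  rewrite big_seq [leRHS]big_seq; apply: ler_sum => b bS; have [bxb bdb] := xbP b bS.
  rewrite indicE; have [zb|] := boolP (z \in _); last first.
    by rewrite mulr0 mulr_ge0// divr_ge0 ?powR_ge0// exprn_ge0.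
  have [_ /= xxb] := set_mem zb; rewrite -/x in xxb.
  have -> : near b.
    apply: (@cube_latdist_le _ _ h _ _ (xb b) x 1) => //; first exact: cube_cell.
    by rewrite mulr1 distrC.
  rewrite !mulr1 ler_wpM2r ?invr_ge0 ?exprn_ge0// ler_powRl ?le_max ?lexx//.
  by rewrite ge_max g0 /= lerBlDr; apply: geta; rewrite // distrC.
have sum_near (s' : seq 'rV[int]_N) : \sum_(b <- s') (near b)%:R = (count near s')%:R :> R.
  by elim: s' => [|b s' IH]; rewrite ?big_nil// big_cons IH -natrD.
rewrite -mulr_sumr sum_near mulrAC ler_pdivrMr ?exprn_gt0// ler_wpM2l ?powR_ge0//.
rewrite -natrX ler_nat -size_filter.
apply: (@latbox_count N _ (cell h x) 2); first by rewrite filter_uniq// boundary_cells_uniq.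
by move=> b; rewrite mem_filter => /andP[].
Qed.

End InteriorEstimate.

(** * Passage to the limit *)

Section Embedding.
Variables (R : realType).

Lemma powRD_le (s a b : R) : 0 <= s -> 0 <= a -> 0 <= b ->
  (a + b) `^ s <= 2 `^ s * (a `^ s + b `^ s).
Proof.
move=> s0 a0 b0; wlog ab : a b a0 b0 / a <= b.
  move=> H; have [/H|/ltW /H] := leP a b; first exact.
  by rewrite addrC [b `^ s + _]addrC; exact.
apply: (@le_trans _ _ ((2 * b) `^ s)).
  by apply: ler_powRl => //; [exact: addr_ge0|rewrite mulr_natl mulr2n lerD2r].
by rewrite powRM// ler_wpM2l ?powR_ge0// lerDr powR_ge0.
Qed.

Variables (n : nat) (Omega : set 'rV[R[i]]_n) (p q : R).
Local Notation N := (n + n)%N.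
Local Notation D := (@complexify R n @^-1` Omega).
Hypothesis n0 : (0 < n)%N.
Hypothesis oO : open Omega.
Hypothesis bO : bounded_set Omega.
Hypothesis lO : lipschitz_boundary Omega.
Hypotheses (p1 : 1 <= p) (q1 : 1 <= q) (pq : q * (2 * n%:R - 1) < 2 * n%:R * p).

Let p0 : 0 < p. Proof. exact: lt_le_trans p1. Qed.
Let q0 : 0 < q. Proof. exact: lt_le_trans q1. Qed.
Let qp0 : 0 <= q / p. Proof. by rewrite divr_ge0// ltW. Qed.

Local Notation bd_integral f :=
  (\int[@hausdorff_measure R n (2 * n - 1)]_(z in topological_boundary Omega)
     (Normc.normc (f z) `^ p)%:E)%E.
Local Notation integral f :=
  (\int[@lebesgue_measureC R n]_(z in Omega) (Normc.normc (f z) `^ q)%:E)%E.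

(** [A1] and [A2] are fixed before [f], while [A3] depends on sup |f| and [h0] on the modulus of
    continuity: [eta] is to be chosen first, then [h] tends to 0. *)
Lemma grid_integral_bound : exists A1 A2 : R, [/\ 0 <= A1, 0 <= A2 &
  forall f, holomorphic_on Omega f -> {within closure Omega, continuous f} ->
  forall Jr, bd_integral f = Jr%:E -> exists2 A3 : R, 0 <= A3 &
  forall eta, 0 < eta -> exists2 h0 : R, 0 < h0 &
  forall h, 0 < h -> h <= h0 ->
  (integral f <= (A1 * Jr `^ (q / p) + A2 * eta `^ q + A3 * h)%:E)%E].
Proof.
have N0 : (0 < N)%N by rewrite addn_gt0 n0.
have pqN : q * N.-1%:R < N%:R * p.
  have -> : N%:R = 2 * n%:R :> R by rewrite natrD mulr_natl mulr2n.
  have -> : N.-1%:R = 2 * n%:R - 1 :> R; last exact: pq.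
  by rewrite -subn1 natrB// natrD mulr_natl mulr2n.
have [M M0 DM] := bounded_complexify bO.
have oD : open D by exact: open_complexify.
have charts := lipschitz_boundary_chart oO lO.
have [C HC] := boundary_cell_count N0 oD DM charts.
have [c [r0 [c0 r00 Hc]]] := boundary_ahlfors n0 (compact_bd oD DM) charts.
have [C0 C00 HC0] := far_cell_estimate n0 oO DM.
have [K K0 HK] := grid_sum_bound n0 (ltW M0) DM HC p1 q1 pqN C00.
pose r := 2 * M + 7; have r_ge0 : 0 <= r by rewrite /r; lra.
pose Cr := C%:R * r ^+ N.-1; have Cr0 : 0 <= Cr by rewrite mulr_ge0// exprn_ge0.
pose B := (2 `^ p) `^ (q / p) * 2 `^ (q / p).
have B0 : 0 <= B by rewrite mulr_ge0 ?powR_ge0.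
pose B1 := B * (5 ^+ N / c) `^ (q / p).
pose B2 := B * (Cr `^ (q / p) * 2 `^ q).
have c5 : 0 <= 5 ^+ N / c by rewrite divr_ge0 ?exprn_ge0// ltW.
have B10 : 0 <= B1 by apply: mulr_ge0 => //; exact: powR_ge0.
have B20 : 0 <= B2 by rewrite /B2 mulr_ge0// mulr_ge0 ?powR_ge0.
exists (2 `^ q * (K * B1)), (2 `^ q * (K * B2 + r ^+ N)); split.
- by rewrite mulr_ge0 ?powR_ge0// mulr_ge0.
- by rewrite mulr_ge0 ?powR_ge0// addr_ge0 ?exprn_ge0// mulr_ge0.
move=> f holf cf Jr JE.
have [Mg Mg0 HMg] := modulus_bounded DM cf.
pose g := modulus f; have g0 x : 0 <= g x by exact: modulus_ge0.
have J0 : 0 <= Jr by rewrite -lee_fin -JE; apply: integral_ge0 => z _; rewrite lee_fin powR_ge0.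
exists (3 ^+ N * Cr * Mg `^ q).
  by rewrite mulr_ge0 ?powR_ge0// mulr_ge0// exprn_ge0.
move=> eta eta0; have [d d0 Hd] := modulus_uniform DM cf eta0.
exists (Num.min (Num.min 1 r0) (d / 2)); first by rewrite !lt_min ltr01 r00 divr_gt0.
move=> h h0; rewrite !le_min => /andP[/andP[h1 hr0] hd].
have gxy x y : closure D x -> closure D y -> `|x - y| <= h -> g x <= g y + eta.
  move=> Dx Dy xy; have : `|g x - g y| <= eta by apply: Hd => //; lra.
  by rewrite ler_norml; lra.
have gr := grid_radius_le (ltW M0) h0 h1.
have S_le : h ^+ N.-1 * (size (boundary_cells D M h))%:R <= Cr.
  apply: (@le_trans _ _ (h ^+ N.-1 * (C * grid_radius M h ^ N.-1)%:R)).
    by rewrite ler_wpM2l ?exprn_ge0 ?(ltW h0)// ler_nat; apply: size_boundary_cells.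
  rewrite natrM mulrCA ler_wpM2l// natrX -exprMn lerXn2r ?nnegrE ?mulr_ge0 ?(ltW h0)//.
  by apply: le_trans gr; rewrite ler_wpM2l ?(ltW h0)// ler_nat leqW// leq_addr.
have X_le : h ^+ N * (size (grid n M h))%:R <= r ^+ N.
  by rewrite size_latbox natrX -exprMn lerXn2r ?nnegrE ?mulr_ge0 ?(ltW h0).
have /choice[xb xbP] : forall b, exists x, b \in boundary_cells D M h -> cube h b x /\ bd D x.
  move=> b; have [bS|bS] := boolP (b \in boundary_cells D M h); last by exists 0.
  by have [x [bx bdx]] := boundary_cellsP DM b h0 bS; exists x.
(* The value at one boundary point of the cell plus the oscillation [eta], in place of a supremum
   over the cell. *)
pose F b := g (xb b) + eta.
have F0 b : 0 <= F b by rewrite addr_ge0// ltW.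
have FS b x : b \in boundary_cells D M h -> cube h b x -> D x -> g x <= F b.
  move=> bS bx Dx; have [bxb [clb _]] := xbP b bS.
  by apply: gxy => //; [exact: subset_closure|exact: cube_norm_le (ltW h0) bx bxb].
have gMg x : D x -> g x <= Mg by move=> Dx; apply: HMg; exact: subset_closure.
have sum_far := HK h F (fun i => g (latpt h i)) h0 h1 F0 (fun i => g0 _)
  (fun i => HC0 f Mg h F i holf gMg h0 F0 FS).
set T := h ^+ N.-1 * \sum_(b <- _) F b `^ p in sum_far.
pose m := \sum_(b <- boundary_cells D M h) (Num.max 0 (g (xb b) - eta)) `^ p.
have m_le : h ^+ N.-1 * m <= 5 ^+ N / c * Jr.
  have := @boundary_integral_ge R n Omega M oO (2 * n - 1) h c eta p g xb h0 (ltW c0)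
    (ltW p0) g0 _ xbP (fun b bb => Hc b h bb h0 hr0).
  have -> : (\int[@hausdorff_measure R n (2 * n - 1)]_(z in topological_boundary Omega)
      (g (realify z) `^ p)%:E)%E = Jr%:E.
    by rewrite -JE; apply: eq_integral => z _; rewrite /g /modulus realifyK.
  rewrite lee_fin -/m => H.
  have {}H := H (fun x y bx bY => gxy x y bx.1 bY.1).
  by rewrite -[5 ^+ N / c]invf_div ler_pdivlMl ?divr_gt0 ?exprn_gt0.
(* [F b] exceeds the truncated value in the boundary sum by at most 2 eta, on O(h^(1 - N)) cells. *)
have T_le : T <= 2 `^ p * (5 ^+ N / c * Jr + (2 * eta) `^ p * Cr).
  apply: (@le_trans _ _ (h ^+ N.-1 *
      (2 `^ p * (m + (size (boundary_cells D M h))%:R * (2 * eta) `^ p)))).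
    rewrite ler_wpM2l ?exprn_ge0 ?(ltW h0)//.
    have -> : (size (boundary_cells D M h))%:R * (2 * eta) `^ p =
        \sum_(b <- boundary_cells D M h) (2 * eta) `^ p.
      by rewrite big_const_seq count_predT iter_addr_0 mulr_natl.
    rewrite -big_split mulr_sumr /=; apply: ler_sum => b _.
    apply: le_trans (powRD_le (ltW p0) _ _); rewrite ?le_max ?lexx ?mulr_ge0 ?(ltW eta0)//.
    apply: ler_powRl; rewrite ?(ltW p0)//.
    have : g (xb b) - eta <= Num.max 0 (g (xb b) - eta) by rewrite le_max lexx orbT.
    by rewrite /F; lra.
  rewrite mulrCA ler_wpM2l ?powR_ge0// mulrDr; apply: lerD => //.
  by rewrite mulrA mulrC ler_wpM2l ?powR_ge0.
have T0 : 0 <= T.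
  by rewrite mulr_ge0 ?exprn_ge0 ?(ltW h0)// sumr_ge0// => b _; rewrite powR_ge0.
have eta2 : 0 <= 2 * eta by rewrite mulr_ge0// ltW.
have cJ : 0 <= 5 ^+ N / c * Jr by rewrite mulr_ge0.
have eC : 0 <= (2 * eta) `^ p * Cr by rewrite mulr_ge0 ?powR_ge0.
have Tqp : T `^ (q / p) <= B1 * Jr `^ (q / p) + B2 * eta `^ q.
  apply: le_trans (ler_powRl qp0 T0 T_le) _.
  rewrite powRM ?powR_ge0 ?addr_ge0//.
  apply: (@le_trans _ _ (B * ((5 ^+ N / c * Jr) `^ (q / p) + ((2 * eta) `^ p * Cr) `^ (q / p)))).
    by rewrite /B -[leRHS]mulrA; apply: ler_wpM2l; [exact: powR_ge0|exact: powRD_le].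
  have -> : ((2 * eta) `^ p * Cr) `^ (q / p) = Cr `^ (q / p) * 2 `^ q * eta `^ q.
    rewrite powRM ?powR_ge0// -powRrM mulrCA divff ?gt_eqF// mulr1.
    by rewrite powRM ?(ltW eta0)//; ring.
  by rewrite powRM// mulrDr /B1 /B2 !mulrA.
pose nearb i := has (fun b => latdist i b <= 1)%N (boundary_cells D M h).
(* On far cells |f| is compared with its value at the corner; near the boundary the crude bound [Mg]
   is enough, as the volume there is O(h). *)
pose cc i : R := (if far_cell D M h i then (g (latpt h i) + eta) `^ q else 0) +
  Mg `^ q * (nearb i)%:R.
have cc0 i : 0 <= cc i.
  by rewrite addr_ge0//; [case: ifP => // _; exact: powR_ge0|rewrite mulr_ge0 ?powR_ge0].
have -> : integral f = (\int[@lebesgue_measureC R n]_(z in Omega) (g (realify z) `^ q)%:E)%E.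
  by apply: eq_integral => z _; rewrite /g /modulus realifyK.
have volume := @volume_integral_le R n Omega M DM h (fun x => g x `^ q) cc h0
  (fun x => powR_ge0 _ _) cc0.
apply: le_trans (volume _) _.
  move=> i x ig ix Dx; rewrite /cc; case: ifPn => [fi|fi].
    apply: ler_wpDr; first by rewrite mulr_ge0 ?powR_ge0.
    apply: ler_powRl; rewrite ?(ltW q0)//.
    have /andP[iI _] := fi; have ii := latpt_cube i (ltW h0).
    apply: gxy; [exact: subset_closure| |exact: cube_norm_le (ltW h0) ix ii].
    by apply: subset_closure; exact: (inner_cellsP DM i h0 iI).
  have [b bS ib] := far_cell_near oD DM h0 ix Dx fi.
  have -> : nearb i by apply/hasP; exists b.
  by rewrite add0r mulr1; apply: ler_powRl; rewrite ?(ltW q0)// gMg.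
rewrite lee_fin.
have hN : h ^+ N = h * h ^+ N.-1 by rewrite -exprS prednK.
have near_le : h ^+ N * \sum_(i <- grid n M h) Mg `^ q * (nearb i)%:R <= 3 ^+ N * Cr * Mg `^ q * h.
  rewrite -mulr_sumr.
  have -> : \sum_(i <- grid n M h) (nearb i)%:R = (count nearb (grid n M h))%:R :> R.
    by elim: (grid n M h) => [|b s' IH]; rewrite ?big_nil// big_cons IH -natrD.
  apply: (@le_trans _ _ (h ^+ N * (Mg `^ q * (size (boundary_cells D M h) * 3 ^ N)%:R))).
    rewrite ler_wpM2l ?exprn_ge0 ?(ltW h0)// ler_wpM2l ?powR_ge0// ler_nat.
    exact: count_near_boundary.
  rewrite natrM natrX hN.
  have -> : h * h ^+ N.-1 * (Mg `^ q * ((size (boundary_cells D M h))%:R * 3 ^+ N)) =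
     (h ^+ N.-1 * (size (boundary_cells D M h))%:R) * (3 ^+ N * Mg `^ q * h) by ring.
  have -> : 3 ^+ N * Cr * Mg `^ q * h = Cr * (3 ^+ N * Mg `^ q * h) by ring.
  by rewrite ler_wpM2r// mulr_ge0 ?(ltW h0)// mulr_ge0 ?powR_ge0// exprn_ge0.
have far_le : h ^+ N * \sum_(i <- grid n M h) (if far_cell D M h i then (g (latpt h i) + eta) `^ q else 0) <=
    2 `^ q * (K * T `^ (q / p) + r ^+ N * eta `^ q).
  rewrite -big_mkcond /=.
  apply: (@le_trans _ _ (h ^+ N * (2 `^ q * (\sum_(i <- grid n M h | far_cell D M h i) g (latpt h i) `^ q +
      (size (grid n M h))%:R * eta `^ q)))).
    rewrite ler_wpM2l ?exprn_ge0 ?(ltW h0)//.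
    have : \sum_(i <- grid n M h | far_cell D M h i) eta `^ q <= (size (grid n M h))%:R * eta `^ q.
      rewrite big_const_seq iter_addr_0 -[leLHS]mulr_natl ler_wpM2r ?powR_ge0// ler_nat.
      exact: count_size.
    move=> /(lerD (lexx (\sum_(i <- grid n M h | far_cell D M h i) g (latpt h i) `^ q))).
    rewrite -big_split /= => /(ler_wpM2l (powR_ge0 2 q)); apply: le_trans.
    by rewrite mulr_sumr; apply: ler_sum => i _; apply: powRD_le; rewrite ?(ltW q0) ?(ltW eta0).
  rewrite mulrCA ler_wpM2l ?powR_ge0// mulrDr; apply: lerD => //.
  by rewrite mulrA ler_wpM2r ?powR_ge0.
rewrite /cc big_split mulrDr /=; apply: lerD near_le.
apply: le_trans far_le _.
have -> : 2 `^ q * (K * B1) * Jr `^ (q / p) + 2 `^ q * (K * B2 + r ^+ N) * eta `^ q =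
   2 `^ q * (K * (B1 * Jr `^ (q / p) + B2 * eta `^ q) + r ^+ N * eta `^ q) by ring.
by rewrite ler_wpM2l ?powR_ge0// lerD2r ler_wpM2l.
Qed.

Lemma integral_bound : exists2 A : R, 0 <= A &
  forall f, holomorphic_on Omega f -> {within closure Omega, continuous f} ->
  forall Jr, bd_integral f = Jr%:E -> (integral f <= (A * Jr `^ (q / p))%:E)%E.
Proof.
have [A1 [A2 [A10 A20 H]]] := grid_integral_bound; exists A1 => // f holf cf Jr JE.
have [A3 A30 {}H] := H f holf cf Jr JE.
apply/lee_addgt0Pr => e e0; rewrite -EFinD.
(* Chosen for A2 t <= e / 2; [eta] is then t^(1 / q), as it enters to the power q. *)
pose t := e / 2 / (A2 + 1).
have t0 : 0 < t by rewrite !divr_gt0// ltr_wpDl.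
have [h0 h00 {}H] := H (t `^ q^-1) (powR_gt0 _ t0).
pose h := Num.min h0 (e / 2 / (A3 + 1)).
have A31 : 0 < A3 + 1 by rewrite ltr_wpDl.
have hp : 0 < h by rewrite lt_min h00 !divr_gt0.
apply: le_trans (H h hp _) _; first by rewrite ge_min lexx.
rewrite -powRrM mulVf ?gt_eqF// powRr1 ?(ltW t0)// lee_fin -addrA lerD2l.
have e20 : 0 <= e / 2 by rewrite divr_ge0// ltW.
have A2t : A2 * t <= e / 2.
  by rewrite mulrA ler_pdivrMr ?ltr_wpDl// mulrC ler_wpM2l// lerDl.
have A3h : A3 * h <= e / 2.
  apply: (@le_trans _ _ (A3 * (e / 2 / (A3 + 1)))); first by rewrite ler_wpM2l// ge_min lexx orbT.
  by rewrite mulrA ler_pdivrMr// mulrC ler_wpM2l// lerDl.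
lra.
Qed.

End Embedding.

Theorem corollary1p7 (R : realType) (n : nat) (Omega : set 'rV[R[i]]_n)
    (p q : R) :
  (0 < n)%N ->
  open Omega -> connected Omega -> bounded_set Omega ->
  lipschitz_boundary Omega ->
  1 <= p -> 1 <= q -> q * (2 * n%:R - 1) < 2 * n%:R * p ->
  exists delta : R, 0 < delta /\
    forall f : 'rV[R[i]]_n -> R[i],
      holomorphic_on Omega f -> {within closure Omega, continuous f} ->
      (delta%:E *
         (\int[@lebesgue_measureC R n]_(z in Omega)
            (Normc.normc (f z) `^ q)%:E) `^ q^-1
       <= (\int[@hausdorff_measure R n (2 * n - 1)]_(z in topological_boundary Omega)
            (Normc.normc (f z) `^ p)%:E) `^ p^-1)%E.
Proof.
move=> n0 oO _ bO lO p1 q1 pq.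
have p0 : 0 < p by exact: lt_le_trans p1.
have q0 : 0 < q by exact: lt_le_trans q1.
have [A A0 H] := integral_bound n0 oO bO lO p1 q1 pq.
have A1 : 0 < A + 1 by rewrite ltr_wpDl.
(* A + 1 rather than [A], which may be 0. *)
exists ((A + 1) `^ q^-1)^-1; split; first by rewrite invr_gt0 powR_gt0.
move=> f holf cf; set I := integral _ _ _; set J := integral _ _ _.
have J0 : (0 <= J)%E by apply: integral_ge0 => z _; rewrite lee_fin powR_ge0.
have I0 : (0 <= I)%E by apply: integral_ge0 => z _; rewrite lee_fin powR_ge0.
(* An infinite boundary integral makes the right side infinite; if it is finite, [integral_bound]
   makes the interior integral finite too and the rest is real arithmetic. *)
have [->|Joo] := eqVneq J +oo%E; first by rewrite poweRyr ?leey// gt_eqF// invr_gt0.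
have JE : J = (fine J)%:E by rewrite fineK// ge0_fin_numE// ltey.
have Jr0 : 0 <= fine J by exact: fine_ge0.
have IJ := H f holf cf (fine J) JE; rewrite -/I in IJ.
have IE : I = (fine I)%:E by rewrite fineK// ge0_fin_numE// (le_lt_trans IJ)// ltry.
rewrite JE IE !poweR_EFin -EFinM lee_fin; rewrite IE lee_fin in IJ.
rewrite ler_pdivrMl ?powR_gt0//.
apply: (@le_trans _ _ (((A + 1) * fine J `^ (q / p)) `^ q^-1)).
  apply: ler_powRl; rewrite ?invr_ge0 ?(ltW q0) ?fine_ge0//.
  by apply: le_trans IJ _; rewrite ler_wpM2r ?powR_ge0// lerDl.
rewrite powRM ?powR_ge0 ?(ltW A1)// -powRrM.
by rewrite mulrAC divff ?gt_eqF// mul1r.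
Qed.
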